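(* (1) Every injective homomorphism of ind-groups $\phi:\operatorname{Aut}(\mathbb A^n)\to\operatorname{Aut}(\mathbb A^n)$ is an isomorphism of ind-groups, and $\phi=\operatorname{Int}\mathbf g$ for a well-defined (i.e. uniquely determined) $\mathbf g\in\operatorname{Aut}(\mathbb A^n)$. (2) Every nontrivial homomorphism of ind-groups $\phi:\operatorname{SAut}(\mathbb A^n)\to\operatorname{SAut}(\mathbb A^n)$ is an isomorphism of ind-groups, and $\phi=\operatorname{Int}\mathbf g$ (restricted to $\operatorname{SAut}(\mathbb A^n)$) for a well-defined (i.e. uniquely determined) $\mathbf g\in\operatorname{Aut}(\mathbb A^n)$.
   Context: The base field $\Bbbk$ is algebraically closed of characteristic zero; varieties are over $\Bbbk$, and $\mathbb A^n=\Bbbk^n$ is affine $n$-space. An ind-variety is a set $\mathcal V$ with an ascending filtration $\mathcal V_0\subseteq\mathcal V_1\subseteq\cdots$, $\mathcal V=\bigcup_k\mathcal V_k$, such that each $\mathcal V_k$ is an algebraic variety and $\mathcal V_k$ is Zariski-closed in $\mathcal V_{k+1}$. A subset $S\subseteq\mathcal V$ is closed if $S\cap\mathcal V_k$ is closed in $\mathcal V_k$ for all $k$; a closed subset is itself an ind-variety. A morphism $\phi:\mathcal V\to\mathcal W$ of ind-varieties is a map such that for every $k$ there is an $m$ with $\phi(\mathcal V_k)\subseteq\mathcal W_m$ and $\mathcal V_k\to\mathcal W_m$ a morphism of varieties. An ind-group is an ind-variety with a group structure such that multiplication and inversion are morphisms; homomorphisms (isomorphisms) of ind-groups are group homomorphisms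 (isomorphisms) that are morphisms (isomorphisms) of ind-varieties. $\operatorname{Aut}(\mathbb A^n)$ is the ind-group of polynomial automorphisms $\mathbf f=(f_1,\dots,f_n)$ of $\mathbb A^n$: $\operatorname{End}(\mathbb A^n)=\Bbbk[x_1,\dots,x_n]^n$ is filtered by finite-dimensional subspaces, and $\operatorname{Aut}(\mathbb A^n)$ is identified with the closed subset $\{(\alpha,\beta)\mid\alpha\circ\beta=\beta\circ\alpha=\operatorname{id}\}$ of $\operatorname{End}(\mathbb A^n)\times\operatorname{End}(\mathbb A^n)$. $\operatorname{SAut}(\mathbb A^n)$ is the closed normal subgroup of those $\mathbf f$ with $\det\left(\frac{\partial f_i}{\partial x_j}\right)_{(i,j)}=1$. For $\mathbf g\in\operatorname{Aut}(\mathbb A^n)$, $\operatorname{Int}\mathbf g$ denotes conjugation $\mathbf h\mapsto\mathbf g\mathbf h\mathbf g^{-1}$. A homomorphism is nontrivial if it is not the constant map to the neutral element.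
   Formalization: In (2), uniqueness of g is claimed only for n ≠ 1: for n = 1, SAut(A^1) is the abelian group of translations, so g is determined only up to a translation; the other conclusions of (2) are kept for all n. *)

(* Defs.v *)
From HB Require Import structures.
From mathcomp Require Import all_boot all_order all_algebra.
From mathcomp Require Import mpoly.

Set Implicit Arguments.
Unset Strict Implicit.
Unset Printing Implicit Defensive.

Import GRing.Theory.
Local Open Scope ring_scope.

(* A map c : T -> 'rV[K]_N, injective on X and with Zariski-closed image c(X),
   makes X an affine variety embedded in affine N-space. *)

Definition zariski_closed (K : fieldType) N (Z : 'rV[K]_N -> Prop) : Prop :=
  exists I : {mpoly K[N]} -> Prop,
    forall v, Z v <-> (forall p, I p -> p.@[v ord0] = 0).

Definition regular_on (K : fieldType) T N (c : T -> 'rV[K]_N) (X : {pred T})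
    (f : T -> K) : Prop :=
  exists p : {mpoly K[N]}, {in X, forall x, f x = p.@[c x ord0]}.

Definition closed_on (K : fieldType) T N (c : T -> 'rV[K]_N) (X S : {pred T}) :
    Prop :=
  exists I : {mpoly K[N]} -> Prop,
    {in X, forall x, x \in S <-> (forall p, I p -> p.@[c x ord0] = 0)}.

Section Regular.
Context (K : fieldType) (T : Type) (N : nat) (c : T -> 'rV[K]_N).
Context (X : {pred T}).
Local Notation reg := (regular_on c X).

Lemma reg_ext f g : {in X, f =1 g} -> reg g -> reg f.
Proof. by move=> e [p Hp]; exists p => x xX; rewrite e ?Hp. Qed.

Lemma reg_const a : reg (fun=> a).
Proof. by exists a%:MP => x _; rewrite mevalC. Qed.

Lemma reg_coord j : reg (fun x => c x ord0 j).
Proof. by exists 'X_j => x _; rewrite mevalXU. Qed.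

Lemma reg_add f g : reg f -> reg g -> reg (fun x => f x + g x).
Proof.
by case=> p Hp [q Hq]; exists (p + q) => x xX; rewrite mevalD Hp ?Hq.
Qed.

Lemma reg_mul f g : reg f -> reg g -> reg (fun x => f x * g x).
Proof.
by case=> p Hp [q Hq]; exists (p * q) => x xX; rewrite mevalM Hp ?Hq.
Qed.

Lemma reg_sum (I : Type) (r : seq I) (P : pred I) (F : I -> T -> K) :
  (forall i, P i -> reg (F i)) -> reg (fun x => \sum_(i <- r | P i) F i x).
Proof.
move=> FP; elim: r => [|i r IH].
  by apply: reg_ext (reg_const 0) => x _; rewrite big_nil.
case Pi: (P i).
  by apply: reg_ext (reg_add (FP i Pi) IH) => x _; rewrite big_cons Pi.
by apply: reg_ext IH => x _; rewrite big_cons Pi.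
Qed.

Lemma reg_meval M (p : {mpoly K[M]}) (F : 'I_M -> T -> K) :
  (forall i, reg (F i)) -> reg (fun x => p.@[fun i => F i x]).
Proof.
move=> FP; have: forall i, exists q : {mpoly K[N]},
    {in X, forall x, F i x = q.@[c x ord0]} by exact: FP.
case/fin_all_exists => q Hq.
exists (p \mPo [tuple q i | i < M]) => x xX.
rewrite comp_mpoly_meval; apply: meval_eq => i.
by rewrite tnth_mktuple; apply: Hq.
Qed.

Lemma closed_on_zeros (A : Type) (g : A -> T -> K) (S : {pred T}) :
    (forall a, reg (g a)) -> (forall x, x \in S <-> forall a, g a x = 0) ->
  closed_on c X S.
Proof.
move=> greg gS; exists (fun p => exists a,
  {in X, forall x, g a x = p.@[c x ord0]}) => x xX; rewrite gS; split.
  by move=> g0 p [a Ha]; rewrite -Ha.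
by move=> I0 a; have [p Hp] := greg a; rewrite Hp // I0 //; exists a.
Qed.

End Regular.

(* Ind-varieties all of whose steps are affine: ind_filt d is an affine variety,
   embedded in affine space by ind_chart d, whose values outside ind_filt d are
   irrelevant.  The last three axioms say that ind_filt d is a closed subvariety
   of ind_filt d.+1. *)
HB.mixin Record isAffIndVariety (K : fieldType) T := {
  ind_filt : nat -> {pred T};
  ind_dim : nat -> nat;
  ind_chart : forall d, T -> 'rV[K]_(ind_dim d);
  ind_filtS : forall d, {subset ind_filt d <= ind_filt d.+1};
  ind_filt_cover : forall x, exists d, x \in ind_filt d;
  ind_chart_inj : forall d, {in ind_filt d &, injective (ind_chart d)};
  ind_chart_closed : forall d,
    zariski_closed (fun v => exists2 x, x \in ind_filt d & v = ind_chart d x);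
  ind_filt_closed : forall d,
    closed_on (ind_chart d.+1) (ind_filt d.+1) (ind_filt d);
  ind_chart_up : forall d j,
    regular_on (ind_chart d) (ind_filt d) (fun x => ind_chart d.+1 x ord0 j);
  ind_chart_down : forall d j,
    regular_on (ind_chart d.+1) (ind_filt d) (fun x => ind_chart d x ord0 j)
}.

#[short(type="affIndVarietyType")]
HB.structure Definition AffIndVariety (K : fieldType) :=
  {T of isAffIndVariety K T}.

Definition ind_closed (K : fieldType) (V : affIndVarietyType K)
    (S : {pred V}) : Prop :=
  forall d, closed_on (@ind_chart K V d) (ind_filt d) S.

Definition ind_morphism (K : fieldType) (V W : affIndVarietyType K)
    (f : V -> W) : Prop :=
  forall d, exists e,
    {in ind_filt d, forall x, f x \in ind_filt e} /\
    forall j, regular_on (@ind_chart K V d) (ind_filt d)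
                (fun x => ind_chart e (f x) ord0 j).

(* A closed subset of an ind-variety, with the induced filtration. *)
HB.factory Record ClosedSub_isAffIndVariety (K : fieldType)
    (V : affIndVarietyType K) (P : pred V) U of SubType V P U := {
  ind_closed_subproof : ind_closed P
}.

HB.builders Context K V P U of ClosedSub_isAffIndVariety K V P U.

Let filt d : {pred U} := [pred u | \val u \in (ind_filt d : {pred V})].
Let chart d (u : U) := @ind_chart K V d (\val u).

Fact filtS d : {subset filt d <= filt d.+1}.
Proof. by move=> u; rewrite !inE; apply: ind_filtS. Qed.

Fact filt_cover u : exists d, u \in filt d.
Proof. exact: (ind_filt_cover (\val u)). Qed.

Fact chart_inj d : {in filt d &, injective (chart d)}.
Proof. by move=> u v uF vF /(ind_chart_inj _ _ _ uF vF) /val_inj. Qed.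

Fact chart_closed d :
  zariski_closed (fun v => exists2 x, x \in filt d & v = chart d x).
Proof.
have [I HI] := @ind_chart_closed K V d.
have [J HJ] := ind_closed_subproof d.
exists (fun p => I p \/ J p) => v; split.
  case=> u uF -> p [Ip|Jp].
    by apply: (iffLR (HI _)) Ip; exists (\val u).
  by apply: (iffLR (HJ _ uF)) Jp; apply: valP.
move=> v0; have /HI[x xF vE] : forall p, I p -> p.@[v ord0] = 0.
  by move=> p Ip; apply: v0; left.
have /(HJ _ xF) Px : forall p, J p -> p.@[ind_chart d x ord0] = 0.
  by move=> p Jp; rewrite -vE; apply: v0; right.
by exists (Sub x Px); rewrite /chart ?inE SubK.
Qed.

Fact filt_closed d : closed_on (chart d.+1) (filt d.+1) (filt d).
Proof.
by have [I HI] := @ind_filt_closed K V d; exists I => u uF; apply: HI.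
Qed.

Fact chart_up d j :
  regular_on (chart d) (filt d) (fun x => chart d.+1 x ord0 j).
Proof.
by have [p Hp] := @ind_chart_up K V d j; exists p => u uF; apply: Hp.
Qed.

Fact chart_down d j :
  regular_on (chart d.+1) (filt d) (fun x => chart d x ord0 j).
Proof.
by have [p Hp] := @ind_chart_down K V d j; exists p => u uF; apply: Hp.
Qed.

HB.instance Definition _ := isAffIndVariety.Build K U filtS filt_cover
  chart_inj chart_closed filt_closed chart_up chart_down.

HB.end.

Section Product.
Context (K : fieldType) (V W : affIndVarietyType K).

Definition prod_filt d : {pred V * W} :=
  [pred x | (x.1 \in ind_filt d) && (x.2 \in ind_filt d)].
Definition prod_chart d (x : V * W) : 'rV[K]_(@ind_dim K V d + @ind_dim K W d) :=
  row_mx (ind_chart d x.1) (ind_chart d x.2).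

Fact prod_filtS d : {subset prod_filt d <= prod_filt d.+1}.
Proof. by move=> x /andP[x1 x2]; rewrite inE !ind_filtS. Qed.

Fact ind_filt_le (U : affIndVarietyType K) d e :
  {subset (ind_filt d : {pred U}) <= ind_filt (d + e)}.
Proof.
by elim: e => [|e IH] x xd; rewrite ?addn0 // addnS ind_filtS ?IH.
Qed.

Fact prod_filt_cover x : exists d, x \in prod_filt d.
Proof.
have [d xd] := ind_filt_cover x.1; have [e xe] := ind_filt_cover x.2.
by exists (d + e)%N; rewrite inE ind_filt_le //= addnC ind_filt_le.
Qed.

Fact prod_chart_inj d : {in prod_filt d &, injective (prod_chart d)}.
Proof.
move=> [x1 x2] [y1 y2] /andP[/= xF1 xF2] /andP[/= yF1 yF2].
by case/eq_row_mx=> /= /(ind_chart_inj _ _ _ xF1 yF1) -> /(ind_chart_inj _ _ _ xF2 yF2) ->.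
Qed.

Definition mpoly_liftl M N (p : {mpoly K[M]}) : {mpoly K[M + N]} :=
  p \mPo [tuple 'X_(lshift N i) | i < M].
Definition mpoly_liftr M N (p : {mpoly K[N]}) : {mpoly K[M + N]} :=
  p \mPo [tuple 'X_(rshift M i) | i < N].

Lemma mpoly_liftlE M N p (u : 'rV[K]_M) (v : 'rV[K]_N) :
  (mpoly_liftl N p).@[row_mx u v ord0] = p.@[u ord0].
Proof.
rewrite comp_mpoly_meval; apply: meval_eq => i.
by rewrite tnth_mktuple mevalXU row_mxEl.
Qed.

Lemma mpoly_liftrE M N p (u : 'rV[K]_M) (v : 'rV[K]_N) :
  (mpoly_liftr M p).@[row_mx u v ord0] = p.@[v ord0].
Proof.
rewrite comp_mpoly_meval; apply: meval_eq => i.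
by rewrite tnth_mktuple mevalXU row_mxEr.
Qed.

Fact prod_chart_closed d :
  zariski_closed (fun v => exists2 x, x \in prod_filt d & v = prod_chart d x).
Proof.
have [I HI] := @ind_chart_closed K V d.
have [J HJ] := @ind_chart_closed K W d.
exists (fun q => (exists2 p, I p & q = mpoly_liftl _ p) \/
                 (exists2 p, J p & q = mpoly_liftr _ p)) => v; split.
  case=> -[x y] /andP[/= xF yF] -> q [] [p Ip ->].
    by rewrite mpoly_liftlE; apply: (iffLR (HI _)) Ip; exists x.
  by rewrite mpoly_liftrE; apply: (iffLR (HJ _)) Ip; exists y.
rewrite -[v]hsubmxK => v0.
have /HI[x xF xE] : forall p, I p -> p.@[lsubmx v ord0] = 0.
  by move=> p Ip; rewrite -(mpoly_liftlE _ _ (rsubmx v)) v0 //; left; exists p.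
have /HJ[y yF yE] : forall p, J p -> p.@[rsubmx v ord0] = 0.
  by move=> p Jp; rewrite -(mpoly_liftrE _ (lsubmx v)) v0 //; right; exists p.
by exists (x, y); rewrite ?inE ?xF ?yF //= xE yE.
Qed.

Fact prod_filt_closed d : closed_on (prod_chart d.+1) (prod_filt d.+1) (prod_filt d).
Proof.
have [I HI] := @ind_filt_closed K V d.
have [J HJ] := @ind_filt_closed K W d.
exists (fun q => (exists2 p, I p & q = mpoly_liftl _ p) \/
                 (exists2 p, J p & q = mpoly_liftr _ p)).
move=> [x y] /andP[/= xF yF]; split.
  case/andP=> /= xd yd q [] [p Ip ->].
    by rewrite mpoly_liftlE; apply: (iffLR (HI _ xF)) Ip.
  by rewrite mpoly_liftrE; apply: (iffLR (HJ _ yF)) Ip.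
move=> v0; rewrite inE /=; apply/andP; split.
  apply/(HI _ xF) => p Ip.
  by rewrite -(mpoly_liftlE _ _ (ind_chart d.+1 y)) v0 //; left; exists p.
apply/(HJ _ yF) => p Jp.
by rewrite -(mpoly_liftrE _ (ind_chart d.+1 x)) v0 //; right; exists p.
Qed.

Lemma reg_fst d e f :
    regular_on (@ind_chart K V d) (ind_filt e) f ->
  regular_on (prod_chart d) (prod_filt e) (fun x => f x.1).
Proof.
case=> p Hp; exists (mpoly_liftl _ p) => -[x y] /andP[/= xF _].
by rewrite mpoly_liftlE Hp.
Qed.

Lemma reg_snd d e f :
    regular_on (@ind_chart K W d) (ind_filt e) f ->
  regular_on (prod_chart d) (prod_filt e) (fun x => f x.2).
Proof.
case=> p Hp; exists (mpoly_liftr _ p) => -[x y] /andP[/= _ yF].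
by rewrite mpoly_liftrE Hp.
Qed.

Fact prod_chart_up d j :
  regular_on (prod_chart d) (prod_filt d) (fun x => prod_chart d.+1 x ord0 j).
Proof.
rewrite -(splitK j); case: (split j) => {}j /=.
  apply: reg_ext (reg_fst (ind_chart_up d j)) => x _; exact: row_mxEl.
apply: reg_ext (reg_snd (ind_chart_up d j)) => x _; exact: row_mxEr.
Qed.

Fact prod_chart_down d j :
  regular_on (prod_chart d.+1) (prod_filt d) (fun x => prod_chart d x ord0 j).
Proof.
rewrite -(splitK j); case: (split j) => {}j /=.
  apply: reg_ext (reg_fst (ind_chart_down d j)) => x _; exact: row_mxEl.
apply: reg_ext (reg_snd (ind_chart_down d j)) => x _; exact: row_mxEr.
Qed.

HB.instance Definition _ := isAffIndVariety.Build K (V * W)%type prod_filtS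
  prod_filt_cover prod_chart_inj prod_chart_closed prod_filt_closed
  prod_chart_up prod_chart_down.

End Product.

HB.mixin Record isAffIndGroup (K : fieldType) G
    of Group G & isAffIndVariety K G := {
  ind_mulg_morphism : ind_morphism (fun x : G * G => (x.1 * x.2)%g);
  ind_invg_morphism : ind_morphism (fun x : G => x^-1%g)
}.

#[short(type="affIndGroupType")]
HB.structure Definition AffIndGroup (K : fieldType) :=
  {G of isAffIndGroup K G & Group G & isAffIndVariety K G}.

Definition ind_group_hom (K : fieldType) (G H : affIndGroupType K)
    (phi : G -> H) : Prop :=
  {morph phi : x y / (x * y)%g} /\ ind_morphism phi.

Definition ind_group_iso (K : fieldType) (G H : affIndGroupType K)
    (phi : G -> H) : Prop :=
  ind_group_hom phi /\
  exists psi : H -> G, [/\ ind_group_hom psi, cancel phi psi & cancel psi phi].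

Lemma mnm_subnn n (m : 'X_{1..n}) : (m - m = 0)%MM.
Proof. by apply/mnmP => i; rewrite mnmBE mnm0E subnn. Qed.

Lemma msize_mul_leq (K : fieldType) n (p q : {mpoly K[n]}) a b :
  (msize p <= a.+1 -> msize q <= b.+1 -> msize (p * q) <= (a + b).+1)%N.
Proof.
move=> pa qb; have [->|p0] := eqVneq p 0; first by rewrite mul0r msize0.
have [->|q0] := eqVneq q 0; first by rewrite mulr0 msize0.
by rewrite msizeM // -subn1 leq_subLR add1n -addSn -addnS leq_add.
Qed.

Lemma msize_comp_leq (K : fieldType) n k (p : {mpoly K[n]})
    (lq : n.-tuple {mpoly K[k]}) d e :
    (msize p <= d.+1)%N -> (forall i, msize (tnth lq i) <= e.+1)%N ->
  (msize (p \mPo lq) <= (d * e).+1)%N.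
Proof.
move=> pd lqe; rewrite (comp_mpolywE _ pd).
apply: leq_trans (msize_sum _ _ _) _.
apply/bigmax_leqP_seq => m _ _; apply: leq_trans (msizeZ_le _ _) _.
have le_m : (\sum_(i < n) m i * e <= d * e)%N.
  by rewrite -big_distrl /= -mdegE leq_mul2r -ltnS bmdeg orbT.
apply: leq_trans (_ : _ <= (\sum_(i < n) m i * e).+1)%N _; last by rewrite ltnS.
elim/big_rec2: _ => [|i a q _ IH]; first by rewrite msize1.
apply: msize_mul_leq => //; elim: (m i : nat) => [|j IHj].
  by rewrite expr0 msize1.
by rewrite exprS mulSn msize_mul_leq.
Qed.

Lemma comp_mpolyA (K : fieldType) n k l (p : {mpoly K[n]})
    (f : n.-tuple {mpoly K[k]}) (g : k.-tuple {mpoly K[l]}) :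
  (p \mPo f) \mPo g = p \mPo [tuple tnth f i \mPo g | i < n].
Proof.
rewrite (comp_mpolyE p f) (comp_mpolyE p [tuple _ | _ < _]) raddf_sum /=.
apply: eq_bigr => m _; rewrite comp_mpolyZ rmorph_prod /=; congr (_ *: _).
by apply: eq_bigr => i _; rewrite rmorphXn /= tnth_mktuple.
Qed.

Lemma comp_mpolyXt (K : fieldType) n k (f : n.-tuple {mpoly K[k]}) i :
  'X_i \mPo f = tnth f i.
Proof. by rewrite comp_mpolyXU -tnth_nth. Qed.

Lemma mderiv_comp (K : fieldType) n k (p : {mpoly K[n]})
    (f : n.-tuple {mpoly K[k]}) j :
  (p \mPo f)^`M(j) = \sum_i (p^`M(i) \mPo f) * (tnth f i)^`M(j).
Proof.
pose P q := (q \mPo f)^`M(j) = \sum_i (q^`M(i) \mPo f) * (tnth f i)^`M(j).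
have P1 : P 1.
  rewrite /P comp_mpoly1 -mpolyC1 mderivC big1 // => i _.
  by rewrite mderivC comp_mpoly0 mul0r.
have PM q r : P q -> P r -> P (q * r).
  rewrite /P rmorphM mderivM /= => -> ->; rewrite mulr_suml mulr_sumr.
  rewrite -big_split; apply: eq_bigr => i _ /=.
  by rewrite mderivM comp_mpolyD !rmorphM /= mulrDl mulrA mulrAC.
have PX i : P 'X_i.
  rewrite /P comp_mpolyXt (bigD1 i) //= big1 ?addr0 => [|l li].
    by rewrite mderivX mnm1E eqxx mnm_subnn mpolyX0 scale1r comp_mpoly1 mul1r.
  by rewrite mderivX mnm1E eq_sym (negPf li) scale0r comp_mpoly0 mul0r.
have PXn i a : P ('X_i ^+ a).
  by elim: a => [|a IHa]; rewrite ?expr0 // exprS; apply: (PM _ _ (PX i) IHa).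
rewrite -/(P p); elim/mpolyind: p => [|c m p _ _ IH].
  rewrite /P comp_mpoly0 mderiv0 big1 // => i _.
  by rewrite mderiv0 comp_mpoly0 mul0r.
have Pm : P 'X_[m].
  rewrite mpolyXE_id; elim/big_rec: _ => // i q _ Pq.
  exact: PM (PXn i (m i)) Pq.
rewrite /P comp_mpolyD comp_mpolyZ mderivD mderivZ IH Pm scaler_sumr.
rewrite -big_split; apply: eq_bigr => i _ /=.
by rewrite mderivD mderivZ comp_mpolyD comp_mpolyZ mulrDl scalerAl.
Qed.

(* Families of polynomials whose coefficients are regular functions. *)
Section RegularFamily.
Context (K : fieldType) (T : Type) (N : nat) (c : T -> 'rV[K]_N).
Context (X : {pred T}) (n : nat).

Definition reg_mpoly (P : T -> {mpoly K[n]}) : Prop :=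
  forall m, regular_on c X (fun x => (P x)@_m).

Lemma reg_mpoly_ext P Q : {in X, P =1 Q} -> reg_mpoly Q -> reg_mpoly P.
Proof. by move=> PQ HQ m; apply: reg_ext (HQ m) => x xX; rewrite PQ. Qed.

Lemma reg_mpoly_const p : reg_mpoly (fun=> p).
Proof. by move=> m; apply: reg_const. Qed.

Lemma reg_mpolyD P Q :
  reg_mpoly P -> reg_mpoly Q -> reg_mpoly (fun x => P x + Q x).
Proof.
by move=> HP HQ m; apply: reg_ext (reg_add (HP m) (HQ m)) => x _; rewrite mcoeffD.
Qed.

Lemma reg_mpolyZ f P :
  regular_on c X f -> reg_mpoly P -> reg_mpoly (fun x => f x *: P x).
Proof.
by move=> Hf HP m; apply: reg_ext (reg_mul Hf (HP m)) => x _; rewrite mcoeffZ.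
Qed.

Lemma reg_mpolyM P Q :
  reg_mpoly P -> reg_mpoly Q -> reg_mpoly (fun x => P x * Q x).
Proof.
move=> HP HQ m.
have H k : regular_on c X (fun x => (P x)@_k.1 * (Q x)@_k.2).
  exact: reg_mul (HP k.1) (HQ k.2).
apply: reg_ext (reg_sum _ (fun k _ => H (val k.1, val k.2))) => x _.
exact: mcoeffM.
Qed.

Lemma reg_mpoly_sum (I : Type) (r : seq I) (F : I -> T -> {mpoly K[n]}) :
  (forall i, reg_mpoly (F i)) -> reg_mpoly (fun x => \sum_(i <- r) F i x).
Proof.
move=> HF; elim: r => [|i r IH].
  by apply: reg_mpoly_ext (reg_mpoly_const 0) => x _; rewrite big_nil.
by apply: reg_mpoly_ext (reg_mpolyD (HF i) IH) => x _; rewrite big_cons.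
Qed.

Lemma reg_mpoly_prod (I : Type) (r : seq I) (F : I -> T -> {mpoly K[n]}) :
  (forall i, reg_mpoly (F i)) -> reg_mpoly (fun x => \prod_(i <- r) F i x).
Proof.
move=> HF; elim: r => [|i r IH].
  by apply: reg_mpoly_ext (reg_mpoly_const 1) => x _; rewrite big_nil.
by apply: reg_mpoly_ext (reg_mpolyM (HF i) IH) => x _; rewrite big_cons.
Qed.

Lemma reg_mpolyX P a : reg_mpoly P -> reg_mpoly (fun x => P x ^+ a).
Proof.
move=> HP; elim: a => [|a IH]; first exact: reg_mpoly_const.
by apply: reg_mpoly_ext (reg_mpolyM HP IH) => x _; rewrite exprS.
Qed.

Lemma reg_mpoly_deriv P j : reg_mpoly P -> reg_mpoly (fun x => (P x)^`M(j)).
Proof.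
move=> HP m.
have H := reg_mul (reg_const c X (m j).+1%:R) (HP (m + U_(j))%MM).
by apply: reg_ext H => x _; rewrite mcoeff_mderiv mulr_natl.
Qed.

Lemma reg_mpoly_det k (F : T -> 'M[{mpoly K[n]}]_k) :
  (forall i j, reg_mpoly (fun x => F x i j)) ->
  reg_mpoly (fun x => \det (F x)).
Proof.
move=> HF; apply: reg_mpoly_sum => s; apply: reg_mpolyM.
  exact: reg_mpoly_const.
by apply: reg_mpoly_prod => i.
Qed.

End RegularFamily.

Lemma reg_mpoly_comp (K : fieldType) T N (c : T -> 'rV[K]_N) (X : {pred T}) n k
    (P : T -> {mpoly K[n]}) (Q : T -> n.-tuple {mpoly K[k]}) w :
    {in X, forall x, msize (P x) <= w}%N -> reg_mpoly c X P ->
    (forall i, reg_mpoly c X (fun x => tnth (Q x) i)) ->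
  reg_mpoly c X (fun x => P x \mPo Q x).
Proof.
move=> Pw HP HQ.
pose F (m : 'X_{1..n < w}) x :=
  (P x)@_m *: \prod_(i < n) (tnth (Q x) i) ^+ (m i).
apply: (@reg_mpoly_ext _ _ _ _ _ _ _
  (fun x => \sum_(m <- index_enum 'X_{1..n < w}) F m x)) => [x xX|].
  exact: comp_mpolywE (Pw x xX).
apply: reg_mpoly_sum => m; apply: reg_mpolyZ (HP m) _.
by apply: reg_mpoly_prod => i; apply: reg_mpolyX.
Qed.

Section PolyEnd.
Context (K : fieldType) (n : nat).

(* The tuple f stands for the polynomial map (f_1, ..., f_n) of affine
   n-space. *)
Definition polyEnd := n.-tuple {mpoly K[n]}.

HB.instance Definition _ := Choice.on polyEnd.

Implicit Types f g h : polyEnd.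

(* msize p <= d.+1 says that p has degree at most d. *)
Definition polyEnd_filt d : {pred polyEnd} :=
  [pred f : polyEnd | [forall i, msize (tnth f i) <= d.+1]%N].

(* The coordinates of f are the coefficients of the f_i, up to degree d. *)
Definition polyEnd_dim d := #|{: 'I_n * 'X_{1..n < d.+1}}|.

Definition polyEnd_index d (j : 'I_(polyEnd_dim d)) : 'I_n * 'X_{1..n < d.+1} :=
  enum_val j.

Definition polyEnd_rank d (a : 'I_n * 'X_{1..n < d.+1}) : 'I_(polyEnd_dim d) :=
  enum_rank a.

Fact polyEnd_rankK d : cancel (@polyEnd_rank d) (@polyEnd_index d).
Proof. exact: enum_rankK. Qed.

Fact polyEnd_indexK d : cancel (@polyEnd_index d) (@polyEnd_rank d).
Proof. exact: enum_valK. Qed.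

Definition polyEnd_chart d f : 'rV[K]_(polyEnd_dim d) :=
  \row_(j < polyEnd_dim d) (tnth f (polyEnd_index j).1)@_((polyEnd_index j).2).

Fact polyEnd_filtP d f :
  reflect (forall i, msize (tnth f i) <= d.+1)%N (f \in polyEnd_filt d).
Proof. exact: forallP. Qed.

Lemma mcoeff_gt_msize (p : {mpoly K[n]}) d m :
  (msize p <= d.+1)%N -> (d < mdeg m)%N -> p@_m = 0.
Proof. by move=> pd dm; apply/memN_msupp_eq0/msize_mdeg_ge/(leq_trans pd). Qed.

Lemma reg_mpoly_tnth d i :
  reg_mpoly (polyEnd_chart d) (polyEnd_filt d) (fun f => tnth f i).
Proof.
move=> m; have [md|dm] := ltnP (mdeg m) d.+1.
  apply: reg_ext (reg_coord _ _ (polyEnd_rank (i, BMultinom md))) => f _.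
  by rewrite mxE polyEnd_rankK.
apply: reg_ext (reg_const _ _ 0) => f /polyEnd_filtP/(_ i) fd.
exact: mcoeff_gt_msize fd dm.
Qed.

Fact polyEnd_filtS d : {subset polyEnd_filt d <= polyEnd_filt d.+1}.
Proof.
move=> f /polyEnd_filtP fd; apply/polyEnd_filtP => i.
exact: leq_trans (fd i) _.
Qed.

Fact polyEnd_filt_cover f : exists d, f \in polyEnd_filt d.
Proof.
exists (\max_(i < n) msize (tnth f i))%N; apply/polyEnd_filtP => i.
by apply/leqW/(leq_bigmax i).
Qed.

Fact polyEnd_chart_inj d : {in polyEnd_filt d &, injective (@polyEnd_chart d)}.
Proof.
move=> f g /polyEnd_filtP fd /polyEnd_filtP gd /rowP fg.
apply/eq_from_tnth => i; apply/mpolyP => m.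
have [md|dm] := ltnP (mdeg m) d.+1; last first.
  by rewrite !(@mcoeff_gt_msize _ d).
by have := fg (polyEnd_rank (i, BMultinom md)); rewrite !mxE polyEnd_rankK.
Qed.

Fact polyEnd_chart_closed d : zariski_closed
  (fun v => exists2 f, f \in polyEnd_filt d & v = polyEnd_chart d f).
Proof.
exists (fun=> False) => v; split=> // _.
pose F i : {mpoly K[n]} :=
  \sum_(m : 'X_{1..n < d.+1}) v ord0 (polyEnd_rank (i, m)) *: 'X_[m].
exists [tuple F i | i < n].
  apply/polyEnd_filtP => i; rewrite tnth_mktuple.
  apply: leq_trans (msize_sum _ _ _) _; apply/bigmax_leqP_seq => m _ _.
  by apply: leq_trans (msizeZ_le _ _) _; rewrite msizeX bmdeg.
apply/rowP => j; rewrite mxE tnth_mktuple; case ej: (polyEnd_index j) => [i m] /=.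
rewrite raddf_sum (bigD1 m) //= mcoeffZ mcoeffX eqxx mulr1 -ej polyEnd_indexK.
rewrite big1 ?addr0 // => m' m'm.
by rewrite mcoeffZ mcoeffX (inj_eq val_inj) (negPf m'm) mulr0.
Qed.

Fact polyEnd_filt_closed d :
  closed_on (@polyEnd_chart d.+1) (polyEnd_filt d.+1) (polyEnd_filt d).
Proof.
pose g (a : 'I_n * 'X_{1..n}) f :=
  if (d < mdeg a.2)%N then (tnth f a.1)@_a.2 else 0.
apply: (@closed_on_zeros _ _ _ _ _ _ g) => [[i m]|f].
  rewrite /g /=; case: (d < mdeg m)%N; last exact: reg_const.
  exact: reg_mpoly_tnth.
split=> [/polyEnd_filtP fd [i m]|f0].
  by rewrite /g /=; case: ifP => // dm; apply: mcoeff_gt_msize (fd i) dm.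
apply/polyEnd_filtP => i; rewrite msizeE; apply/bigmax_leqP_seq => m.
rewrite mcoeff_msupp => fm _; rewrite ltnS leqNgt.
by apply: contraNN fm => dm; have := f0 (i, m); rewrite /g /= dm => ->.
Qed.

Fact polyEnd_chart_up d j : regular_on (@polyEnd_chart d) (polyEnd_filt d)
  (fun f => polyEnd_chart d.+1 f ord0 j).
Proof.
by apply: reg_ext (reg_mpoly_tnth _ _ _) => f _; rewrite mxE.
Qed.

Fact polyEnd_chart_down d j :
  regular_on (@polyEnd_chart d.+1) (polyEnd_filt d)
  (fun f => polyEnd_chart d f ord0 j).
Proof.
have [p Hp] := @reg_mpoly_tnth d.+1 (polyEnd_index j).1 (polyEnd_index j).2.
by exists p => f fd; rewrite -Hp ?mxE // polyEnd_filtS.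
Qed.

HB.instance Definition _ := isAffIndVariety.Build K polyEnd polyEnd_filtS
  polyEnd_filt_cover polyEnd_chart_inj polyEnd_chart_closed polyEnd_filt_closed
  polyEnd_chart_up polyEnd_chart_down.

Definition polyEnd_id : polyEnd := [tuple 'X_i | i < n].
Definition polyEnd_comp f g : polyEnd := [tuple tnth f i \mPo g | i < n].

Lemma polyEnd_compA : associative polyEnd_comp.
Proof.
move=> f g h; apply/eq_from_tnth => i.
by rewrite !tnth_mktuple comp_mpolyA.
Qed.

Lemma polyEnd_comp1f : left_id polyEnd_id polyEnd_comp.
Proof.
by move=> f; apply/eq_from_tnth => i; rewrite !tnth_mktuple comp_mpolyXt.
Qed.

Lemma polyEnd_compf1 : right_id polyEnd_id polyEnd_comp.
Proof.
by move=> f; apply/eq_from_tnth => i; rewrite tnth_mktuple comp_mpoly_id.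
Qed.

Lemma polyEnd_comp_filt d e f g :
    f \in polyEnd_filt d -> g \in polyEnd_filt e ->
  polyEnd_comp f g \in polyEnd_filt (d * e).
Proof.
move=> /polyEnd_filtP fd /polyEnd_filtP ge; apply/polyEnd_filtP => i.
by rewrite tnth_mktuple msize_comp_leq.
Qed.

Lemma reg_polyEnd_comp T N (c : T -> 'rV[K]_N) (X : {pred T})
    (F G : T -> polyEnd) d :
    {in X, forall x, F x \in polyEnd_filt d} ->
    (forall i, reg_mpoly c X (fun x => tnth (F x) i)) ->
    (forall i, reg_mpoly c X (fun x => tnth (G x) i)) ->
  forall i, reg_mpoly c X (fun x => tnth (polyEnd_comp (F x) (G x)) i).
Proof.
move=> Fd HF HG i.
have H : {in X, forall x, msize (tnth (F x) i) <= d.+1}%N.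
  by move=> x xX; apply/polyEnd_filtP/Fd.
apply: reg_mpoly_ext (reg_mpoly_comp H (HF i) HG) => x _.
by rewrite tnth_mktuple.
Qed.

(* An automorphism is a pair consisting of a polynomial map (the first
   component) and its inverse. *)
Definition polyAut_pred : pred (polyEnd * polyEnd) :=
  [pred x | (polyEnd_comp x.1 x.2 == polyEnd_id) &&
            (polyEnd_comp x.2 x.1 == polyEnd_id)].

Fact polyAut_closed : ind_closed polyAut_pred.
Proof.
move=> d.
pose C := @ind_chart K (polyEnd * polyEnd)%type d.
pose X : {pred polyEnd * polyEnd} := ind_filt d.
have H1 i : reg_mpoly C X (fun x => tnth x.1 i).
  by move=> m; apply: reg_fst (reg_mpoly_tnth d i m).
have H2 i : reg_mpoly C X (fun x => tnth x.2 i).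
  by move=> m; apply: reg_snd (reg_mpoly_tnth d i m).
have X1 : {in X, forall x, x.1 \in polyEnd_filt d} by move=> x /andP[].
have X2 : {in X, forall x, x.2 \in polyEnd_filt d} by move=> x /andP[].
have H12 := reg_polyEnd_comp X1 H1 H2.
have H21 := reg_polyEnd_comp X2 H2 H1.
pose g (a : bool * 'I_n * 'X_{1..n}) (x : polyEnd * polyEnd) : K :=
  (if a.1.1 then tnth (polyEnd_comp x.1 x.2) a.1.2
   else tnth (polyEnd_comp x.2 x.1) a.1.2)@_a.2 - ('X_a.1.2)@_a.2.
apply: (@closed_on_zeros _ _ _ _ _ _ g) => [[[b i] m]|x].
  apply: reg_add; last exact: reg_const.
  by case: b; [apply: H12 | apply: H21].
split=> [/andP[/eqP e1 /eqP e2] [[b i] m]|g0].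
  by rewrite /g /= e1 e2 if_same tnth_mktuple subrr.
rewrite inE; apply/andP; split; apply/eqP/eq_from_tnth => i;
  apply/mpolyP => m; apply/eqP; rewrite tnth_mktuple -subr_eq0; apply/eqP.
  by rewrite -[RHS](g0 (true, i, m)) /g /= !tnth_mktuple.
by rewrite -[RHS](g0 (false, i, m)) /g /= !tnth_mktuple.
Qed.

Record polyAut := PolyAut {
  polyAut_val : (polyEnd * polyEnd)%type;
  _ : polyAut_pred polyAut_val
}.

HB.instance Definition _ := [isSub for polyAut_val].
HB.instance Definition _ := [Choice of polyAut by <:].
HB.instance Definition _ :=
  ClosedSub_isAffIndVariety.Build K (polyEnd * polyEnd)%type polyAut_pred
    polyAut polyAut_closed.

Definition polyAut_map (f : polyAut) : polyEnd := (val f).1.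
Definition polyAut_inv_map (f : polyAut) : polyEnd := (val f).2.

Lemma polyAutK (f : polyAut) :
  polyEnd_comp (polyAut_map f) (polyAut_inv_map f) = polyEnd_id.
Proof. by case/andP: (valP f) => /eqP. Qed.

Lemma polyAutVK (f : polyAut) :
  polyEnd_comp (polyAut_inv_map f) (polyAut_map f) = polyEnd_id.
Proof. by case/andP: (valP f) => _ /eqP. Qed.

Lemma polyAut_map_inj : injective polyAut_map.
Proof.
move=> f g fg; apply/val_inj/injective_projections => //.
rewrite -[LHS]polyEnd_compf1 -(polyAutK g) polyEnd_compA -fg.
by rewrite polyAutVK polyEnd_comp1f.
Qed.

Fact polyAut_one_subproof : polyAut_pred (polyEnd_id, polyEnd_id).
Proof. by rewrite /polyAut_pred /= polyEnd_comp1f eqxx. Qed.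

Fact polyAut_inv_subproof (f : polyAut) :
  polyAut_pred (polyAut_inv_map f, polyAut_map f).
Proof. by rewrite /polyAut_pred /= polyAutK polyAutVK eqxx. Qed.

Fact polyAut_mul_subproof (f g : polyAut) :
  polyAut_pred (polyEnd_comp (polyAut_map f) (polyAut_map g),
                polyEnd_comp (polyAut_inv_map g) (polyAut_inv_map f)).
Proof.
rewrite /polyAut_pred /= polyEnd_compA
  -(polyEnd_compA _ _ (polyAut_inv_map g)) polyAutK.
rewrite polyEnd_compf1 polyAutK polyEnd_compA.
rewrite -(polyEnd_compA _ _ (polyAut_map f)) polyAutVK.
by rewrite polyEnd_compf1 polyAutVK eqxx.
Qed.

Definition polyAut_one := PolyAut polyAut_one_subproof.
Definition polyAut_inv (f : polyAut) := PolyAut (polyAut_inv_subproof f).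
Definition polyAut_mul (f g : polyAut) := PolyAut (polyAut_mul_subproof f g).

Fact polyAut_mulA : associative polyAut_mul.
Proof. by move=> f g h; apply/polyAut_map_inj/polyEnd_compA. Qed.

Fact polyAut_mul1g : left_id polyAut_one polyAut_mul.
Proof. by move=> f; apply/polyAut_map_inj/polyEnd_comp1f. Qed.

Fact polyAut_mulg1 : right_id polyAut_one polyAut_mul.
Proof. by move=> f; apply/polyAut_map_inj/polyEnd_compf1. Qed.

Fact polyAut_mulVg : left_inverse polyAut_one polyAut_inv polyAut_mul.
Proof. by move=> f; apply/polyAut_map_inj/polyAutVK. Qed.

Fact polyAut_mulgV : right_inverse polyAut_one polyAut_inv polyAut_mul.
Proof. by move=> f; apply/polyAut_map_inj/polyAutK. Qed.

HB.instance Definition _ := isGroup.Build polyAut polyAut_mulA polyAut_mul1g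
  polyAut_mulg1 polyAut_mulVg polyAut_mulgV.

Lemma polyAut_morphism (V : affIndVarietyType K) (phi : V -> polyAut) :
    (forall d, exists e, {in ind_filt d, forall x,
        polyAut_map (phi x) \in polyEnd_filt e /\
        polyAut_inv_map (phi x) \in polyEnd_filt e}) ->
    (forall d i, reg_mpoly (@ind_chart K V d) (ind_filt d)
        (fun x => tnth (polyAut_map (phi x)) i)) ->
    (forall d i, reg_mpoly (@ind_chart K V d) (ind_filt d)
        (fun x => tnth (polyAut_inv_map (phi x)) i)) ->
  ind_morphism phi.
Proof.
move=> Hfilt H1 H2 d; have [e He] := Hfilt d; exists e; split.
  by move=> x /He[x1 x2]; apply/andP.
move=> j; rewrite -(splitK j); case: (split j) => {}j /=.
  apply: reg_ext (H1 d (polyEnd_index j).1 (polyEnd_index j).2) => x _.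
  by rewrite [LHS]row_mxEl mxE.
apply: reg_ext (H2 d (polyEnd_index j).1 (polyEnd_index j).2) => x _.
by rewrite [LHS]row_mxEr mxE.
Qed.

Lemma reg_polyAut_map d i :
  reg_mpoly (@ind_chart K polyAut d) (ind_filt d)
    (fun f : polyAut => tnth (polyAut_map f) i).
Proof.
move=> m; have [p Hp] := @reg_fst K polyEnd polyEnd d d _ (reg_mpoly_tnth d i m).
by exists p => f fd; apply: Hp.
Qed.

Lemma reg_polyAut_inv_map d i :
  reg_mpoly (@ind_chart K polyAut d) (ind_filt d)
    (fun f : polyAut => tnth (polyAut_inv_map f) i).
Proof.
move=> m; have [p Hp] := @reg_snd K polyEnd polyEnd d d _ (reg_mpoly_tnth d i m).
by exists p => f fd; apply: Hp.
Qed.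

Fact polyAut_mulg_morphism :
  ind_morphism (fun x : polyAut * polyAut => (x.1 * x.2)%g).
Proof.
have X1 d : {in ind_filt d, forall x : polyAut * polyAut,
    polyAut_map x.1 \in polyEnd_filt d /\
    polyAut_inv_map x.1 \in polyEnd_filt d}.
  by move=> x /andP[/andP].
have X2 d : {in ind_filt d, forall x : polyAut * polyAut,
    polyAut_map x.2 \in polyEnd_filt d /\
    polyAut_inv_map x.2 \in polyEnd_filt d}.
  by move=> x /andP[_ /andP].
apply: polyAut_morphism => [d|d i|d i].
- exists (d * d)%N => x xd; have [x1 x1'] := X1 d x xd.
  by have [x2 x2'] := X2 d x xd; split; apply: polyEnd_comp_filt.
- apply: (@reg_polyEnd_comp _ _ _ _ _ _ d) => [x /X1[]//|{}i m|{}i m].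
    exact: reg_fst (reg_polyAut_map d i m).
  exact: reg_snd (reg_polyAut_map d i m).
apply: (@reg_polyEnd_comp _ _ _ _ _ _ d) => [x /X2[]//|{}i m|{}i m].
  exact: reg_snd (reg_polyAut_inv_map d i m).
exact: reg_fst (reg_polyAut_inv_map d i m).
Qed.

Fact polyAut_invg_morphism : ind_morphism (fun f : polyAut => f^-1%g).
Proof.
apply: polyAut_morphism => [d|d i|d i].
- by exists d => x /andP[].
- exact: reg_polyAut_inv_map.
exact: reg_polyAut_map.
Qed.

HB.instance Definition _ :=
  isAffIndGroup.Build K polyAut polyAut_mulg_morphism polyAut_invg_morphism.

Definition jacobian f : 'M[{mpoly K[n]}]_n :=
  \matrix_(i, j) (tnth f i)^`M(j).

Lemma jacobian_comp f g :
  jacobian (polyEnd_comp f g) = map_mx (comp_mpoly g) (jacobian f) *m jacobian g.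
Proof.
apply/matrixP => i j; rewrite !mxE tnth_mktuple mderiv_comp.
by apply: eq_bigr => k _; rewrite !mxE.
Qed.

Lemma jacobian_id : jacobian polyEnd_id = 1%:M.
Proof.
apply/matrixP => i j; rewrite !mxE tnth_mktuple mderivX mnm1E.
by case: eqP => [->|_]; rewrite ?mnm_subnn ?mpolyX0 ?scale1r ?scale0r.
Qed.

Definition polySAut_pred : pred polyAut :=
  [pred f : polyAut | \det (jacobian (polyAut_map f)) == 1].

Fact polySAut_closed : ind_closed polySAut_pred.
Proof.
move=> d; pose g m (f : polyAut) : K :=
  (\det (jacobian (polyAut_map f)))@_m - 1@_m.
apply: (@closed_on_zeros _ _ _ _ _ _ g) => [m|f].
  apply: reg_add (reg_const _ _ _); move: m; apply: reg_mpoly_det => i j.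
  apply: reg_mpoly_ext (reg_mpoly_deriv j (reg_polyAut_map d i)) => f _.
  by rewrite mxE.
rewrite inE; split=> [/eqP f1 m|g0]; first by rewrite /g f1 subrr.
by apply/eqP/mpolyP => m; apply/eqP; rewrite -subr_eq0; apply/eqP/g0.
Qed.

Fact polySAut_group_closed : group_closed polySAut_pred.
Proof.
have H1 : 1%g \in polySAut_pred by rewrite inE [polyAut_map _]/= jacobian_id det1.
have HM : {in polySAut_pred &, forall f g : polyAut, (f * g)%g \in polySAut_pred}.
  move=> f g; rewrite !inE => /eqP f1 /eqP g1.
  by rewrite jacobian_comp det_mulmx det_map_mx f1 g1 rmorph1 mulr1.
have HV : {in polySAut_pred, forall f : polyAut, f^-1%g \in polySAut_pred}.
  move=> f; rewrite !inE => /eqP f1.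
  have := congr1 (determinant \o jacobian) (polyAutK f).
  rewrite /= jacobian_comp det_mulmx det_map_mx f1 rmorph1 mul1r => ->.
  by rewrite jacobian_id det1.
split=> [|f g fP gP]; [exact: H1 | exact: HM _ _ fP (HV _ gP)].
Qed.

Record polySAut := PolySAut {
  polySAut_val :> polyAut;
  _ : polySAut_pred polySAut_val
}.

HB.instance Definition _ := [isSub for polySAut_val].
HB.instance Definition _ := [Choice of polySAut by <:].
HB.instance Definition _ := ClosedSub_isAffIndVariety.Build K polyAut
  polySAut_pred polySAut polySAut_closed.
HB.instance Definition _ := SubChoice_isSubGroup.Build polyAut
  polySAut_pred polySAut polySAut_group_closed.

Fact polySAut_mulg_morphism :
  ind_morphism (fun x : polySAut * polySAut => (x.1 * x.2)%g).
Proof.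
move=> d; have [e [He Hr]] := @ind_mulg_morphism K polyAut d; exists e; split.
  by move=> [f g] fg; rewrite inE gmulfM; apply: (He (val f, val g)).
move=> j; have [p Hp] := Hr j; exists p => -[f g] fg.
by rewrite -(Hp (val f, val g) fg).
Qed.

Fact polySAut_invg_morphism : ind_morphism (fun f : polySAut => f^-1%g).
Proof.
move=> d; have [e [He Hr]] := @ind_invg_morphism K polyAut d; exists e; split.
  by move=> f fd; rewrite inE; apply: (He (val f)).
move=> j; have [p Hp] := Hr j; exists p => f fd.
by rewrite -(Hp (val f) fd).
Qed.

HB.instance Definition _ :=
  isAffIndGroup.Build K polySAut polySAut_mulg_morphism polySAut_invg_morphism.

Definition Int (g h : polyAut) : polyAut := (g * h * g^-1)%g.

End PolyEnd.

(* Main.v *)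
(* Let phi : SAut(A^n) -> Aut(A^n) be a nontrivial homomorphism of ind-groups.

   Rigidity: two such homomorphisms that agree on SL_n, on translations and on
   shears x_i |-> x_i + p are equal, although shears and affine maps need not
   generate SAut(A^n). Indeed every divergence-free polynomial vector field is a
   sum of velocities of conjugates of shears, so that both homomorphisms have the
   same differential, and an f fixing 0 is joined to its linear part by the curve
   t^-1 f(t x).

   Translations: let D_v be the velocity field of t |-> phi(translation by t v).
   If D_v vanishes at p with v nonzero, then the translation by v acts unipotently,
   through the isotropy representation, on the finite-dimensional tangent space at
   p, whereas it acts surjectively by differences on the shears q(x_a) e_i; hence
   all D_w vanish at p. So the determinant of the D_(e_i) is nonzero, and it is
   constant because it is invariant under translations. The dual 1-forms are then
   closed, hence exact, and integrating them conjugates phi on translations to the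
   identity.

   Then phi can be corrected by a translation to be the identity on SL_n (a scalar
   root of unity is central in SL_n), and it is the identity on shears by induction
   on the degree, as commutators of shears and translations have lower degree. By
   rigidity phi is inner. The case of Aut(A^n) follows since SAut(A^n) is normal
   with trivial centralizer when n > 1. *)
Require Import Defs.
From HB Require Import structures.
From mathcomp Require Import all_boot all_order all_algebra.
From mathcomp Require Import fingroup perm mpoly.
From mathcomp Require Import ring.

Set Implicit Arguments.
Unset Strict Implicit.
Unset Printing Implicit Defensive.

Import GRing.Theory.
Local Open Scope ring_scope.

(** * Derivatives at 0 of polynomial functions of one variable *)

(** The differential of a homomorphism is never constructed. A morphism is polynomial in charts, so
    the 1-jet of a curve determines the velocity of its image, and velocities are read off on points
    of affine space, as polynomial vector fields. Uniqueness for differential equations is replaced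
    by a fact of characteristic zero: a polynomial function of one variable whose derivative
    vanishes everywhere is constant. The group law brings the derivative at any time back to time 0.

    The conjugating automorphism for the translations is an orbit map, [v |-> phi (trans v) 0]; the
    primitives of the dual forms give its inverse, and they are polynomial because the frame has
    constant determinant.

    Commutators determine the image of a shear only up to a translation. That translation is
    excluded by comparing additivity in the coefficient with conjugation by a diagonal matrix of
    entries 2 and 1/2.

    Dimension 1 needs its own argument: there SAut is the commutative group of translations, and its
    centralizer in Aut is not trivial. *)

Lemma mnm_neq0_exists n (m : 'X_{1..n}) : m != 0%MM -> exists i, m i != 0%N.
Proof.
move=> m0; apply/existsP; apply: contraNT m0; rewrite negb_exists => /forallP m0.
by apply/eqP/mnmP => i; rewrite mnm0E; apply/eqP; have := m0 i; rewrite negbK.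
Qed.

Section CharZero.
Context (K : fieldType) (charK0 : [pchar K] =i pred0).

Lemma natf_eq0 m : (m%:R == 0 :> K) = (m == 0)%N.
Proof. exact: (iffLR (pcharf0P K) charK0). Qed.

Lemma natf_inj : injective (fun m : nat => m%:R : K).
Proof.
suff le m p : m%:R = p%:R :> K -> (m <= p)%N.
  by move=> m p e; apply/eqP; rewrite eqn_leq !le.
move=> e; rewrite leqNgt; apply/negP => lt_pm.
have /eqP : (m - p)%:R == 0 :> K by rewrite natrB ?(ltnW lt_pm) // e subrr.
by move/eqP; rewrite natf_eq0 subn_eq0 leqNgt lt_pm.
Qed.

Lemma poly_natf_root_eq0 (p : {poly K}) :
  (forall m : nat, p.[m%:R] = 0) -> p = 0.
Proof.
move=> p0; apply/eqP/negP => /negP pn0.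
have := @max_poly_roots _ p [seq m%:R | m <- iota 0 (size p)] pn0.
rewrite size_map size_iota ltnn (map_inj_uniq natf_inj) iota_uniq.
by move=> /(_ _ isT)/negP; apply; [apply/allP => _ /mapP[m _ ->]; rewrite /root p0|].
Qed.

Lemma poly_horner_eq0 (p : {poly K}) : (forall s, p.[s] = 0) -> p = 0.
Proof. by move=> p0; apply: poly_natf_root_eq0. Qed.

Lemma poly_horner_inj (p q : {poly K}) : (forall s, p.[s] = q.[s]) -> p = q.
Proof.
move=> pq; apply/eqP; rewrite -subr_eq0; apply/eqP/poly_horner_eq0 => s.
by rewrite hornerD hornerN pq subrr.
Qed.

Lemma poly_deriv_eq0 (p : {poly K}) : p^`() = 0 -> p = (p`_0)%:P.
Proof.
move=> p'0; apply/polyP => -[|i]; rewrite coefC //=.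
have /eqP : p^`()`_i = 0 by rewrite p'0 coef0.
by rewrite coef_deriv -mulr_natr mulf_eq0 natf_eq0 orbF => /eqP.
Qed.

(** Polynomiality is part of the relation: [P] is unique since K is infinite, so [b] is determined
    by [u], and all regular functions on the line have such a derivative. *)
Definition isder0 (u : K -> K) (b : K) : Prop :=
  exists2 P : {poly K}, (forall s, u s = P.[s]) & P^`().[0] = b.

Lemma isder0_uniq u b b' : isder0 u b -> isder0 u b' -> b = b'.
Proof.
by case=> P uP <- [Q uQ <-]; congr _.[_]; congr deriv;
  apply: poly_horner_inj => s; rewrite -uP.
Qed.

Lemma isder0_ext u u' b b' : u =1 u' -> b = b' -> isder0 u b -> isder0 u' b'.
Proof. by move=> uu <- [P uP Pb]; exists P => // s; rewrite -uu. Qed.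

Lemma isder0_const c : isder0 (fun=> c) 0.
Proof. by exists c%:P => [s|]; rewrite ?hornerC // derivC horner0. Qed.

Lemma isder0_id : isder0 id 1.
Proof. by exists 'X => [s|]; rewrite ?hornerX // derivX hornerC. Qed.

Lemma isder0D u v a b :
  isder0 u a -> isder0 v b -> isder0 (fun s => u s + v s) (a + b).
Proof.
case=> P uP <- [Q vQ <-]; exists (P + Q) => [s|].
  by rewrite hornerD uP vQ.
by rewrite derivD hornerD.
Qed.

Lemma isder0M u v a b : isder0 u a -> isder0 v b ->
  isder0 (fun s => u s * v s) (a * v 0 + u 0 * b).
Proof.
case=> P uP <- [Q vQ <-]; exists (P * Q) => [s|].
  by rewrite hornerM uP vQ.
by rewrite derivM hornerD !hornerM uP vQ.
Qed.

Lemma isder0Z c u a : isder0 u a -> isder0 (fun s => c * u s) (c * a).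
Proof.
move=> ua; apply: isder0_ext (isder0M (isder0_const c) ua) => //.
by rewrite mul0r add0r.
Qed.

Lemma isder0_sum I (r : seq I) (P : pred I) (u : I -> K -> K) b :
    (forall i, P i -> isder0 (u i) (b i)) ->
  isder0 (fun s => \sum_(i <- r | P i) u i s) (\sum_(i <- r | P i) b i).
Proof.
move=> ub; elim: r => [|i r IH].
  by apply: isder0_ext (isder0_const 0) => [s|]; rewrite big_nil.
case Pi: (P i); last first.
  by apply: isder0_ext IH => [s|]; rewrite big_cons Pi.
by apply: isder0_ext (isder0D (ub i Pi) IH) => [s|]; rewrite big_cons Pi.
Qed.

Lemma isder0_scale u b c :
  isder0 u b -> isder0 (fun s => u (s * c)) (b * c).
Proof.
case=> P uP <-; exists (P \Po (c *: 'X)) => [s|].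
  by rewrite horner_comp hornerZ hornerX uP mulrC.
rewrite deriv_comp hornerM horner_comp derivZ derivX.
by rewrite !hornerZ hornerX hornerC mulr0 mulr1.
Qed.

Lemma isder0_meval n (p : {mpoly K[n]}) (v : K -> 'I_n -> K) (w : 'I_n -> K) :
    (forall i, isder0 (v^~ i) (w i)) ->
  isder0 (fun s => p.@[v s]) (\sum_i p^`M(i).@[v 0] * w i).
Proof.
move=> vw; pose D q := isder0 (fun s => q.@[v s])
  (\sum_i q^`M(i).@[v 0] * w i).
have D1 : D 1.
  apply: isder0_ext (isder0_const 1) => [s|]; first by rewrite meval1.
  by rewrite big1 // => i _; rewrite -mpolyC1 mderivC meval0 mul0r.
have DM q r : D q -> D r -> D (q * r).
  move=> Dq Dr; apply: isder0_ext (isder0M Dq Dr) => [s|].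
    by rewrite mevalM.
  rewrite mulr_suml mulr_sumr -big_split; apply: eq_bigr => i _ /=.
  by rewrite mderivM mevalD !mevalM; ring.
have DX i : D 'X_i.
  apply: isder0_ext (vw i) => [s|]; first by rewrite mevalXU.
  rewrite (bigD1 i) //= big1 ?addr0 => [|j ji].
    by rewrite mderivX mnm1E eqxx mnm_subnn mpolyX0 scale1r meval1 mul1r.
  by rewrite mderivX mnm1E eq_sym (negPf ji) scale0r meval0 mul0r.
have DXm m : D 'X_[m].
  rewrite mpolyXE_id; elim/big_rec: _ => // i q _ Dq; apply: (DM _ _ _ Dq).
  by elim: (m i) => [|a IH]; rewrite ?expr0 // exprS; apply: (DM _ _ (DX i) IH).
rewrite -/(D p); elim/mpolyind: p => [|c m p _ _ IH].
  apply: isder0_ext (isder0_const 0) => [s|]; first by rewrite meval0.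
  by rewrite big1 // => i _; rewrite mderiv0 meval0 mul0r.
apply: isder0_ext (isder0D (isder0Z c (DXm m)) IH) => [s|].
  by rewrite mevalD mevalZ.
rewrite mulr_sumr -big_split; apply: eq_bigr => i _ /=.
by rewrite mderivD mderivZ mevalD mevalZ; ring.
Qed.

(** Stands in for uniqueness of solutions of differential equations. In its uses the derivative at
    [a] is reduced to one at 0 by a group law. *)
Lemma isder0_shift_const (u : K -> K) :
    (forall a, isder0 (fun s => u (a + s)) 0) -> forall s, u s = u 0.
Proof.
move=> u0; have [P uP _] := u0 0.
have {}uP s : u s = P.[s] by rewrite -uP add0r.
suff PE : P = (P`_0)%:P by move=> s; rewrite !uP PE !hornerC.
apply/poly_deriv_eq0/poly_horner_eq0 => a.
apply: isder0_uniq (u0 a); exists (P \Po ('X + a%:P)) => [s|].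
  by rewrite horner_comp hornerD hornerX hornerC uP addrC.
rewrite deriv_comp hornerM horner_comp !derivE addr0.
by rewrite hornerD hornerX !hornerC add0r mulr1.
Qed.

Lemma msize_mderiv n (p : {mpoly K[n]}) i :
  p^`M(i) != 0 -> (msize p^`M(i) < msize p)%N.
Proof.
move=> dp0; have := mlead_supp dp0; rewrite mcoeff_msupp mcoeff_mderiv.
rewrite -mulr_natr mulf_eq0 negb_or => /andP[pm _].
rewrite -mlead_deg //; apply: leq_ltn_trans (_ : _ <= mdeg (mlead p^`M(i) + U_(i)))%N _.
  by rewrite mdegD mdeg1 addn1.
by apply: msize_mdeg_lt; rewrite mcoeff_msupp.
Qed.

Lemma mderiv_eq0_const n (p : {mpoly K[n]}) :
  (forall i, p^`M(i) = 0) -> p = (p@_0%MM)%:MP.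
Proof.
move=> dp0; apply/mpolyP => m; rewrite mcoeffC.
have [->|m0] := eqVneq m 0%MM; first by rewrite mulr1.
have [i mi] := mnm_neq0_exists m0.
have le1 : (U_(i) <= m)%MM.
  by apply/mnm_lepP => j; rewrite mnm1E; case: eqP => // <-; rewrite lt0n.
have := mcoeff_mderiv i p (m - U_(i)); rewrite dp0 mcoeff0 submK //.
move/esym/eqP; rewrite -[_ *+ _]mulr_natr mulf_eq0 natf_eq0 orbF => /eqP ->.
by rewrite mulr0.
Qed.

(** A nonzero derivative has smaller degree, and a polynomial without nonzero derivatives is
    constant. It serves for the polynomials vanishing at all points and for the kernel of a
    substitution. *)
Lemma mderiv_stable_const n (I : {mpoly K[n]} -> Prop) :
    (forall p i, I p -> I p^`M(i)) ->
  forall p, I p -> p != 0 -> exists2 c, c != 0 & I c%:MP.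
Proof.
move=> Id p; have [k] := ubnP (msize p); elim: k p => // k IH p pk Ip p0.
have [/forallP dp0|] := boolP [forall i, p^`M(i) == 0].
  have pE := mderiv_eq0_const (fun i => eqP (dp0 i)).
  exists (p@_0%MM); last by rewrite -pE.
  by apply: contraNneq p0 => c0; rewrite pE c0.
rewrite negb_forall => /existsP[i di].
by apply: (IH p^`M(i)) => //; [exact: leq_trans (msize_mderiv di) _ | exact: Id].
Qed.

Lemma mpoly_meval_eq0 n (p : {mpoly K[n]}) :
  (forall x : 'rV[K]_n, p.@[x ord0] = 0) -> p = 0.
Proof.
move=> p0; apply/eqP/negPn/negP => pn0.
pose I (q : {mpoly K[n]}) := forall x : 'rV[K]_n, q.@[x ord0] = 0.
have Id q i : I q -> I q^`M(i).
  move=> Iq x.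
  pose v (s : K) : 'I_n -> K := (x + s *: delta_mx 0 i) ord0.
  have vw j : isder0 (v^~ j) (i == j)%:R.
    apply: isder0_ext (isder0D (isder0_const (x 0 j))
      (isder0Z (i == j)%:R isder0_id)) => [s|].
      by rewrite /v !mxE eqxx eq_sym mulrC.
    by rewrite add0r mulr1.
  have H := isder0_meval q vw.
  have := isder0_uniq H (isder0_ext (fun s => esym (Iq _)) erefl (isder0_const 0)).
  rewrite (bigD1 i) //= eqxx mulr1 big1 ?addr0 => [<-|j ji].
    by apply: meval_eq => j; rewrite /v scale0r addr0.
  by rewrite eq_sym (negPf ji) mulr0.
have [c c0 /(_ 0)] := mderiv_stable_const Id p0 pn0.
by rewrite mevalC => c0'; rewrite c0' eqxx in c0.
Qed.

Lemma mpoly_meval_inj n (p q : {mpoly K[n]}) :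
  (forall x : 'rV[K]_n, p.@[x ord0] = q.@[x ord0]) -> p = q.
Proof.
move=> pq; apply/eqP; rewrite -subr_eq0; apply/eqP/mpoly_meval_eq0 => x.
by rewrite mevalB pq subrr.
Qed.

End CharZero.

(** * Regular families of points of an ind-variety *)

Section Families.
Context (K : fieldType).

(* [F] is a morphism to the [d]-th step from the variety that [c] embeds in affine
   space; in practice from the line, with [c = line], or from affine space. *)
Definition regfam_at (V : affIndVarietyType K) d T N (c : T -> 'rV[K]_N)
    (F : T -> V) : Prop :=
  (forall t, F t \in ind_filt d) /\
  (forall j, regular_on c predT (fun t => ind_chart d (F t) ord0 j)).

Definition regfam (V : affIndVarietyType K) T N (c : T -> 'rV[K]_N)
  (F : T -> V) : Prop := exists d, regfam_at d c F.

Lemma regfam_reg (V : affIndVarietyType K) d T N (c : T -> 'rV[K]_N)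
    (F : T -> V) (u : V -> K) :
    regfam_at d c F -> regular_on (@ind_chart K V d) (ind_filt d) u ->
  regular_on c predT (fun t => u (F t)).
Proof.
case=> Fd Fr [p up]; apply: reg_ext (reg_meval p Fr) => t _.
exact: up.
Qed.

Lemma regfam_atS (V : affIndVarietyType K) d T N (c : T -> 'rV[K]_N)
  (F : T -> V) : regfam_at d c F -> regfam_at d.+1 c F.
Proof.
move=> FF; split=> [t|j]; first by apply/ind_filtS/(proj1 FF).
exact: regfam_reg FF (ind_chart_up d j).
Qed.

Lemma regfam_atD (V : affIndVarietyType K) e d T N (c : T -> 'rV[K]_N)
  (F : T -> V) : regfam_at d c F -> regfam_at (d + e) c F.
Proof.
by move=> FF; elim: e => [|e IH]; rewrite ?addn0 // addnS; apply: regfam_atS.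
Qed.

Lemma regfam_morph (V W : affIndVarietyType K) (phi : V -> W) T N
    (c : T -> 'rV[K]_N) (F : T -> V) :
  ind_morphism phi -> regfam c F -> regfam c (fun t => phi (F t)).
Proof.
move=> phiM [d FF]; have [e [phie phir]] := phiM d; exists e; split=> [t|j].
  by apply/phie/(proj1 FF).
exact: regfam_reg FF (phir j).
Qed.

Lemma regfam_pair (V W : affIndVarietyType K) T N (c : T -> 'rV[K]_N)
    (F : T -> V) (G : T -> W) :
  regfam c F -> regfam c G -> regfam c (fun t => (F t, G t)).
Proof.
move=> [d /(regfam_atD) FF] [e /(regfam_atD) GG].
exists (d + e)%N; have {}FF := FF e; have {}GG := GG d; rewrite addnC in GG.
split=> [t|j]; first by apply/andP; split; [apply: (proj1 FF)|apply: (proj1 GG)].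
rewrite -(splitK j); case: (split j) => {}j /=.
  by apply: reg_ext (proj2 FF j) => t _; apply: row_mxEl.
by apply: reg_ext (proj2 GG j) => t _; apply: row_mxEr.
Qed.

Lemma regfam_const (V : affIndVarietyType K) T N (c : T -> 'rV[K]_N) (x : V) :
  regfam c (fun=> x).
Proof.
have [d xd] := ind_filt_cover x; exists d; split=> // j.
exact: reg_const.
Qed.

Lemma regfam_reparam (V : affIndVarietyType K) T N (c : T -> 'rV[K]_N)
    T' N' (c' : T' -> 'rV[K]_N') (h : T' -> T) (F : T -> V) :
    (forall j, regular_on c' predT (fun t => c (h t) ord0 j)) ->
  regfam c F -> regfam c' (fun t => F (h t)).
Proof.
move=> hr [d [Fd Fr]]; exists d; split=> // j; have [p Fp] := Fr j.
by apply: reg_ext (reg_meval p hr) => t _; apply: Fp.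
Qed.

Lemma regfam_mul (G : affIndGroupType K) T N (c : T -> 'rV[K]_N)
    (F F' : T -> G) :
  regfam c F -> regfam c F' -> regfam c (fun t => (F t * F' t)%g).
Proof.
by move=> FF FF'; apply: regfam_morph ind_mulg_morphism (regfam_pair FF FF').
Qed.

Lemma regfam_inv (G : affIndGroupType K) T N (c : T -> 'rV[K]_N)
  (F : T -> G) : regfam c F -> regfam c (fun t => (F t)^-1%g).
Proof. exact: regfam_morph ind_invg_morphism. Qed.

Lemma ind_morphism_comp (U V W : affIndVarietyType K) (f : V -> W) (g : U -> V) :
  ind_morphism f -> ind_morphism g -> ind_morphism (f \o g).
Proof.
move=> fM gM d; have [e [ge gr]] := gM d; have [e' [fe fr]] := fM e.
exists e'; split=> [x xd|j]; first exact/fe/ge.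
have [p fp] := fr j.
by apply: reg_ext (reg_meval p gr) => x xd; apply/fp/ge.
Qed.

Lemma ind_filt_lift (V W : affIndVarietyType K) (f : V -> W) d e k :
    {in ind_filt d, forall x, f x \in ind_filt e} ->
    (forall j, regular_on (@ind_chart K V d) (ind_filt d)
       (fun x => ind_chart e (f x) ord0 j)) ->
  {in ind_filt d, forall x, f x \in ind_filt (e + k)} /\
  (forall j, regular_on (@ind_chart K V d) (ind_filt d)
     (fun x => ind_chart (e + k) (f x) ord0 j)).
Proof.
move=> fe fr; elim: k => [|k [IH1 IH2]]; first by rewrite addn0.
rewrite addnS; split=> [x xd|j]; first exact/ind_filtS/IH1.
have [p Hp] := @ind_chart_up K W (e + k) j.
by apply: reg_ext (reg_meval p IH2) => x xd; apply/Hp/IH1.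
Qed.

Lemma ind_morphism_pair (U V W : affIndVarietyType K) (f : U -> V) (g : U -> W) :
  ind_morphism f -> ind_morphism g -> ind_morphism (fun x => (f x, g x)).
Proof.
move=> fM gM d; have [e [fe fr]] := fM d; have [e' [ge gr]] := gM d.
have [fE fR] := ind_filt_lift e' fe fr; have [gE gR] := ind_filt_lift e ge gr.
rewrite addnC in gE gR; exists (e + e')%N; split=> [x xd|j].
  by apply/andP; split; [apply: fE | apply: gE].
rewrite -(splitK j); case: (split j) => {}j /=.
  by apply: reg_ext (fR j) => x _; apply: row_mxEl.
by apply: reg_ext (gR j) => x _; apply: row_mxEr.
Qed.

Lemma ind_morphism_const (U V : affIndVarietyType K) (x : V) :
  ind_morphism (fun _ : U => x).
Proof.
move=> d; have [e xe] := ind_filt_cover x; exists e; split=> // j.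
exact: reg_const.
Qed.

Lemma ind_morphism_id (U : affIndVarietyType K) : ind_morphism (@id U).
Proof. by move=> d; exists d; split=> // j; apply: reg_coord. Qed.

Lemma ind_morphism_mul (U : affIndVarietyType K) (G : affIndGroupType K)
    (f g : U -> G) :
  ind_morphism f -> ind_morphism g -> ind_morphism (fun x => (f x * g x)%g).
Proof.
move=> fM gM.
exact: ind_morphism_comp ind_mulg_morphism (ind_morphism_pair fM gM).
Qed.

Definition line (s : K) : 'rV[K]_1 := const_mx s.

Lemma line_id : regular_on line predT id.
Proof. by apply: reg_ext (reg_coord _ _ ord0) => s _; rewrite mxE. Qed.

Lemma line_deriv u : regular_on line predT u -> exists b, isder0 u b.
Proof.
case=> p up; exists (\sum_i p^`M(i).@[line 0 ord0] * 1).
have vw i : isder0 (fun s => line s ord0 i) 1.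
  by apply: isder0_ext (isder0_id _) => [s|//]; rewrite mxE.
by apply: isder0_ext (isder0_meval p vw) => [s|//]; rewrite up.
Qed.

(** Contact of order 1 at time 0. There is no global chart, so the derivatives are compared in every
    step of the filtration that contains both curves. *)
Definition same_jet (V : affIndVarietyType K) (F G : K -> V) : Prop :=
  F 0 = G 0 /\ forall d j, regfam_at d line F -> regfam_at d line G ->
    exists2 b, isder0 (fun s => ind_chart d (F s) ord0 j) b &
               isder0 (fun s => ind_chart d (G s) ord0 j) b.

Lemma same_jet_reg (V : affIndVarietyType K) d (F G : K -> V) (u : V -> K) :
    same_jet F G -> regfam_at d line F -> regfam_at d line G ->
    regular_on (@ind_chart K V d) (ind_filt d) u ->
  exists2 b, isder0 (fun s => u (F s)) b & isder0 (fun s => u (G s)) b.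
Proof.
move=> [FG0 FG] FF GG [p up].
have /fin_all_exists2[w wF wG] : forall j, exists2 b,
    isder0 (fun s => ind_chart d (F s) ord0 j) b &
    isder0 (fun s => ind_chart d (G s) ord0 j) b by move=> j; apply: FG.
exists (\sum_j p^`M(j).@[ind_chart d (F 0) ord0] * w j).
  apply: isder0_ext (isder0_meval p wF) => // s.
  by rewrite -up //; apply: (proj1 FF).
apply: isder0_ext (isder0_meval p wG) => [s|]; last by rewrite FG0.
by rewrite -up //; apply: (proj1 GG).
Qed.

(** Chain rule in charts. This is how a homomorphism acts on velocities without a tangent map. *)
Lemma same_jet_morph (V W : affIndVarietyType K) (phi : V -> W) (F G : K -> V)
    (u : W -> K) :
    ind_morphism phi -> regfam line F -> regfam line G -> same_jet F G ->
    (forall e, regular_on (@ind_chart K W e) (ind_filt e) u) ->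
  exists2 b, isder0 (fun s => u (phi (F s))) b &
             isder0 (fun s => u (phi (G s))) b.
Proof.
move=> phiM [d /regfam_atD FF] [d' /regfam_atD GG] FG ur.
have {}FF := FF d'; have {}GG := GG d; rewrite addnC in GG.
have [k [phik phir]] := phiM (d + d')%N.
apply: (same_jet_reg (u := u \o phi) FG FF GG); have [p up] := ur k.
by apply: reg_ext (reg_meval p phir) => x xd; apply/up/phik.
Qed.

End Families.

Arguments line {K} s.

(** * Action on points, and velocities of curves of automorphisms *)

(** The uniform degree bound [w] makes the evaluation a sum over one finite set of monomials. *)
Lemma reg_meval_regfam (K : fieldType) T N (c : T -> 'rV[K]_N) (X : {pred T}) n
    (P : T -> {mpoly K[n]}) (v : T -> 'I_n -> K) w :
    {in X, forall t, msize (P t) <= w}%N -> reg_mpoly c X P ->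
    (forall i, regular_on c X (fun t => v t i)) ->
  regular_on c X (fun t => (P t).@[v t]).
Proof.
move=> Pw HP Hv.
have vX i a : regular_on c X (fun t => v t i ^+ a).
  elim: a => [|a IH]; first by apply: reg_ext (reg_const _ _ 1) => t _.
  by apply: reg_ext (reg_mul (Hv i) IH) => t _; rewrite exprS.
have vP (m : 'X_{1..n}) : regular_on c X (fun t => \prod_i v t i ^+ m i).
  elim: (index_enum _) => [|i r IH].
    by apply: reg_ext (reg_const _ _ 1) => t _; rewrite big_nil.
  by apply: reg_ext (reg_mul (vX i (m i)) IH) => t _; rewrite big_cons.
apply: reg_ext (reg_sum _ (fun (m : 'X_{1..n < w}) _ => reg_mul (HP m) (vP m))).
move=> t tX; rewrite [in LHS](mpolywE (Pw t tX)) raddf_sum /=.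
by apply: eq_bigr => m _; rewrite mevalZ mevalX.
Qed.

Section Tangent.
Context (K : fieldType) (charK0 : [pchar K] =i pred0) (n : nat).
Local Notation Aut := (polyAut K n).
Local Notation point := 'rV[K]_n.
Implicit Types (f g : Aut) (x y v : point).

Definition act f x : point := \row_i (tnth (polyAut_map f) i).@[x ord0].

Lemma actE f x i : act f x ord0 i = (tnth (polyAut_map f) i).@[x ord0].
Proof. by rewrite mxE. Qed.

Lemma act1 x : act 1%g x = x.
Proof. by apply/rowP => i; rewrite mxE tnth_mktuple mevalXU. Qed.

Lemma actM f g x : act (f * g)%g x = act f (act g x).
Proof.
apply/rowP => i; rewrite !mxE tnth_mktuple comp_mpoly_meval.
by apply: meval_eq => j; rewrite mxE.
Qed.

Lemma actK f : cancel (act f) (act f^-1%g).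
Proof. by move=> x; rewrite -actM mulVg act1. Qed.

Lemma actVK f : cancel (act f^-1%g) (act f).
Proof. by move=> x; rewrite -actM mulgV act1. Qed.

Lemma act_eq f g : act f =1 act g -> f = g.
Proof.
move=> fg; apply/polyAut_map_inj/eq_from_tnth => i.
by apply: (mpoly_meval_inj charK0) => x; rewrite -!actE fg.
Qed.

Lemma polyAut_msize d f i :
  f \in ind_filt d -> (msize (tnth (polyAut_map f) i) <= d.+1)%N.
Proof. by move=> /andP[/polyEnd_filtP]. Qed.

Lemma reg_act d x i :
  regular_on (@ind_chart K Aut d) (ind_filt d) (fun f => act f x ord0 i).
Proof.
have fw : {in ind_filt d, forall f, msize (tnth (polyAut_map f) i) <= d.+1}%N.
  by move=> f; apply: polyAut_msize.
have H := reg_meval_regfam fw (reg_polyAut_map K d i) (fun j => reg_const _ _ (x ord0 j)).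
by apply: reg_ext H => f fd; rewrite mxE.
Qed.

Lemma regfam_mpoly T N (c : T -> 'rV[K]_N) (F : T -> Aut) d i :
  regfam_at d c F -> reg_mpoly c predT (fun t => tnth (polyAut_map (F t)) i).
Proof. by move=> FF m; apply: (regfam_reg FF (reg_polyAut_map K d i m)). Qed.

Lemma regfam_act T N (c : T -> 'rV[K]_N) (F : T -> Aut) (v : T -> point) i :
    regfam c F -> (forall j, regular_on c predT (fun t => v t ord0 j)) ->
  regular_on c predT (fun t => act (F t) (v t) ord0 i).
Proof.
move=> [d FF] vr.
apply: reg_ext (reg_meval_regfam (w := d.+1) _ (regfam_mpoly i FF) vr) => t _.
  exact: mxE.
exact/polyAut_msize/(proj1 FF).
Qed.

Lemma isder0_mpoly_exists (P : K -> {mpoly K[n]}) w :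
    (forall s, msize (P s) <= w)%N -> reg_mpoly line predT P ->
  exists B : {mpoly K[n]}, (msize B <= w)%N /\
    forall m, isder0 (fun s => (P s)@_m) B@_m.
Proof.
move=> Pw Pr.
have /fin_all_exists[b Hb] : forall m : 'X_{1..n < w}, exists b,
    isder0 (fun s => (P s)@_m) b by move=> m; apply/line_deriv/Pr.
have Bm (m : 'X_{1..n < w}) : (\sum_(k : 'X_{1..n < w}) b k *: 'X_[k])@_m = b m.
  rewrite raddf_sum (bigD1 m) //= mcoeffZ mcoeffX eqxx mulr1.
  rewrite big1 ?addr0 // => k km.
  by rewrite mcoeffZ mcoeffX (inj_eq val_inj) (negPf km) mulr0.
have Bw : (msize (\sum_(k : 'X_{1..n < w}) b k *: 'X_[k]) <= w)%N.
  apply: leq_trans (msize_sum _ _ _) _; apply/bigmax_leqP_seq => m _ _.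
  by apply: leq_trans (msizeZ_le _ _) _; rewrite msizeX bmdeg.
exists (\sum_(k : 'X_{1..n < w}) b k *: 'X_[k]); split=> // m.
have [mw|wm] := ltnP (mdeg m) w; last first.
  rewrite (memN_msupp_eq0 (msize_mdeg_ge (leq_trans Bw wm))).
  apply: isder0_ext (isder0_const 0) => // s.
  by rewrite (memN_msupp_eq0 (msize_mdeg_ge (leq_trans (Pw s) wm))).
rewrite (Bm (BMultinom mw)); exact: (Hb (BMultinom mw)).
Qed.

Lemma isder0_meval_regfam (P : K -> {mpoly K[n]}) (B : {mpoly K[n]})
    (u : K -> 'I_n -> K) (z : 'I_n -> K) w :
    (forall s, msize (P s) <= w)%N -> (msize B <= w)%N ->
    (forall m, isder0 (fun s => (P s)@_m) B@_m) ->
    (forall i, isder0 (u^~ i) (z i)) ->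
  isder0 (fun s => (P s).@[u s])
    (B.@[u 0] + \sum_i (P 0)^`M(i).@[u 0] * z i).
Proof.
move=> Pw Bw PB uz.
have H (m : 'X_{1..n < w}) := isder0M (PB m) (isder0_meval 'X_[m] uz).
apply: isder0_ext (isder0_sum _ (fun m _ => H m)) => [s|].
  rewrite [in RHS](mpolywE (Pw s)) raddf_sum /=.
  by apply: eq_bigr => m _; rewrite mevalZ.
rewrite big_split /=; congr (_ + _).
  rewrite [in RHS](mpolywE Bw) raddf_sum /=.
  by apply: eq_bigr => m _; rewrite mevalZ.
under eq_bigr do rewrite mulr_sumr.
rewrite exchange_big; apply: eq_bigr => i _ /=.
have -> : (P 0)^`M(i) = \sum_(m : 'X_{1..n < w}) (P 0)@_m *: 'X_[m]^`M(i).
  rewrite [in LHS](mpolywE (Pw 0)) linear_sum /=.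
  by apply: eq_bigr => m _; apply: mderivZ.
rewrite raddf_sum /= mulr_suml.
by apply: eq_bigr => m _; rewrite mevalZ mulrA.
Qed.

(** [X] is indexed by the starting point [x], not by [act (F 0) x]; it is a vector field in the
    usual sense when [F 0 = 1]. *)
Definition tangent (F : K -> Aut) (X : 'I_n -> {mpoly K[n]}) : Prop :=
  forall x i, isder0 (fun s => act (F s) x ord0 i) (X i).@[x ord0].

Lemma isder0_coord x i : isder0 (fun=> x ord0 i) ((0 : point) ord0 i).
Proof. by rewrite mxE; apply: isder0_const. Qed.

Lemma tangent_mcoeff_exists (F : K -> Aut) d : regfam_at d line F ->
  exists X : 'I_n -> {mpoly K[n]}, tangent F X /\
   (forall i, msize (X i) <= d.+1)%N /\
   forall i m, isder0 (fun s => (tnth (polyAut_map (F s)) i)@_m) (X i)@_m.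
Proof.
move=> FF; have Fw i s : (msize (tnth (polyAut_map (F s)) i) <= d.+1)%N.
  exact/polyAut_msize/(proj1 FF).
have /fin_all_exists[X HX] i := isder0_mpoly_exists (Fw i) (regfam_mpoly i FF).
exists X; split; last by split=> i; have [] := HX i.
move=> x i; have [Xw Xm] := HX i.
apply: isder0_ext (isder0_meval_regfam (Fw i) Xw Xm (isder0_coord x)) => [s|].
  by rewrite actE.
by rewrite big1 ?addr0 // => j _; rewrite mxE mulr0.
Qed.

Lemma tangent_exists (F : K -> Aut) : regfam line F -> exists X, tangent F X.
Proof. by case=> d /tangent_mcoeff_exists[X [FX _]]; exists X. Qed.

Lemma tangent_uniq (F : K -> Aut) X Y :
  tangent F X -> tangent F Y -> X =1 Y.
Proof.
move=> FX FY i; apply: (mpoly_meval_inj charK0) => x.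
exact: isder0_uniq (FX x i) (FY x i).
Qed.

Lemma tangent_mcoeff (F : K -> Aut) X : regfam line F -> tangent F X ->
  forall i m, isder0 (fun s => (tnth (polyAut_map (F s)) i)@_m) (X i)@_m.
Proof.
case=> d /tangent_mcoeff_exists[Y [FY [_ Ym]]] FX i m.
by rewrite (tangent_uniq FX FY).
Qed.

Lemma isder0_act (F : K -> Aut) X (v : K -> point) w i :
    regfam line F -> tangent F X ->
    (forall j, isder0 (fun s => v s ord0 j) (w j)) ->
  isder0 (fun s => act (F s) (v s) ord0 i)
    ((X i).@[v 0 ord0] +
      \sum_j (tnth (polyAut_map (F 0)) i)^`M(j).@[v 0 ord0] * w j).
Proof.
move=> [d FF] FX vw; have [Y [FY [Yw Ym]]] := tangent_mcoeff_exists FF.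
have Fw s : (msize (tnth (polyAut_map (F s)) i) <= d.+1)%N.
  exact/polyAut_msize/(proj1 FF).
rewrite (tangent_uniq FX FY).
by apply: isder0_ext (isder0_meval_regfam Fw (Yw i) (Ym i) vw) => // s; rewrite actE.
Qed.

Lemma isder0_act_const f (v : K -> point) w i :
    (forall j, isder0 (fun s => v s ord0 j) (w j)) ->
  isder0 (fun s => act f (v s) ord0 i)
    (\sum_j (tnth (polyAut_map f) i)^`M(j).@[v 0 ord0] * w j).
Proof.
move=> vw; apply: isder0_ext (isder0_meval (tnth (polyAut_map f) i) vw) => // s.
by rewrite actE.
Qed.

Lemma mderiv_id (i j : 'I_n) x :
  (tnth (polyAut_map (1%g : Aut)) i)^`M(j).@[x ord0] = (i == j)%:R.
Proof.
rewrite tnth_mktuple mderivX mnm1E.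
by case: eqP => [->|_]; rewrite ?mnm_subnn ?mpolyX0 ?scale1r ?scale0r ?meval1 ?meval0.
Qed.

Lemma isder0_act1 (F : K -> Aut) X (v : K -> point) w i :
    regfam line F -> tangent F X -> F 0 = 1%g ->
    (forall j, isder0 (fun s => v s ord0 j) (w j)) ->
  isder0 (fun s => act (F s) (v s) ord0 i) ((X i).@[v 0 ord0] + w i).
Proof.
move=> FF FX F0 vw; apply: isder0_ext (isder0_act i FF FX vw) => //.
congr (_ + _); rewrite (bigD1 i) //= F0 mderiv_id eqxx mul1r big1 ?addr0 // => j ji.
by rewrite mderiv_id eq_sym (negPf ji) mul0r.
Qed.

Lemma tangent_const f : tangent (fun=> f) (fun=> 0).
Proof. by move=> x i; rewrite meval0; apply: isder0_const. Qed.

Lemma tangent_mul (F G : K -> Aut) X Y :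
    regfam line F -> F 0 = 1%g -> G 0 = 1%g -> tangent F X -> tangent G Y ->
  tangent (fun s => (F s * G s)%g) (fun i => X i + Y i).
Proof.
move=> FF F0 G0 FX GY x i.
apply: isder0_ext (isder0_act1 i FF FX F0 (GY x)) => [s|]; first by rewrite actM.
by rewrite G0 act1 mevalD.
Qed.

Lemma tangent_inv (F : K -> Aut) X :
    regfam line F -> F 0 = 1%g -> tangent F X ->
  tangent (fun s => (F s)^-1%g) (fun i => - X i).
Proof.
move=> FF F0 FX; have [Y FY] := tangent_exists (regfam_inv FF).
have F0' : (F 0)^-1%g = 1%g by rewrite F0 invg1.
have H := tangent_mul FF F0 F0' FX FY.
have XY i : X i + Y i = 0.
  apply: (tangent_uniq H (Y := fun=> 0)) => x j.
  by apply: isder0_ext (tangent_const 1%g x j) => // s; rewrite mulgV.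
move=> x i; have /eqP := XY i; rewrite addrC addr_eq0 => /eqP <-; exact: FY.
Qed.

Lemma tangent_scale (F : K -> Aut) X c :
  tangent F X -> tangent (fun s => F (s * c)) (fun i => c *: X i).
Proof.
move=> FX x i; apply: isder0_ext (isder0_scale c (FX x i)) => //.
by rewrite mevalZ mulrC.
Qed.

(** The last hypothesis says that [Y] is the pushforward of [X] by [f]; it is written at [act f x]
    to avoid the inverse of the Jacobian matrix. *)
Lemma tangent_conj (F : K -> Aut) X f (Y : 'I_n -> {mpoly K[n]}) :
    F 0 = 1%g -> tangent F X ->
    (forall x i, (Y i).@[act f x ord0] =
       \sum_j (tnth (polyAut_map f) i)^`M(j).@[x ord0] * (X j).@[x ord0]) ->
  tangent (fun s => (f * F s * f^-1)%g) Y.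
Proof.
move=> F0 FX XY x i.
apply: isder0_ext (isder0_act_const f i (FX (act f^-1 x)%g)) => [s|].
  by rewrite !actM.
by rewrite F0 act1 -XY actVK.
Qed.

Lemma regfam_scale (V : affIndVarietyType K) (F : K -> V) c :
  regfam line F -> regfam line (fun s => F (s * c)).
Proof.
move=> FF; apply: (regfam_reparam (h := fun s => s * c) _ FF) => j.
by apply: reg_ext (reg_mul (line_id K) (reg_const _ _ c)) => s _; rewrite mxE.
Qed.

Lemma regfam_shift (V : affIndVarietyType K) (F : K -> V) c :
  regfam line F -> regfam line (fun s => F (c + s)).
Proof.
move=> FF; apply: (regfam_reparam (h := fun s => c + s) _ FF) => j.
by apply: reg_ext (reg_add (reg_const _ _ c) (line_id K)) => s _; rewrite mxE.
Qed.

End Tangent.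

(** * Affine automorphisms and shears *)

(* Sealed, for otherwise comparing two such terms computes determinants. *)
HB.lock Definition mkAut (K : fieldType) n (f g : polyEnd K n) : polyAut K n :=
  insubd (1%g : polyAut K n) (f, g).
Canonical mkAut_unlockable := Unlockable mkAut.unlock.

(** The value is the default 1 when [f] is not in SAut, so statements about it carry the condition
    [kappa f = 1]. *)
HB.lock Definition toSAut (K : fieldType) n (f : polyAut K n) : polySAut K n :=
  insubd (1%g : polySAut K n) f.
Canonical toSAut_unlockable := Unlockable toSAut.unlock.

(** The Jacobian determinant of an automorphism is constant ([jdetE]), so its constant coefficient
    is all of it. *)
HB.lock Definition kappa (K : fieldType) n (f : polyAut K n) : K :=
  (\det (jacobian (polyAut_map f)))@_0%MM.
Canonical kappa_unlockable := Unlockable kappa.unlock.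

Arguments mkAut {K n} f g.
Arguments toSAut {K n} f.
Arguments kappa {K n} f.

Section Elementary.
Context (K : fieldType) (charK0 : [pchar K] =i pred0) (n : nat).
Local Notation Aut := (polyAut K n).
Local Notation SAut := (polySAut K n).
Local Notation End := (polyEnd K n).
Local Notation point := 'rV[K]_n.
Implicit Types (f g : Aut) (x y v : point) (i j : 'I_n).

Definition endact (f : End) x : point := \row_i (tnth f i).@[x ord0].

Lemma mkAutE (f g : End) :
    cancel (endact f) (endact g) -> cancel (endact g) (endact f) ->
  polyAut_map (mkAut f g) = f /\ polyAut_inv_map (mkAut f g) = g.
Proof.
have comp_id (p q : End) :
    cancel (endact q) (endact p) -> polyEnd_comp p q = polyEnd_id K n.
  move=> pq; apply/eq_from_tnth => i; apply: (mpoly_meval_inj charK0) => x.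
  rewrite !tnth_mktuple comp_mpoly_meval mevalXU -[in RHS](pq x) mxE.
  by apply: meval_eq => j; rewrite mxE.
move=> fg gf; have fgP : polyAut_pred (f, g).
  by apply/andP; split; apply/eqP; apply: comp_id.
by rewrite /polyAut_map /polyAut_inv_map unlock val_insubd fgP.
Qed.

Lemma act_mkAut (f g : End) :
    cancel (endact f) (endact g) -> cancel (endact g) (endact f) ->
  act (mkAut f g) =1 endact f.
Proof.
by move=> fg gf x; apply/rowP => i; rewrite actE (proj1 (mkAutE fg gf)) mxE.
Qed.

Lemma mulg_act f g h k : (forall x, act f (act g x) = act h (act k x)) ->
  (f * g = h * k)%g.
Proof. by move=> e; apply: (act_eq charK0) => x; rewrite !actM. Qed.

Lemma regfam_polyAut T N (c : T -> 'rV[K]_N) (F : T -> Aut) e :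
    (forall t i, msize (tnth (polyAut_map (F t)) i) <= e.+1)%N ->
    (forall t i, msize (tnth (polyAut_inv_map (F t)) i) <= e.+1)%N ->
    (forall i, reg_mpoly c predT (fun t => tnth (polyAut_map (F t)) i)) ->
    (forall i, reg_mpoly c predT (fun t => tnth (polyAut_inv_map (F t)) i)) ->
  regfam c F.
Proof.
move=> s1 s2 r1 r2; exists e; split=> [t|j].
  by apply/andP; split; apply/forallP => i; [apply: s1 | apply: s2].
rewrite -(splitK j); case: (split j) => {}j /=.
  apply: reg_ext (r1 (polyEnd_index j).1 (polyEnd_index j).2) => x _.
  by rewrite [LHS]row_mxEl mxE.
apply: reg_ext (r2 (polyEnd_index j).1 (polyEnd_index j).2) => x _.
by rewrite [LHS]row_mxEr mxE.
Qed.

(** Points are row vectors and [L] acts on the right, so products of matrices correspond to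
    compositions in the opposite order. *)
Definition affE (L : 'M[K]_n) v : End :=
  [tuple \sum_j L j i *: 'X_j + (v ord0 i)%:MP | i < n].

Lemma endact_aff L v x : endact (affE L v) x = x *m L + v.
Proof.
apply/rowP => i; rewrite !mxE tnth_mktuple mevalD mevalC raddf_sum /=.
congr (_ + _); apply: eq_bigr => j _.
by rewrite mevalZ mevalXU mulrC.
Qed.

Definition aff L v : Aut := mkAut (affE L v) (affE (invmx L) (- v *m invmx L)).

Lemma affEK L v : L \in unitmx ->
  cancel (endact (affE L v)) (endact (affE (invmx L) (- v *m invmx L))).
Proof.
by move=> LU x; rewrite !endact_aff -mulmxDl addrK mulmxK.
Qed.

Lemma affEVK L v : L \in unitmx ->
  cancel (endact (affE (invmx L) (- v *m invmx L))) (endact (affE L v)).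
Proof.
by move=> LU x; rewrite !endact_aff -mulmxDl mulmxKV // subrK.
Qed.

Lemma act_aff L v x : L \in unitmx -> act (aff L v) x = x *m L + v.
Proof.
by move=> LU; rewrite act_mkAut ?endact_aff //; [exact: affEK | exact: affEVK].
Qed.

Lemma aff_map L v : L \in unitmx -> polyAut_map (aff L v) = affE L v.
Proof. by move=> LU; case: (mkAutE (affEK v LU) (affEVK v LU)). Qed.

Lemma aff_inv_map L v : L \in unitmx ->
  polyAut_inv_map (aff L v) = affE (invmx L) (- v *m invmx L).
Proof. by move=> LU; case: (mkAutE (affEK v LU) (affEVK v LU)). Qed.

Lemma msize_affE L v i : (msize (tnth (affE L v) i) <= 2)%N.
Proof.
rewrite tnth_mktuple; apply: leq_trans (msizeD_le _ _) _; rewrite geq_max.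
apply/andP; split; last by rewrite msizeC; case: eqP.
apply: leq_trans (msize_sum _ _ _) _; apply/bigmax_leqP_seq => j _ _.
by apply: leq_trans (msizeZ_le _ _) _; rewrite msizeX mdeg1.
Qed.

Lemma reg_affE T N (c : T -> 'rV[K]_N) (L : T -> 'M[K]_n) (v : T -> point) i :
    (forall i j, regular_on c predT (fun t => L t i j)) ->
    (forall j, regular_on c predT (fun t => v t ord0 j)) ->
  reg_mpoly c predT (fun t => tnth (affE (L t) (v t)) i).
Proof.
move=> Lr vr; apply: (@reg_mpoly_ext _ _ _ _ _ _ _
  (fun t => \sum_j L t j i *: 'X_j + (v t ord0 i)*: 1)) => [t _|].
  by rewrite tnth_mktuple -mul_mpolyC mulr1.
apply: reg_mpolyD; last exact: reg_mpolyZ (vr i) (reg_mpoly_const _ _ _).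
by apply: reg_mpoly_sum => j; apply: reg_mpolyZ (Lr j i) (reg_mpoly_const _ _ _).
Qed.

Lemma regfam_aff T N (c : T -> 'rV[K]_N) (L : T -> 'M[K]_n) (v : T -> point) :
    (forall t, L t \in unitmx) ->
    (forall i j, regular_on c predT (fun t => L t i j)) ->
    (forall i j, regular_on c predT (fun t => invmx (L t) i j)) ->
    (forall j, regular_on c predT (fun t => v t ord0 j)) ->
  regfam c (fun t => aff (L t) (v t)).
Proof.
move=> LU Lr Ir vr; apply: (@regfam_polyAut _ _ _ _ 1) => [t i|t i|i|i].
- by rewrite aff_map // msize_affE.
- by rewrite aff_inv_map // msize_affE.
- apply: reg_mpoly_ext (reg_affE i Lr vr) => t _; by rewrite aff_map.
have wr j : regular_on c predT (fun t => (- v t *m invmx (L t)) ord0 j).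
  apply: reg_ext (reg_sum (index_enum _)
    (fun k _ => reg_mul (reg_mul (reg_const c _ (-1)) (vr k)) (Ir k j))).
  by move=> t _; rewrite mxE; apply: eq_bigr => k _; rewrite mxE mulN1r.
by apply: reg_mpoly_ext (reg_affE i Ir wr) => t _; rewrite aff_inv_map.
Qed.

Definition trans v : Aut := aff 1%:M v.

Lemma act_trans v x : act (trans v) x = x + v.
Proof. by rewrite act_aff ?unitmx1 // mulmx1. Qed.

Lemma transD u v : trans (u + v) = (trans u * trans v)%g.
Proof. by apply: (act_eq charK0) => x; rewrite actM !act_trans addrA addrAC. Qed.

Lemma trans0 : trans 0 = 1%g.
Proof. by apply: (act_eq charK0) => x; rewrite act_trans act1 addr0. Qed.

Lemma transN v : trans (- v) = (trans v)^-1%g.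
Proof.
by apply: (@mulIg _ (trans v)); rewrite -transD addNr trans0 mulVg.
Qed.

Lemma regfam_trans T N (c : T -> 'rV[K]_N) (v : T -> point) :
    (forall j, regular_on c predT (fun t => v t ord0 j)) ->
  regfam c (fun t => trans (v t)).
Proof.
move=> vr; apply: regfam_aff => // [t|i j|i j]; first exact: unitmx1.
  exact: reg_const.
exact: reg_const.
Qed.

Lemma mderiv0_meval_shift (p : {mpoly K[n]}) i x c :
  p^`M(i) = 0 -> p.@[(x + c *: delta_mx 0 i) ord0] = p.@[x ord0].
Proof.
move=> pi0; pose u s := p.@[(x + s *: delta_mx 0 i) ord0].
suff H : forall s, u s = u 0 by rewrite -/(u c) H /u scale0r addr0.
apply: (isder0_shift_const charK0) => a.
pose v s : 'I_n -> K := (x + (a + s) *: delta_mx 0 i) ord0.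
have vw j : isder0 (v^~ j) (i == j)%:R.
  apply: isder0_ext (isder0D (isder0_const (x 0 j + a * (i == j)%:R))
    (isder0Z (i == j)%:R (isder0_id K))) => [s|].
    by rewrite /v !mxE eqxx eq_sym mulrDl addrA [_%:R * s]mulrC.
  by rewrite add0r mulr1.
apply: isder0_ext (isder0_meval p vw) => //; rewrite big1 // => j _.
by case: eqP => [<-|_]; rewrite ?pi0 ?meval0 ?mul0r ?mulr0.
Qed.

Definition shearE i (p : {mpoly K[n]}) : End :=
  [tuple 'X_j + (j == i)%:R *: p | j < n].

Lemma endact_shear i p x :
  endact (shearE i p) x = x + p.@[x ord0] *: delta_mx 0 i.
Proof.
apply/rowP => j; rewrite !mxE tnth_mktuple mevalD mevalXU mevalZ eqxx /=.
by rewrite mulrC.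
Qed.

Definition shear i p : Aut := mkAut (shearE i p) (shearE i (- p)).

Lemma shearEK i p : p^`M(i) = 0 ->
  cancel (endact (shearE i p)) (endact (shearE i (- p))).
Proof.
move=> pi0 x; rewrite !endact_shear mevalN mderiv0_meval_shift //.
by rewrite scaleNr addrK.
Qed.

Lemma shearEVK i p : p^`M(i) = 0 ->
  cancel (endact (shearE i (- p))) (endact (shearE i p)).
Proof.
move=> pi0; rewrite -[X in cancel _ (_ (shearE i X))]opprK; apply: shearEK.
by rewrite mderivN pi0 oppr0.
Qed.

Lemma act_shear i p x : p^`M(i) = 0 ->
  act (shear i p) x = x + p.@[x ord0] *: delta_mx 0 i.
Proof.
by move=> pi0; rewrite act_mkAut ?endact_shear //; [exact: shearEK | exact: shearEVK].
Qed.

Lemma shearD i p q : p^`M(i) = 0 -> q^`M(i) = 0 ->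
  shear i (p + q) = (shear i p * shear i q)%g.
Proof.
move=> pi0 qi0; apply: (act_eq charK0) => x.
rewrite actM !act_shear ?mderivD ?pi0 ?qi0 ?addr0 // mderiv0_meval_shift //.
by rewrite mevalD scalerDl addrA addrAC.
Qed.

Lemma shearC i (c : K) : shear i c%:MP = trans (c *: delta_mx 0 i).
Proof.
by apply: (act_eq charK0) => x; rewrite act_shear ?mderivC // mevalC act_trans.
Qed.

Lemma regfam_shear i p : p^`M(i) = 0 -> regfam line (fun s => shear i (s *: p)).
Proof.
move=> pi0; have spi0 s : (s *: p)^`M(i) = 0 by rewrite mderivZ pi0 scaler0.
have sz q j : (msize q <= msize p)%N -> (msize (tnth (shearE i q) j) <= (msize p).+2)%N.
  move=> qp; rewrite tnth_mktuple; apply: leq_trans (msizeD_le _ _) _.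
  rewrite geq_max msizeX mdeg1 /=; apply: leq_trans (msizeZ_le _ _) _.
  by apply: leq_trans qp _; rewrite -addn2 leq_addr.
have rg (a : K) j :
    reg_mpoly line predT (fun s => tnth (shearE i ((a * s) *: p)) j).
  apply: (@reg_mpoly_ext _ _ _ _ _ _ _
    (fun s => 'X_j + (a * s) *: ((j == i)%:R *: p))) => [s _|].
    by rewrite tnth_mktuple !scalerA [_ * (_ == _)%:R]mulrC.
  apply: reg_mpolyD; first exact: reg_mpoly_const.
  apply: reg_mpolyZ (reg_mpoly_const _ _ _).
  exact: reg_mul (reg_const _ _ a) (line_id K).
apply: (@regfam_polyAut _ _ _ _ (msize p).+1) => [s j|s j|j|j].
- rewrite (proj1 (mkAutE (shearEK (spi0 s)) (shearEVK (spi0 s)))).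
  by apply/sz/msizeZ_le.
- rewrite (proj2 (mkAutE (shearEK (spi0 s)) (shearEVK (spi0 s)))).
  by apply: sz; rewrite -scaleNr; apply: msizeZ_le.
- apply: reg_mpoly_ext (rg 1 j) => s _.
  by rewrite (proj1 (mkAutE (shearEK (spi0 s)) (shearEVK (spi0 s)))) mul1r.
apply: reg_mpoly_ext (rg (-1) j) => s _.
by rewrite (proj2 (mkAutE (shearEK (spi0 s)) (shearEVK (spi0 s)))) mulN1r scaleNr.
Qed.

Lemma tangent_shear i p : p^`M(i) = 0 ->
  tangent (fun s => shear i (s *: p)) (fun j => (j == i)%:R *: p).
Proof.
move=> pi0 x j; rewrite mevalZ.
apply: isder0_ext (isder0D (isder0_const (x ord0 j))
  (isder0Z ((j == i)%:R * p.@[x ord0]) (isder0_id K))) => [s|].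
  rewrite act_shear ?mderivZ ?pi0 ?scaler0 // !mxE mevalZ eqxx /=.
  by ring.
by rewrite add0r mulr1.
Qed.

Definition jdet f : {mpoly K[n]} := \det (jacobian (polyAut_map f)).
Lemma kappaE f : kappa f = (jdet f)@_0%MM.
Proof. by rewrite unlock. Qed.

Lemma jdetM f g : jdet (f * g)%g = (jdet f \mPo polyAut_map g) * jdet g.
Proof. by rewrite /jdet jacobian_comp det_mulmx det_map_mx. Qed.

Lemma jdet1 : jdet 1%g = 1.
Proof. by rewrite /jdet jacobian_id det1. Qed.

(** By the chain rule for [f^-1 * f], the determinant is a unit of the polynomial ring; degrees add,
    so it has degree 0. *)
Lemma jdetE f : jdet f = (kappa f)%:MP.
Proof.
have e : (jdet f^-1%g \mPo polyAut_map f) * jdet f = 1.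
  by rewrite -jdetM mulVg jdet1.
have n0 : (jdet f^-1%g \mPo polyAut_map f) * jdet f != 0 by rewrite e oner_neq0.
move: (n0); rewrite mulf_eq0 negb_or => /andP[a0 b0].
rewrite kappaE; apply: msize1_polyC.
have := msizeM a0 b0; rewrite e msize1.
move: a0 b0; rewrite -!msize_poly_eq0.
case: (msize (_ \mPo _)) => // a; case: (msize (jdet f)) => // b; rewrite addSn addnS.
by move=> _ _ [/esym/eqP]; rewrite addn_eq0 => /andP[_ /eqP->].
Qed.

Lemma kappaM f g : kappa (f * g)%g = kappa f * kappa g.
Proof.
by rewrite !kappaE jdetM !jdetE comp_mpolyC -mpolyCM !mcoeffC eqxx !mulr1.
Qed.

Lemma kappa1 : kappa (1%g : Aut) = 1.
Proof. by rewrite !kappaE jdet1 mcoeff1 eqxx. Qed.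

Lemma kappa_neq0 f : kappa f != 0.
Proof.
apply/eqP => f0; have := kappaM f^-1%g f.
by rewrite mulVg kappa1 f0 mulr0 => /eqP; rewrite oner_eq0.
Qed.

Lemma kappaV f : kappa f^-1%g = (kappa f)^-1.
Proof.
apply: (@mulIf _ (kappa f)); first exact: kappa_neq0.
by rewrite -kappaM mulVg kappa1 mulVf // kappa_neq0.
Qed.

Lemma polySAutE f : (f \in @polySAut_pred K n) = (kappa f == 1).
Proof.
rewrite inE -/(jdet f) jdetE -[1 in LHS]mpolyC1.
by rewrite (inj_eq (can_inj (@mpolyCK n K))).
Qed.

Lemma kappa_val (h : SAut) : kappa (val h) = 1.
Proof. by apply/eqP; rewrite -polySAutE; apply: valP. Qed.

Lemma regfam_kappa T N (c : T -> 'rV[K]_N) (F : T -> Aut) :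
  regfam c F -> regular_on c predT (fun t => kappa (F t)).
Proof.
move=> [d FF]; suff H : reg_mpoly c predT (fun t => jdet (F t)).
  by apply: reg_ext (H 0%MM) => t _; rewrite kappaE.
apply: reg_mpoly_det => i j.
apply: reg_mpoly_ext (reg_mpoly_deriv j (regfam_mpoly i FF)) => t _.
by rewrite mxE.
Qed.

(** The additive group has no nontrivial character: such a character is a polynomial [P] with
    [P(s) P(-s) = 1], hence of degree 0. *)
Lemma kappa_Ga (c : K -> Aut) : regfam line c ->
  (forall s t, c (s + t) = c s * c t)%g -> forall s, kappa (c s) = 1.
Proof.
move=> cf cM; have [_ [P cP _]] := line_deriv (regfam_kappa cf).
have c0 : c 0 = 1%g.
  by apply: (@mulgI _ (c 0)); rewrite -cM addr0 mulg1.
have PV : P * (P \Po - 'X) = 1.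
  apply: (poly_horner_inj charK0) => s.
  rewrite hornerM horner_comp hornerN hornerX -!cP -kappaM -cM subrr.
  by rewrite c0 kappa1 hornerC.
have : size (P * (P \Po - 'X)) == 1%N by rewrite PV size_poly1.
rewrite size_mul_eq1 => /andP[/eqP P1 _].
have [a PE] : exists a, P = a%:P by exists P`_0; apply: size1_polyC; rewrite P1.
by move=> s; rewrite -kappa1 -c0 !cP PE !hornerC.
Qed.

Lemma kappa_aff L v : L \in unitmx -> kappa (aff L v) = \det L.
Proof.
move=> LU; rewrite kappaE /jdet aff_map //.
have -> : jacobian (affE L v) = map_mx (@mpolyC n K) L^T.
  apply/matrixP => i j; rewrite !mxE tnth_mktuple mderivD mderivC addr0.
  rewrite raddf_sum (bigD1 j) //= big1 ?addr0 => [|k kj].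
    by rewrite mderivZ mderivX mnm1E eqxx mnm_subnn mpolyX0 scale1r -mul_mpolyC mulr1.
  by rewrite mderivZ mderivX mnm1E (negPf kj) scale0r scaler0.
by rewrite det_map_mx mcoeffC eqxx mulr1 det_tr.
Qed.

Lemma kappa_trans v : kappa (trans v) = 1.
Proof. by rewrite kappa_aff ?unitmx1 // det1. Qed.

Lemma kappa_shear i p : p^`M(i) = 0 -> kappa (shear i p) = 1.
Proof.
move=> pi0; rewrite -[p]scale1r.
apply: (kappa_Ga (regfam_shear pi0)) => s t.
by rewrite scalerDl shearD // mderivZ pi0 scaler0.
Qed.

Lemma toSAutK f : kappa f = 1 -> val (toSAut f) = f.
Proof.
move=> f1; have fP : polySAut_pred f.
  by rewrite -[polySAut_pred f]/(f \in @polySAut_pred K n) polySAutE f1.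
by rewrite unlock val_insubd fP.
Qed.

Lemma valSAutM (h k : SAut) : val (h * k)%g = (val h * val k)%g.
Proof. exact: gmulfM. Qed.

Lemma valSAut1 : val (1%g : SAut) = 1%g.
Proof. exact: gmulf1. Qed.

Lemma valSAutV (h : SAut) : val h^-1%g = (val h)^-1%g.
Proof. exact: gmulfV. Qed.

Lemma toSAutM f g : kappa f = 1 -> kappa g = 1 ->
  toSAut (f * g)%g = (toSAut f * toSAut g)%g.
Proof.
move=> f1 g1; apply: val_inj.
by rewrite valSAutM !toSAutK // kappaM f1 g1 mulr1.
Qed.

Lemma toSAut_val (h : SAut) : toSAut (val h) = h.
Proof. by apply: val_inj; rewrite toSAutK // kappa_val. Qed.

Lemma toSAutV f : kappa f = 1 -> toSAut f^-1%g = (toSAut f)^-1%g.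
Proof.
move=> f1; apply: val_inj.
by rewrite valSAutV !toSAutK // kappaV f1 invr1.
Qed.

Lemma toSAut1 : toSAut (1%g : Aut) = 1%g.
Proof. by rewrite -valSAut1 toSAut_val. Qed.

Lemma regfam_toSAut T N (c : T -> 'rV[K]_N) (F : T -> Aut) :
  regfam c F -> (forall t, kappa (F t) = 1) -> regfam c (fun t => toSAut (F t)).
Proof.
move=> [d [Fd Fr]] F1; exists d; split=> [t|j].
  by rewrite inE toSAutK.
by apply: reg_ext (Fr j) => t _; rewrite /ind_chart /= toSAutK.
Qed.

Lemma val_ind_morphism : ind_morphism (fun h : SAut => val h).
Proof. by move=> d; exists d; split=> // j; apply: reg_coord. Qed.

End Elementary.

(** * Divergence *)

Section Divergence.
Context (K : fieldType) (charK0 : [pchar K] =i pred0) (n : nat).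
Local Notation Aut := (polyAut K n).
Local Notation SAut := (polySAut K n).
Local Notation point := 'rV[K]_n.
Local Notation field := ('I_n -> {mpoly K[n]}).
Implicit Types (f g : Aut) (x y v : point) (X Y : field).

Lemma isder0_prod_exists I (r : seq I) (P : pred I) (u : I -> K -> K) :
    (forall i, exists b, isder0 (u i) b) ->
  exists b, isder0 (fun s => \prod_(i <- r | P i) u i s) b.
Proof.
move=> ub; elim: r => [|i r [b IH]].
  by exists 0; apply: isder0_ext (isder0_const 1) => // s; rewrite big_nil.
have [a ua] := ub i; case Pi: (P i); last first.
  by exists b; apply: isder0_ext IH => // s; rewrite big_cons Pi.
exists (a * \prod_(i <- r | P i) u i 0 + u i 0 * b).
by apply: isder0_ext (isder0M ua IH) => // s; rewrite big_cons Pi.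
Qed.

Lemma isder0_prod1 I (r : seq I) (u : I -> K -> K) (b : I -> K) :
    (forall i, isder0 (u i) (b i)) -> (forall i, u i 0 = 1) ->
  isder0 (fun s => \prod_(i <- r) u i s) (\sum_(i <- r) b i).
Proof.
move=> ub u1; elim: r => [|i r IH].
  by apply: isder0_ext (isder0_const 1) => [s|]; rewrite big_nil.
apply: isder0_ext (isder0M (ub i) IH) => [s|]; rewrite big_cons //.
by rewrite u1 mul1r (eq_bigr (fun=> 1)) ?big1_eq ?mulr1 // => k _; rewrite u1.
Qed.

Lemma isder0_det k (M : K -> 'M[K]_k) (B : 'M[K]_k) :
    (forall i j, isder0 (fun s => M s i j) (B i j)) -> M 0 = 1%:M ->
  isder0 (fun s => \det (M s)) (\tr B).
Proof.
move=> MB M0.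
have H (sg : 'S_k) : isder0 (fun s => (-1) ^+ sg * \prod_i M s i (sg i))
    (if sg == 1%g then \tr B else 0).
  have [->|sg1] := eqVneq sg 1%g.
    rewrite odd_perm1 expr0; apply: isder0_ext (isder0Z 1 (isder0_prod1 (index_enum _)
      (u := fun i s => M s i i) (fun i => MB i i) _)) => [s||i].
    - by congr (_ * _); apply: eq_bigr => i _; rewrite perm1.
    - by rewrite mul1r.
    by rewrite M0 mxE eqxx.
  (* A permutation that moves [i] also moves [sg i]; its product has two factors vanishing at 0, so
     it contributes nothing to the first order. *)
  have [i sgi] : exists i, sg i != i.
    apply/existsP; apply: contraNT sg1; rewrite negb_exists => /forallP s1.
    by apply/eqP/permP => i; rewrite perm1; apply/eqP; have := s1 i; rewrite negbK.
  have [b Hb] := @isder0_prod_exists _ (index_enum _)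
    (fun l => (l != i) && (l != sg i)) (fun l s => M s l (sg l))
    (fun l => ex_intro _ _ (MB l (sg l))).
  apply: isder0_ext (isder0Z ((-1) ^+ sg) (isder0M (MB i (sg i))
    (isder0M (MB (sg i) (sg (sg i))) Hb))) => [s|].
    by rewrite [in RHS](bigD1 i) // [in RHS](bigD1 (sg i)).
  have sgi' : (i == sg i) = false by rewrite eq_sym (negPf sgi).
  rewrite !M0 !mxE (inj_eq perm_inj) sgi'.
  by rewrite !mul0r !mulr0 addr0 mulr0.
apply: isder0_ext (isder0_sum (index_enum _) (fun sg _ => H sg)) => //.
by rewrite (bigD1 1%g) //= eqxx big1 ?addr0 // => sg /negPf ->.
Qed.

Definition div X : {mpoly K[n]} := \sum_i (X i)^`M(i).

(** The Jacobian determinant is 1 along the curve, and its derivative at the identity is the trace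
    of the Jacobian matrix of [X]. *)
Lemma tangent_div (c : K -> Aut) X : regfam line c -> c 0 = 1%g ->
  (forall s, kappa (c s) = 1) -> tangent c X -> div X = 0.
Proof.
move=> cf c0 c1 cX; apply: (mpoly_meval_eq0 charK0) => x.
pose M s : 'M_n := \matrix_(i, j) (tnth (polyAut_map (c s)) i)^`M(j).@[x ord0].
pose B : 'M_n := \matrix_(i, j) (X i)^`M(j).@[x ord0].
have MB i j : isder0 (fun s => M s i j) (B i j).
  have [d cd] := cf; have [Y [cY [Yw Ym]]] := tangent_mcoeff_exists cd.
  pose P s := (tnth (polyAut_map (c s)) i)^`M(j).
  have szd (p : {mpoly K[n]}) : (msize p <= d.+1)%N -> (msize p^`M(j) <= d.+1)%N.
    move=> pd; have [->|p0] := eqVneq p^`M(j) 0; first by rewrite msize0.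
    exact: leq_trans (ltnW (msize_mderiv p0)) pd.
  have Pw s : (msize (P s) <= d.+1)%N by apply/szd/polyAut_msize/(proj1 cd).
  have Pm m : isder0 (fun s => (P s)@_m) ((Y i)^`M(j))@_m.
    apply: isder0_ext (isder0Z (m j).+1%:R (Ym i (m + U_(j))%MM)) => [s|].
      by rewrite mcoeff_mderiv mulr_natl.
    by rewrite mcoeff_mderiv mulr_natl.
  apply: isder0_ext (isder0_meval_regfam Pw (szd _ (Yw i)) Pm (isder0_coord x)) => [s|].
    by rewrite mxE.
  rewrite mxE (tangent_uniq charK0 cX cY) big1 ?addr0 // => k _.
  by rewrite mxE mulr0.
have M0 : M 0 = 1%:M by apply/matrixP => i j; rewrite !mxE c0 mderiv_id.
have det1 s : \det (M s) = 1.
  have := congr1 (meval (x ord0)) (jdetE (c s)); rewrite c1 mevalC => <-.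
  rewrite /jdet -det_map_mx; congr (\det _).
  by apply/matrixP => i j; rewrite !mxE.
rewrite /div raddf_sum.
have -> : \sum_i (X i)^`M(i).@[x ord0] = \tr B by apply: eq_bigr => i _; rewrite mxE.
apply: isder0_uniq (isder0_det MB M0) _ => //.
by apply: isder0_ext (isder0_const 1) => // s.
Qed.

Lemma mderivXU (k l : 'I_n) : ('X_k : {mpoly K[n]})^`M(l) = (k == l)%:R.
Proof.
rewrite mderivX mnm1E; case: eqP => [->|_]; last by rewrite scale0r.
by rewrite mnm_subnn mpolyX0 scale1r.
Qed.

Lemma mderiv_antideriv (i : 'I_n) (p : {mpoly K[n]}) : exists q, q^`M(i) = p.
Proof.
elim/mpolyind: p => [|c m p _ _ [q <-]]; first by exists 0; rewrite mderiv0.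
exists ((c / (m i).+1%:R) *: 'X_[m + U_(i)] + q).
rewrite mderivD mderivZ mderivX addmK mnmDE mnm1E eqxx addn1 scalerA.
by rewrite divfK // natf_eq0.
Qed.

Lemma mderiv_sum (i : 'I_n) I (r : seq I) (P : pred I) (F : I -> {mpoly K[n]}) :
  (\sum_(k <- r | P k) F k)^`M(i) = \sum_(k <- r | P k) (F k)^`M(i).
Proof. exact: raddf_sum. Qed.

Lemma mderiv_prodX (P : pred 'I_n) (m : 'X_{1..n}) i : ~~ P i ->
  (\prod_(j | P j) ('X_j : {mpoly K[n]}) ^+ m j)^`M(i) = 0.
Proof.
move=> Pi; elim/big_rec: _ => [|j q Pj q0]; first by rewrite -mpolyC1 mderivC.
rewrite mderivM q0 mulr0 addr0 mpolyXn mderivX mulmnE mnm1E.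
by case: eqP => [ji|_]; rewrite ?ji ?(negPf Pi) // mul0n scale0r mul0r in Pj *.
Qed.

End Divergence.

(** * Contraction of an automorphism to its linear part *)

Section Contraction.
Context (K : fieldType) (charK0 : [pchar K] =i pred0) (n : nat).
Local Notation Aut := (polyAut K n).
Local Notation SAut := (polySAut K n).
Local Notation point := 'rV[K]_n.
Implicit Types (f g : Aut) (x y v : point).

Lemma meval_row0 (p : {mpoly K[n]}) : p.@[(0 : point) ord0] = p@_0%MM.
Proof.
rewrite [in LHS](mpolyE p) [in RHS](mpolyE p) !raddf_sum; apply: eq_bigr => m _ /=.
rewrite mevalZ mcoeffZ mevalX mcoeffX; congr (_ * _).
have [->|m0] := eqVneq m 0%MM.
  by rewrite big1 // => i _; rewrite mnm0E expr0.
have [i mi] := mnm_neq0_exists m0.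
by rewrite (bigD1 i) //= mxE expr0n (negPf mi) mul0r.
Qed.

Definition lin0 f : 'M[K]_n :=
  \matrix_(j, i) (tnth (polyAut_map f) i)@_U_(j).

Lemma lin0E f :
  (lin0 f)^T = map_mx (meval ((0 : point) ord0)) (jacobian (polyAut_map f)).
Proof.
apply/matrixP => i j; rewrite !mxE meval_row0 mcoeff_mderiv mnm0E add0m.
by rewrite mulr1n.
Qed.

Lemma det_lin0 f : \det (lin0 f) = kappa f.
Proof. by rewrite -det_tr lin0E det_map_mx /= meval_row0 kappaE. Qed.

Lemma lin0_unit f : lin0 f \in unitmx.
Proof.
by rewrite unitmxE det_lin0 unitfE kappa_neq0.
Qed.

Lemma lin0M f g : act g 0 = 0 -> lin0 (f * g)%g = lin0 g *m lin0 f.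
Proof.
move=> g0; apply: trmx_inj; rewrite trmx_mul !lin0E.
have -> : jacobian (polyAut_map (f * g)%g) =
    map_mx (comp_mpoly (polyAut_map g)) (jacobian (polyAut_map f))
      *m jacobian (polyAut_map g) by exact: jacobian_comp.
rewrite map_mxM; congr (_ *m _).
apply/matrixP => i j; rewrite !mxE /= comp_mpoly_meval; apply: meval_eq => k.
by rewrite -actE g0.
Qed.

Lemma lin01 : lin0 1%g = 1%:M.
Proof.
by apply: trmx_inj; rewrite lin0E jacobian_id map_scalar_mx trmx1 rmorph1.
Qed.

Lemma lin0V f : act f 0 = 0 -> lin0 f^-1%g = invmx (lin0 f).
Proof.
move=> f0; apply: (can_inj (mulmxK (lin0_unit f))).
have fV0 : act f^-1%g 0 = 0 by rewrite -[X in act _ X]f0 actK.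
rewrite mulVmx ?lin0_unit //.
have e : lin0 (f^-1 * f)%g = 1%:M by rewrite mulVg lin01.
by apply: (mulmx1C (A := lin0 f)); rewrite -lin0M // e.
Qed.

Lemma affV (L : 'M[K]_n) : L \in unitmx -> (aff L 0)^-1%g = aff (invmx L) 0.
Proof.
move=> LU; apply: (@mulIg _ (aff L 0)); rewrite mulVg.
apply: (act_eq charK0) => x.
by rewrite act1 actM !act_aff ?unitmx_inv // !addr0 mulmxK.
Qed.

(** For nonzero [c] this is [x |-> c^-1 f(c x)]. If [f] fixes 0, the value prescribed at [c = 0] is
    the one that extends the family polynomially. *)
Definition contract (c : K) f : Aut :=
  if c == 0 then aff (lin0 f) 0
  else (aff c^-1%:M 0 * f * aff c%:M 0)%g.

Lemma scalar_unit (c : K) : c != 0 -> c%:M \in @unitmx K n.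
Proof. by move=> c0; rewrite unitmxE det_scalar unitrX // unitfE. Qed.

Lemma invmx_scalarV (c : K) : c != 0 -> invmx (c%:M : 'M[K]_n) = c^-1%:M.
Proof. by move=> c0; rewrite invmx_scalar. Qed.

Lemma affE_scalar (c : K) i : tnth (affE (c%:M : 'M[K]_n) 0) i = c *: 'X_i.
Proof.
rewrite tnth_mktuple mxE mpolyC0 addr0 (bigD1 i) //= mxE eqxx mulr1n.
rewrite big1 ?addr0 // => j ji.
by rewrite mxE (negPf ji) mulr0n scale0r.
Qed.

Lemma mcoeff_comp_scale (p : {mpoly K[n]}) c m :
  (p \mPo affE c%:M 0)@_m = c ^+ mdeg m * p@_m.
Proof.
elim/mpolyind: p => [|a k p _ _ IH]; first by rewrite comp_mpoly0 !mcoeff0 mulr0.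
rewrite comp_mpolyD comp_mpolyZ mcoeffD IH !mcoeffD !mcoeffZ mulrDr; congr (_ + _).
have -> : 'X_[k] \mPo affE c%:M 0 = c ^+ mdeg k *: 'X_[k].
  rewrite comp_mpolyX [in RHS]mpolyXE_id mdegE -prodrXr -scaler_prod.
  by apply: eq_bigr => i _; rewrite affE_scalar exprZn.
rewrite mcoeffZ mcoeffX; case: eqP => [->|_]; rewrite ?mulr0 //; ring.
Qed.

(** One formula for all [c], without negative powers. The truncated predecessor does no harm in
    degree 0, where the coefficient vanishes because [f] fixes 0; at [c = 0] the convention
    [0 ^ 0 = 1] keeps exactly the linear terms. *)
Lemma mcoeff_contract c f i m : act f 0 = 0 ->
  (tnth (polyAut_map (contract c f)) i)@_m =
    c ^+ (mdeg m).-1 * (tnth (polyAut_map f) i)@_m.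
Proof.
move=> f0; rewrite /contract; have [->|c0] := eqVneq c 0; last first.
  have -> : polyAut_map (aff c^-1%:M 0 * f * aff c%:M 0)%g = polyEnd_comp
      (polyEnd_comp (affE c^-1%:M 0) (polyAut_map f)) (affE c%:M 0).
    by rewrite -!aff_map ?scalar_unit ?invr_eq0.
  rewrite tnth_mktuple [tnth (polyEnd_comp _ _) _]tnth_mktuple affE_scalar.
  rewrite comp_mpolyZ comp_mpolyXt comp_mpolyZ mcoeffZ.
  rewrite mcoeff_comp_scale; case: (posnP (mdeg m)) => [m0|m0].
    have -> : m = 0%MM by apply/eqP; rewrite -mdeg_eq0 m0.
    by rewrite -meval_row0 -actE f0 mxE !mulr0.
  by rewrite -[in LHS](prednK m0) exprS !mulrA mulVf // mul1r.
rewrite aff_map ?lin0_unit // tnth_mktuple mxE mpolyC0 addr0 raddf_sum /=.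
under eq_bigr => j _ do rewrite mcoeffZ mcoeffX mxE.
have [/mdeg1P[j /eqP ->]|m1] := boolP (mdeg m == 1%N).
  rewrite mdeg1 expr0 mul1r (bigD1 j) //= eqxx mulr1 big1 ?addr0 //.
  by move=> k kj; rewrite eq_mnm1 (negPf kj) mulr0.
rewrite big1 => [|j _]; last first.
  by case: eqP => [e|_]; rewrite ?mulr0 // -e mdeg1 in m1 *.
case: (posnP (mdeg m)) => [m0|m0].
  have -> : m = 0%MM by apply/eqP; rewrite -mdeg_eq0 m0.
  by rewrite -meval_row0 -actE f0 mxE !mulr0.
rewrite expr0n; case: (mdeg m) m1 m0 => [|[|k]] //= _ _.
by rewrite mul0r.
Qed.

Lemma contractV c f : act f 0 = 0 -> (contract c f)^-1%g = contract c f^-1%g.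
Proof.
move=> f0; rewrite /contract; have [_|c0] := eqVneq c 0.
  by rewrite affV ?lin0_unit // lin0V.
rewrite !invMg !affV ?scalar_unit ?invr_eq0 // !invmx_scalarV ?invr_eq0 //.
by rewrite invrK mulgA.
Qed.

Lemma kappa_contract c f : kappa (contract c f) = kappa f.
Proof.
rewrite /contract; have [_|c0] := eqVneq c 0.
  by rewrite kappa_aff ?lin0_unit // det_lin0.
rewrite !kappaM !kappa_aff ?scalar_unit ?invr_eq0 // !det_scalar.
by rewrite mulrAC -exprMn mulVf // expr1n mul1r.
Qed.

Lemma contract1 f : contract 1 f = f.
Proof.
rewrite /contract oner_eq0 invr1; have -> : aff 1%:M 0 = 1%g :> Aut by exact: trans0.
by rewrite mul1g mulg1.
Qed.

Lemma contract0 f : contract 0 f = aff (lin0 f) 0.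
Proof. by rewrite /contract eqxx. Qed.

Lemma regfam_contract f : act f 0 = 0 -> regfam line (fun c => contract c f).
Proof.
move=> f0; have fV0 : act f^-1%g 0 = 0 by rewrite -[X in act _ X]f0 actK.
have E1 c i m := @mcoeff_contract c f i m f0.
have E2 c i m : (tnth (polyAut_inv_map (contract c f)) i)@_m =
    c ^+ (mdeg m).-1 * (tnth (polyAut_inv_map f) i)@_m.
  have := @mcoeff_contract c f^-1%g i m fV0; rewrite -contractV //; exact.
have rX k : regular_on line predT (fun c : K => c ^+ k).
  elim: k => [|k IH]; first by apply: reg_ext (reg_const _ _ 1) => t _.
  by apply: reg_ext (reg_mul (line_id K) IH) => t _; rewrite exprS.
pose e := (\max_i maxn (msize (tnth (polyAut_map f) i))
                       (msize (tnth (polyAut_inv_map f) i)))%N.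
have le (p q : {mpoly K[n]}) c : (forall m, p@_m = c ^+ (mdeg m).-1 * q@_m) ->
    (msize p <= msize q)%N.
  move=> pq; rewrite [in X in (X <= _)%N]msizeE; apply/bigmax_leqP_seq => m.
  rewrite mcoeff_msupp pq mulf_eq0 negb_or => /andP[_ qm] _.
  by apply: msize_mdeg_lt; rewrite mcoeff_msupp.
have e1 i : (msize (tnth (polyAut_map f) i) <= e.+1)%N.
  apply/leqW; apply: leq_trans (leq_bigmax i); exact: leq_maxl.
have e2 i : (msize (tnth (polyAut_inv_map f) i) <= e.+1)%N.
  apply/leqW; apply: leq_trans (leq_bigmax i); exact: leq_maxr.
apply: (@regfam_polyAut _ _ _ _ _ _ e) => [c i|c i|i m|i m].
- by apply: leq_trans (e1 i); apply: (le _ _ c) => m; apply: E1.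
- by apply: leq_trans (e2 i); apply: (le _ _ c) => m; apply: E2.
- by apply: reg_ext (reg_mul (rX (mdeg m).-1) (reg_const _ _ _)) => c _; apply: E1.
by apply: reg_ext (reg_mul (rX (mdeg m).-1) (reg_const _ _ _)) => c _; apply: E2.
Qed.

End Contraction.

(** * Homomorphisms agreeing on affine maps and shears *)

Section Rigidity.
Context (K : fieldType) (charK0 : [pchar K] =i pred0) (n : nat).
Local Notation Aut := (polyAut K n).
Local Notation SAut := (polySAut K n).
Local Notation point := 'rV[K]_n.
Local Notation field := ('I_n -> {mpoly K[n]}).
Implicit Types (f g : Aut) (x y v : point) (X Y : field).

(** The chart also contains the coefficients of the inverse, but along a curve through 1 the inverse
    has velocity [- X], so [X] determines the whole jet. *)
Lemma same_jet_SAut (F G : K -> SAut) X :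
    F 0 = 1%g -> G 0 = 1%g ->
    tangent (fun s => val (F s)) X -> tangent (fun s => val (G s)) X ->
  same_jet F G.
Proof.
move=> F0 G0 FX GX; split=> [|d j FF GG]; first by rewrite F0 G0.
have jets (H : K -> SAut) : regfam_at d line H -> H 0 = 1%g ->
    tangent (fun s => val (H s)) X ->
    (forall i m, isder0 (fun s => (tnth (polyAut_map (val (H s))) i)@_m) (X i)@_m) /\
    (forall i m, isder0 (fun s => (tnth (polyAut_inv_map (val (H s))) i)@_m) (- X i)@_m).
  move=> HH H0 HX; have Hf : regfam line (fun s => val (H s)) by exists d.
  split=> i m; first exact: (tangent_mcoeff charK0).
  have H0' : val (H 0) = 1%g by rewrite H0.
  exact: (tangent_mcoeff charK0 (regfam_inv Hf) (tangent_inv charK0 Hf H0' HX)).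
have [F1 F2] := jets F FF F0 FX; have [G1 G2] := jets G GG G0 GX.
rewrite -(splitK j); case: (split j) => {}j /=;
  set i := (polyEnd_index j).1; set m := (polyEnd_index j).2.
  exists (X i)@_m; [move: (F1 i m) | move: (G1 i m)];
    by apply: isder0_ext => // s; rewrite [RHS]row_mxEl mxE.
exists (- X i)@_m; [move: (F2 i m) | move: (G2 i m)];
  by apply: isder0_ext => // s; rewrite [RHS]row_mxEr mxE.
Qed.

Context (phi psi : SAut -> Aut).
Hypothesis phiM : {morph phi : h k / (h * k)%g}.
Hypothesis psiM : {morph psi : h k / (h * k)%g}.
Hypothesis phi_mor : ind_morphism phi.
Hypothesis psi_mor : ind_morphism psi.

Definition agree f : Prop := phi (toSAut f) = psi (toSAut f).

Lemma agreeM f g : kappa f = 1 -> kappa g = 1 ->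
  agree f -> agree g -> agree (f * g)%g.
Proof.
by rewrite /agree => f1 g1 fa ga; rewrite (toSAutM f1 g1) phiM psiM fa ga.
Qed.

Lemma hom1 (theta : SAut -> Aut) :
  {morph theta : h k / (h * k)%g} -> theta 1%g = 1%g.
Proof. by move=> tM; apply: (@mulgI _ (theta 1%g)); rewrite -tM !mulg1. Qed.

Lemma homV (theta : SAut -> Aut) h :
  {morph theta : h k / (h * k)%g} -> theta h^-1%g = (theta h)^-1%g.
Proof.
by move=> tM; apply: (@mulgI _ (theta h)); rewrite -tM !mulgV hom1.
Qed.

Lemma agree1 : agree 1%g.
Proof. by rewrite /agree toSAut1 // !hom1. Qed.

Lemma agreeV f : kappa f = 1 -> agree f -> agree f^-1%g.
Proof. by rewrite /agree => f1 fa; rewrite (toSAutV f1) !homV // fa. Qed.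

Hypothesis agree_lin : forall L : 'M[K]_n, \det L = 1 -> agree (aff L 0).
Hypothesis agree_trans : forall v, agree (trans v).
Hypothesis agree_shear : forall i p, p^`M(i) = 0 -> agree (shear i p).

(** The velocities at 1 of curves in SAut along which [phi] and [psi] coincide. They turn out to be
    all the fields of divergence 0. *)
Definition agree_tangent X : Prop :=
  exists c : K -> Aut, [/\ regfam line c, c 0 = 1%g,
    forall s, kappa (c s) = 1, tangent c X & forall s, agree (c s)].

Lemma agree_tangent_ext X Y : X =1 Y -> agree_tangent X -> agree_tangent Y.
Proof.
move=> XY [c [cf c0 c1 cX ca]]; exists c; split=> // x i; rewrite -XY; exact: cX.
Qed.

Lemma agree_tangent0 : agree_tangent (fun=> 0).
Proof.
exists (fun=> 1%g); split=> //; first exact: regfam_const.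
- by move=> _; apply: kappa1.
- exact: tangent_const.
by move=> _; apply: agree1.
Qed.

Lemma agree_tangentD X Y : agree_tangent X -> agree_tangent Y ->
  agree_tangent (fun i => X i + Y i).
Proof.
move=> [c [cf c0 c1 cX ca]] [d [df d0 d1 dX da]].
exists (fun s => c s * d s)%g; split; first exact: regfam_mul.
- by rewrite c0 d0 mulg1.
- by move=> s; rewrite kappaM c1 d1 mulr1.
- exact: tangent_mul.
by move=> s; apply: agreeM (c1 s) (d1 s) (ca s) (da s).
Qed.

Lemma agree_tangentZ a X : agree_tangent X -> agree_tangent (fun i => a *: X i).
Proof.
move=> [c [cf c0 c1 cX ca]]; exists (fun s => c (s * a)); split=> //.
- exact: regfam_scale.
- by rewrite mul0r.
exact: tangent_scale.
Qed.

Lemma agree_tangent_sum I (r : seq I) (P : pred I) (X : I -> field) :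
    (forall k, P k -> agree_tangent (X k)) ->
  agree_tangent (fun i => \sum_(k <- r | P k) X k i).
Proof.
move=> HX; elim: r => [|k r IH].
  by apply: agree_tangent_ext agree_tangent0 => i; rewrite big_nil.
case Pk: (P k); last by apply: agree_tangent_ext IH => i; rewrite big_cons Pk.
by apply: agree_tangent_ext (agree_tangentD (HX k Pk) IH) => i; rewrite big_cons Pk.
Qed.

(* Interpolation: [Y (2 t) - 2 ^ N Y t] kills the top coefficient. *)
Lemma agree_tangent_coef N (Y : nat -> field) :
    (forall t : K, agree_tangent (fun i => \sum_(b < N) t ^+ b *: Y b i)) ->
  forall b, (b < N)%N -> agree_tangent (Y b).
Proof.
elim: N Y => // N IH Y HY.
have lowY b : (b < N)%N -> agree_tangent (Y b).
  move=> bN.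
  have two_neq : 2%:R ^+ b - 2%:R ^+ N != 0 :> K.
    rewrite subr_eq0 -!natrX; apply/eqP => /(natf_inj charK0) /eqP.
    by rewrite eqn_exp2l // => /eqP e; rewrite e ltnn in bN.
  suff H : agree_tangent (fun i => (2%:R ^+ b - 2%:R ^+ N) *: Y b i).
    apply: agree_tangent_ext (agree_tangentZ (2%:R ^+ b - 2%:R ^+ N)^-1 H) => i.
    by rewrite scalerA mulVf // scale1r.
  apply: (IH (fun b i => (2%:R ^+ b - 2%:R ^+ N) *: Y b i)) bN => t.
  apply: agree_tangent_ext (agree_tangentD (HY (2%:R * t))
    (agree_tangentZ (- 2%:R ^+ N) (HY t))) => i.
  rewrite scaler_sumr -big_split big_ord_recr /= !scalerA -scalerDl.
  rewrite [X in X *: _](_ : _ = 0) ?scale0r ?addr0; last by rewrite exprMn; ring.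
  apply: eq_bigr => k _; rewrite !scalerA -scalerDl; congr (_ *: _).
  by rewrite exprMn; ring.
move=> b; rewrite ltnS leq_eqVlt => /orP[/eqP ->|]; last exact: lowY.
apply: agree_tangent_ext (agree_tangentD (HY 1) (agree_tangentZ (-1)
  (agree_tangent_sum (index_enum 'I_N) (P := predT)
    (fun (k : 'I_N) _ => lowY k (ltn_ord k))))) => i.
rewrite big_ord_recr /= expr1n scale1r scaleN1r addrAC.
under eq_bigr do rewrite expr1n scale1r.
by rewrite subrr add0r.
Qed.

Lemma agree_tangent_shear i p : p^`M(i) = 0 ->
  agree_tangent (fun j => (j == i)%:R *: p).
Proof.
move=> pi0; have spi0 s : (s *: p)^`M(i) = 0 by rewrite mderivZ pi0 scaler0.
exists (fun s => shear i (s *: p)); split.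
- exact: regfam_shear.
- by rewrite scale0r -mpolyC0 shearC // scale0r trans0.
- by move=> s; apply: kappa_shear.
- exact: tangent_shear.
by move=> s; apply: agree_shear.
Qed.

Lemma agree_tangent_conj X Y f : kappa f = 1 -> agree f -> agree_tangent X ->
    (forall x i, (Y i).@[act f x ord0] =
       \sum_j (tnth (polyAut_map f) i)^`M(j).@[x ord0] * (X j).@[x ord0]) ->
  agree_tangent Y.
Proof.
move=> f1 fa [c [cf c0 c1 cX ca]] XY; have fV1 : kappa f^-1%g = 1.
  by rewrite kappaV f1 invr1.
exists (fun s => f * c s * f^-1)%g; split.
- by apply: regfam_mul (regfam_const _ _); apply: regfam_mul (regfam_const _ _) cf.
- by rewrite c0 mulg1 mulgV.
- by move=> s; rewrite !kappaM c1 f1 fV1 !mulr1.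
- exact: tangent_conj.
move=> s; have fc1 : kappa (f * c s)%g = 1 by rewrite kappaM f1 c1 mulr1.
exact: agreeM fc1 fV1 (agreeM f1 (c1 s) fa (ca s)) (agreeV f1 fa).
Qed.

(* The Hamiltonian field of [q] in the plane of coordinates [a] and [i]. *)
Definition ham (a i : 'I_n) (q : {mpoly K[n]}) : field :=
  fun j => (j == i)%:R *: q^`M(a) - (j == a)%:R *: q^`M(i).

Lemma hamD a i p q j : ham a i (p + q) j = ham a i p j + ham a i q j.
Proof. by rewrite /ham !mderivD !scalerDr opprD addrACA. Qed.

Lemma hamZ a i c p j : ham a i (c *: p) j = c *: ham a i p j.
Proof. by rewrite /ham !mderivZ scalerBr !scalerA ![c * _]mulrC. Qed.

(** A linear shear preserves area in the plane of the coordinates [a] and [i], so it carries the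
    Hamiltonian field of [q] to that of [q] composed with the inverse shear. *)
Lemma agree_tangent_ham_comp a i q t : a != i -> agree_tangent (ham a i q) ->
  agree_tangent (ham a i (q \mPo shearE a (t *: 'X_i))).
Proof.
move=> ai qa.
have Xa (c : K) : (c *: 'X_i : {mpoly K[n]})^`M(a) = 0.
  by rewrite mderivZ mderivXU eq_sym (negPf ai) scaler0.
have dh (k l : 'I_n) (c : K) : (tnth (shearE a (c *: 'X_i)) k)^`M(l) =
    (k == l)%:R + ((k == a)%:R * c) *: (i == l)%:R.
  by rewrite tnth_mktuple mderivD !mderivZ !mderivXU scalerA.
have dq l : (q \mPo shearE a (t *: 'X_i))^`M(l) = (q^`M(l) \mPo shearE a (t *: 'X_i))
    + ((i == l)%:R * t) *: (q^`M(a) \mPo shearE a (t *: 'X_i)).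
  rewrite mderiv_comp; under eq_bigr do rewrite dh mulrDr.
  rewrite big_split /=; congr (_ + _).
    rewrite (bigD1 l) //= eqxx mulr1 big1 ?addr0 // => k kl.
    by rewrite (negPf kl) mulr0.
  rewrite (bigD1 a) //= eqxx mul1r big1 ?addr0 => [|k ka].
    by rewrite -scalerAr -scaler_nat -scalerAr mulr1 scalerA mulrC.
  by rewrite (negPf ka) mul0r scale0r mulr0.
pose f := shear a (- (t *: 'X_i)).
have XaN : (- (t *: 'X_i) : {mpoly K[n]})^`M(a) = 0 by rewrite mderivN Xa oppr0.
have fmap : polyAut_map f = shearE a (- (t *: 'X_i)).
  exact: (proj1 (mkAutE charK0 (shearEK charK0 XaN) (shearEVK charK0 XaN))).
have fx x r : (r \mPo shearE a (t *: 'X_i)).@[act f x ord0] = r.@[x ord0].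
  rewrite comp_mpoly_meval; apply: meval_eq => k.
  have := shearEVK charK0 (Xa t) x.
  have -> : endact (shearE a (- (t *: 'X_i))) x = act f x.
    by apply/rowP => l; rewrite !mxE fmap.
  by move/rowP/(_ k) => <-; rewrite mxE.
apply: (agree_tangent_conj (f := f) _ _ qa) => [||x j].
- exact: (kappa_shear charK0 XaN).
- exact: agree_shear.
have df l : (tnth (polyAut_map f) j)^`M(l).@[x ord0] =
    (j == l)%:R - (j == a)%:R * t * (i == l)%:R.
  rewrite fmap -scaleNr dh mevalD mevalZ !rmorph_nat /=.
  by rewrite mulrN mulNr.
under eq_bigr do rewrite df mulrBl.
rewrite sumrB (bigD1 j) //= eqxx mul1r big1 ?addr0 => [|k kj]; last first.
  by rewrite eq_sym (negPf kj) mul0r.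
rewrite (bigD1 i) //= eqxx mulr1 big1 ?addr0 => [|k ki]; last first.
  by rewrite [i == k]eq_sym (negPf ki) mulr0 mul0r.
rewrite /ham !mevalB !mevalZ !dq !mevalD !mevalZ !fx eqxx [i == a]eq_sym.
by rewrite (negPf ai) /=; ring.
Qed.

(** Polarization. If [M] involves neither variable, the field of ['X_a ^+ N * M] is that of a shear;
    substituting ['X_a + t *: 'X_i] and extracting the coefficient of [t ^+ m i] gives every
    monomial, up to a nonzero binomial coefficient. *)
Lemma agree_tangent_ham a i q : a != i -> agree_tangent (ham a i q).
Proof.
move=> ai; elim/mpolyind: q => [|c m q _ _ IH].
  apply: agree_tangent_ext agree_tangent0 => j.
  by rewrite /ham !mderiv0 !scaler0 subr0.
suff H : agree_tangent (ham a i 'X_[m]).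
  apply: agree_tangent_ext (agree_tangentD (agree_tangentZ c H) IH) => j.
  by rewrite hamD hamZ.
pose M : {mpoly K[n]} := \prod_(j | (j != a) && (j != i)) 'X_j ^+ m j.
have mE : 'X_[m] = 'X_a ^+ m a * ('X_i ^+ m i * M).
  by rewrite mpolyXE_id (bigD1 a) //= (bigD1 i) //= eq_sym.
have Ma : M^`M(a) = 0 by apply: mderiv_prodX; rewrite eqxx.
have Mi : M^`M(i) = 0 by apply: mderiv_prodX; rewrite eqxx andbF.
pose N := (m a + m i)%N.
pose Y b := ham a i ('C(N, b)%:R *: ('X_a ^+ (N - b) * ('X_i ^+ b * M))).
have pw0 (k l : 'I_n) e : k != l -> (('X_k : {mpoly K[n]}) ^+ e)^`M(l) = 0.
  move=> kl; rewrite mpolyXn mderivX mulmnE mnm1E (negPf kl).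
  by rewrite mul0n scale0r.
have q0i : ('X_a ^+ N * M)^`M(i) = 0.
  by rewrite mderivM Mi mulr0 addr0 pw0 ?mul0r.
have T0 : agree_tangent (ham a i ('X_a ^+ N * M)).
  have d0 : (('X_a ^+ N * M)^`M(a))^`M(i) = 0 by rewrite mderiv_comm q0i mderiv0.
  apply: agree_tangent_ext (agree_tangent_shear d0) => j.
  by rewrite /ham q0i scaler0 subr0.
have HY t : agree_tangent (fun j => \sum_(b < N.+1) t ^+ b *: Y b j).
  apply: agree_tangent_ext (agree_tangent_ham_comp t ai T0) => j.
  have -> : 'X_a ^+ N * M \mPo shearE a (t *: 'X_i) = \sum_(b < N.+1)
      t ^+ b *: ('C(N, b)%:R *: ('X_a ^+ (N - b) * ('X_i ^+ b * M))).
    have -> : 'X_a ^+ N * M \mPo shearE a (t *: 'X_i) =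
        ('X_a + t *: 'X_i) ^+ N * M.
      rewrite rmorphM rmorphXn /= comp_mpolyXt tnth_mktuple eqxx scale1r.
      congr (_ * _); apply: (mpoly_meval_inj charK0) => x.
      rewrite comp_mpoly_meval.
      rewrite -[RHS](mderiv0_meval_shift charK0 x (t * x ord0 i) Ma).
      apply: meval_eq => k; rewrite tnth_mktuple !mxE mevalD !mevalZ !mevalXU.
      by rewrite eqxx /=; ring.
    rewrite exprDn mulr_suml; apply: eq_bigr => b _.
    rewrite exprZn -scaler_nat -scalerAr !scalerA -!scalerAl mulrA [t ^+ b * _]mulrC.
    by [].
  elim: (index_enum _) => [|b r IHr].
    by rewrite !big_nil /ham !mderiv0 !scaler0 subr0.
  by rewrite !big_cons hamD hamZ IHr.
have bN : (m i < N.+1)%N by rewrite ltnS leq_addl.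
have C0 : 'C(N, m i)%:R != 0 :> K by rewrite natf_eq0 // -lt0n bin_gt0 leq_addl.
apply: agree_tangent_ext (agree_tangentZ ('C(N, m i)%:R)^-1
  (agree_tangent_coef HY bN)) => j.
by rewrite /Y hamZ scalerA mulVf // scale1r mE /N addnK.
Qed.

(** Fix a coordinate [a] and let [q i] be a primitive of [X i] in it. The field of [q i] has
    component [X i] along [i]; subtracting these fields leaves a field along [a] whose coefficient
    has [a]-derivative [div X = 0], that is, a shear. *)
Lemma agree_tangent_div0 X : div X = 0 -> agree_tangent X.
Proof.
move=> divX; case: (pickP 'I_n) => [a _|n0]; last first.
  by apply: agree_tangent_ext agree_tangent0 => i; have := n0 i.
have /fin_all_exists[q Hq] : forall i, exists q : {mpoly K[n]}, q^`M(a) = X i.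
  by move=> i; apply: mderiv_antideriv.
pose Y := X a + \sum_(i | i != a) (q i)^`M(i).
have Ya : Y^`M(a) = 0.
  transitivity (div X) => //; rewrite /div (bigD1 a) //= /Y mderivD.
  congr (_ + _); rewrite mderiv_sum.
  by apply: eq_bigr => i _; rewrite mderiv_comm Hq.
apply: agree_tangent_ext (agree_tangentD (agree_tangent_shear Ya)
  (agree_tangent_sum (index_enum _) (P := fun i => i != a)
     (X := fun i => ham a i (q i)) _)) => [j|i ia]; last first.
  by apply: agree_tangent_ham; rewrite eq_sym.
have [->|ja] := eqVneq j a.
  rewrite scale1r /Y -addrA -big_split big1 ?addr0 // => i ia /=.
  by rewrite /ham eqxx eq_sym (negPf ia) scale0r sub0r scale1r subrr.
rewrite scale0r add0r (bigD1 j) //= big1 => [|i /andP[ia ij]].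
  by rewrite /ham eqxx (negPf ja) scale0r subr0 scale1r addr0 Hq.
by rewrite /ham eq_sym (negPf ij) (negPf ja) !scale0r subr0.
Qed.

(* The curve [contract c f] joins [f] to its linear part; along it
   [psi^-1 * phi] has zero derivative. *)
Lemma agree_fix0 f : kappa f = 1 -> act f 0 = 0 -> agree f.
Proof.
move=> f1 f0; pose C c := contract c f.
have Cf : regfam line C by apply: regfam_contract.
have C1 c : kappa (C c) = 1 by rewrite kappa_contract.
pose e c := ((psi (toSAut (C c)))^-1 * phi (toSAut (C c)))%g.
have ef : regfam line e.
  have CS := regfam_toSAut Cf C1.
  by apply: regfam_mul; [apply: regfam_inv|]; apply: regfam_morph CS.
suff e01 : e 1 = e 0.
  have e0 : e 0 = 1%g.
    have L1 : \det (lin0 f) = 1 by rewrite det_lin0.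
    by have := agree_lin L1; rewrite /agree /e /C contract0 => ->; rewrite mulVg.
  have e1 := etrans e01 e0; rewrite /e /C (contract1 charK0 f) in e1.
  by apply: (@mulgI _ (psi (toSAut f))^-1%g); rewrite e1 mulVg.
apply: (act_eq charK0) => x; apply/rowP => i.
pose u s := act (e s) x ord0 i.
apply: (isder0_shift_const charK0 (u := u)) => a.
(* [C] brought back to 1 at time [a]. Its velocity has divergence 0, hence is also that of a curve
   [d] on which the homomorphisms agree; comparing jets, [phi] and [psi] give [c] the same
   velocity. *)
pose c s := (C (a + s) * (C a)^-1)%g.
have cf : regfam line c.
  by apply: regfam_mul (regfam_const _ _); apply: regfam_shift.
have CV1 : kappa (C a)^-1%g = 1 by rewrite kappaV C1 invr1.
have c1 s : kappa (c s) = 1 by rewrite kappaM C1 CV1 mulr1.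
have c0 : c 0 = 1%g by rewrite /c addr0 mulgV.
have [X cX] := tangent_exists cf.
have [d [df d0 d1 dX da]] := agree_tangent_div0 (tangent_div charK0 cf c0 c1 cX).
have cdj : same_jet (fun s => toSAut (c s)) (fun s => toSAut (d s)).
  apply: (@same_jet_SAut _ _ X); rewrite ?c0 ?d0 ?toSAut1 // => y k.
    by apply: isder0_ext (cX y k) => // s; rewrite toSAutK.
  by apply: isder0_ext (dX y k) => // s; rewrite toSAutK.
have cS := regfam_toSAut cf c1; have dS := regfam_toSAut df d1.
have jet theta y k : ind_morphism theta -> exists2 b : K,
    isder0 (fun s => act (theta (toSAut (c s))) y ord0 k) b &
    isder0 (fun s => act (theta (toSAut (d s))) y ord0 k) b.
  move=> tm; apply: (same_jet_morph (u := fun g : Aut => act g y ord0 k) tm cS dS cdj).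
  by move=> l; apply: reg_act.
have [Z cZ] := tangent_exists (regfam_morph psi_mor cS).
have cZ' : tangent (fun s => phi (toSAut (c s))) Z.
  move=> y k; have [b cb db] := jet phi y k phi_mor.
  have [b' cb' db'] := jet psi y k psi_mor.
  have -> : (Z k).@[y ord0] = b; last exact: cb.
  rewrite (isder0_uniq charK0 (cZ y k) cb'); apply: (isder0_uniq charK0 db').
  by apply: isder0_ext db => // s; rewrite -/(agree (d s)) da.
have pc0 : psi (toSAut (c 0)) = 1%g by rewrite c0 toSAut1 hom1.
have fc0 : phi (toSAut (c 0)) = 1%g by rewrite c0 toSAut1 hom1.
have pcV0 : (psi (toSAut (c 0)))^-1%g = 1%g by rewrite pc0 invg1.
have pcf := regfam_morph psi_mor cS.
have H := tangent_mul charK0 (regfam_inv pcf) pcV0 fc0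
  (tangent_inv charK0 pcf pc0 cZ) cZ'.
pose y := act (phi (toSAut (C a))) x.
have Hy k : isder0
    (fun s => act ((psi (toSAut (c s)))^-1 * phi (toSAut (c s)))%g y ord0 k) 0.
  by apply: isder0_ext (H y k) => //; rewrite addNr meval0.
apply: isder0_ext (isder0_act_const (psi (toSAut (C a)))^-1%g i Hy) => [s|].
  have CE : toSAut (C (a + s)) = (toSAut (c s) * toSAut (C a))%g.
    by rewrite -(toSAutM (c1 s) (C1 a)) /c mulgVK.
  have eE : e (a + s) = ((psi (toSAut (C a)))^-1 *
      ((psi (toSAut (c s)))^-1 * phi (toSAut (c s)) * phi (toSAut (C a))))%g.
    by rewrite /e CE phiM psiM invMg !mulgA.
  rewrite /u eE (actM (psi (toSAut (C a)))^-1%g).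
  by rewrite (actM (_ * _)%g (phi (toSAut (C a)))).
by rewrite big1 // => k _; rewrite mulr0.
Qed.

Theorem rigidity : phi =1 psi.
Proof.
move=> h; rewrite -[h]toSAut_val; set f := val h.
have f1 : kappa f = 1 by apply: kappa_val.
have -> : f = (trans (act f 0) * (trans (- act f 0) * f))%g.
  by rewrite mulgA transN // mulgV mul1g.
have t1 v : kappa (trans v) = 1 by apply: kappa_trans.
apply: agreeM; rewrite ?kappaM ?t1 ?f1 ?mulr1 //.
apply: agree_fix0; first by rewrite kappaM t1 f1 mulr1.
by rewrite actM act_trans // subrr.
Qed.

End Rigidity.

(** * Generation of SL_n by transvections *)

Section Transvections.
Context (K : fieldType).

Definition transvection_stable n (P : 'M[K]_n -> Prop) : Prop :=
  forall i j t A, i != j -> P A -> P ((1%:M + t *: delta_mx i j) *m A).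

(** The elementary terms of [B] have rows in [S] and columns outside [S], so their products vanish
    and [1 + B] is a product of transvections. *)
Lemma transvection_stable_block n (P : 'M[K]_n -> Prop) (S : pred 'I_n)
    (B A : 'M[K]_n) :
    transvection_stable P -> (forall i j, ~~ (S i && ~~ S j) -> B i j = 0) ->
  P A -> P ((1%:M + B) *m A).
Proof.
move=> Pt BS PA.
pose F (r : seq ('I_n * 'I_n)) : 'M_n :=
  \sum_(k <- r | S k.1 && ~~ S k.2) B k.1 k.2 *: delta_mx k.1 k.2.
have -> : B = F (index_enum _).
  rewrite /F [LHS]matrix_sum_delta pair_big /= [RHS]big_mkcond /=.
  apply: eq_bigr => -[i j] _ /=; case: ifPn => // /BS ->.
  by rewrite scale0r.
elim: (index_enum _) => [|[i j] r IH]; first by rewrite /F big_nil addr0 mul1mx.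
rewrite /F big_cons -/(F r) /=; case: ifPn => // /andP[Si Sj].
have ij : i != j by apply: contraNneq Sj => <-.
have -> : 1%:M + (B i j *: delta_mx i j + F r) =
    (1%:M + B i j *: delta_mx i j) *m (1%:M + F r).
  rewrite mulmxDl mul1mx mulmxDr mulmx1.
  suff -> : B i j *: delta_mx i j *m F r = 0.
    by rewrite addr0 -addrA; congr (_ + _); rewrite addrC.
  rewrite /F mulmx_sumr big1 // => -[k l] /andP[/= Sk Sl].
  rewrite -scalemxAl -scalemxAr mul_delta_mx_0 ?scaler0 //.
  by apply: contraNneq Sj => ->.
by rewrite -mulmxA; apply: Pt.
Qed.

Lemma transvection_inv n (P : 'M[K]_n -> Prop) (i j : 'I_n) t A :
  transvection_stable P -> i != j ->
  P ((1%:M + t *: delta_mx i j) *m A) -> P A.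
Proof.
move=> Pt ij /(Pt i j (- t) _ ij).
suff -> : (1%:M + - t *: delta_mx i j) *m ((1%:M + t *: delta_mx i j) *m A) = A.
  by [].
rewrite mulmxA mulmxDl mul1mx mulmxDr mulmx1 -scalemxAl -scalemxAr.
rewrite mul_delta_mx_0 1?eq_sym // !scaler0 addr0 scaleNr addrK mul1mx //.
Qed.


Lemma transvectionE n (i j : 'I_n) t (A : 'M[K]_n) k l :
  ((1%:M + t *: delta_mx i j) *m A) k l = A k l + (k == i)%:R * t * A j l.
Proof.
rewrite mulmxDl mul1mx mxE -scalemxAl !mxE; congr (_ + _).
rewrite (bigD1 j) //= mxE eqxx andbT big1 ?addr0 => [|m mj].
  by rewrite mulrA [t * _]mulrC.
by rewrite mxE (negPf mj) andbF mul0r.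
Qed.

Lemma det_transvection n (i j : 'I_n) t :
  i != j -> \det (1%:M + t *: delta_mx i j : 'M[K]_n) = 1.
Proof.
move=> ij; pose T (k l : 'I_n) : 'M[K]_n := 1%:M + t *: delta_mx k l.
have TE (k l p q : 'I_n) : T k l p q = (p == q)%:R + t * ((p == k) && (q == l))%:R.
  by rewrite !mxE.
have trig (k l : 'I_n) : (l < k)%N -> \det (T k l) = 1.
  move=> lk; rewrite det_trig.
    rewrite big1 // => p _; rewrite TE eqxx; case: eqP => [->|_] /=; last first.
      by rewrite mulr0 addr0.
    by rewrite -val_eqE /= gtn_eqF // mulr0 addr0.
  apply/is_trig_mxP => p q pq; rewrite TE -val_eqE /= ltn_eqF // add0r.
  case: eqP => [pk|_] /=; last by rewrite mulr0.
  case: eqP => [ql|_]; last by rewrite mulr0.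
  by move: pq lk; rewrite pk ql => /ltn_trans H /H; rewrite ltnn.
rewrite -/(T i j); case: (ltngtP i j) => [lt_ij|/trig //|/val_inj e]; last first.
  by rewrite e eqxx in ij.
rewrite -det_tr; suff -> : (T i j)^T = T j i by apply: trig.
by rewrite /T linearD /= linearZ /= trmx1 trmx_delta.
Qed.

(** Row reduction without scaling. A nonzero entry below the corner makes the corner 1, which then
    clears its column, and the remaining block is left to induction. If the column is zero below the
    corner, the first row is added to another one beforehand. *)
Lemma SL_transvection_ind n (P : 'M[K]_n -> Prop) :
  P 1%:M -> transvection_stable P -> forall A, \det A = 1 -> P A.
Proof.
elim: n P => [|n IH] P P1 Pt A A1.
  by rewrite (_ : A = 1%:M) //; apply/matrixP => -[].
have corner1 (B : 'M_(n.+1)) : \det B = 1 -> B 0 0 = 1 -> P B.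
  move=> B1 B00.
  pose C : 'M[K]_(n.+1) := \matrix_(i, j) (if (i != 0) && (j == 0) then - B i 0 else 0).
  have C0 i j : ~~ ((i != 0) && ~~ (j != 0)) -> C i j = 0.
    by rewrite negbK mxE => /negPf ->.
  have CN0 i j : ~~ ((i != 0) && ~~ (j != 0)) -> (- C) i j = 0.
    by rewrite mxE => /C0 ->; rewrite oppr0.
  have CC : C *m C = 0.
    apply/matrixP => i j; rewrite !mxE big1 // => k _; rewrite !mxE.
    by case: (eqVneq k 0) => [->|k0]; rewrite ?andbF ?mulr0 ?mul0r.
  have BE : B = (1%:M - C) *m ((1%:M + C) *m B).
    rewrite mulmxA mulmxBl mul1mx mulmxDr mulmx1 CC addr0.
    by rewrite -addrA subrr addr0 mul1mx.
  rewrite BE; apply: (transvection_stable_block Pt CN0).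
  pose D : 'M_(1 + n) := (1%:M + C) *m B.
  have D0 i : D i 0 = (i == 0)%:R.
    rewrite /D mulmxDl mul1mx 2!mxE (bigD1 0) //= mxE eqxx andbT B00 mulr1.
    rewrite big1 => [|k k0]; last by rewrite mxE (negPf k0) andbF mul0r.
    by have [->|_] := eqVneq i 0; rewrite ?B00 addr0 ?addr0 ?subrr.
  have D1 : \det D = 1.
    apply: (transvection_stable_block (P := fun M => \det M = 1) _ C0 B1).
    by move=> i j t M ij M1; rewrite det_mulmx det_transvection // mul1r.
  rewrite -/D; clearbody D.
  have DE : D = block_mx 1%:M (ursubmx D) 0 (drsubmx D).
    rewrite -[LHS]submxK; congr (block_mx _ _ _ _); apply/matrixP => i j.
      by rewrite !ord1 !mxE lshift0 D0.
    by rewrite !mxE ord1 lshift0 D0.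
  have block1 (c : 'M_n) : \det c = 1 ->
      forall b : 'rV[K]_n, P (block_mx 1%:M b 0 c : 'M_(1 + n)).
    apply: (IH (fun d => forall b : 'rV[K]_n, P (block_mx 1%:M b 0 d : 'M_(1 + n)))) =>
      [b|i j t d ij Hd b].
      pose U : 'M[K]_(1 + n) := block_mx 0 b 0 0.
      have U0 (i j : 'I_(1 + n)) : ~~ ((i == 0) && ~~ (j == 0)) -> U i j = 0.
        case: (split_ordP i) => k ->; case: (split_ordP j) => l ->;
          rewrite /U ?block_mxEul ?block_mxEur ?block_mxEdl ?block_mxEdr ?mxE //.
        by rewrite ord1 lshift0 eqxx -val_eqE.
      have -> : block_mx 1%:M b 0 1%:M = (1%:M + U) *m 1%:M.
        by rewrite mulmx1 (scalar_mx_block 1 n 1) add_block_mx !addr0 !add0r.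
      exact: (transvection_stable_block Pt U0 P1).
    have -> : block_mx 1%:M b 0 ((1%:M + t *: delta_mx i j) *m d) =
        (1%:M + t *: delta_mx (rshift 1 i) (rshift 1 j)) *m block_mx 1%:M b 0 d.
      apply/matrixP => k l; rewrite transvectionE.
      case: (split_ordP k) => k' ->; case: (split_ordP l) => l' ->;
        rewrite ?eq_lrshift ?(inj_eq (@rshift_inj _ _)) ?block_mxEul ?block_mxEur
          ?block_mxEdl ?block_mxEdr ?mul0r ?addr0 //.
        by rewrite !mxE mulr0 addr0.
      by rewrite transvectionE.
    by apply: Pt (Hd b); apply: contraNneq ij => e; apply/eqP/(@rshift_inj 1 n).
  rewrite DE; apply: block1.
  by move: D1; rewrite {1}DE det_ublock det1 mul1r.
have [A00|A00] := eqVneq (A 0 0) 1; first exact: corner1.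
have fix_corner (B : 'M_(n.+1)) i : \det B = 1 -> i != 0 -> B i 0 != 0 -> P B.
  move=> B1 i0 Bi; apply: (@transvection_inv _ _ 0 i ((1 - B 0 0) / B i 0)) => //.
    by rewrite eq_sym.
  apply: corner1; first by rewrite det_mulmx det_transvection ?mul1r // eq_sym.
  by rewrite transvectionE eqxx mul1r divfK // addrC subrK.
have [/existsP[i /andP[i0 Ai]]|] := boolP [exists i, (i != 0) && (A i 0 != 0)].
  exact: fix_corner A1 i0 Ai.
rewrite negb_exists => /forallP A0.
have {}A0 i : i != 0 -> A i 0 = 0.
  by move=> i0; apply/eqP; have := A0 i; rewrite i0 negbK.
have A00n : A 0 0 != 0.
  apply/eqP => A000; have := A1; rewrite (expand_det_col _ 0) big1.
    by move/eqP; rewrite eq_sym oner_eq0.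
  by move=> i _; have [->|/A0 ->] := eqVneq i 0; rewrite ?A000 mul0r.
have [i i0] : exists i : 'I_n.+1, i != 0.
  case: n {IH} P P1 Pt A A1 corner1 A00 fix_corner A0 A00n => [|n] P P1 Pt A A1.
    by move: A1; rewrite [A]mx11_scalar det_scalar expr1 mxE eqxx => -> _ /eqP.
  by exists 1.
apply: (@transvection_inv _ _ i 0 1) => //.
apply: (fix_corner _ i) => //; first by rewrite det_mulmx det_transvection ?mul1r.
by rewrite transvectionE eqxx mul1r (A0 i i0) add0r mul1r.
Qed.

End Transvections.

(** * Relations between shears and affine maps *)

Section Relations.
Context (K : fieldType) (charK0 : [pchar K] =i pred0) (n : nat).
Local Notation Aut := (polyAut K n).
Local Notation SAut := (polySAut K n).
Local Notation point := 'rV[K]_n.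
Implicit Types (f g : Aut) (x y v : point).

Lemma mderiv0_msupp (i : 'I_n) (p : {mpoly K[n]}) m :
  p^`M(i) = 0 -> m \in msupp p -> m i = 0%N.
Proof.
rewrite mcoeff_msupp => pi0 pm; apply/eqP; apply: contraNT pm => mi.
have := mcoeff_mderiv i p (m - U_(i)); rewrite pi0 mcoeff0 submK; last first.
  by apply/mnm_lepP => j; rewrite mnm1E; case: eqP => // <-; rewrite lt0n.
move/esym/eqP; rewrite -[_ *+ _]mulr_natr mulf_eq0 (natf_eq0 charK0) orbF.
by move/eqP => ->.
Qed.

Lemma mderiv0_ind (i : 'I_n) (Q : {mpoly K[n]} -> Prop) :
    Q 0 -> (forall c (m : 'X_{1..n}), m i = 0%N -> Q (c *: 'X_[m])) ->
    (forall p q, p^`M(i) = 0 -> q^`M(i) = 0 -> Q p -> Q q -> Q (p + q)) ->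
  forall p, p^`M(i) = 0 -> Q p.
Proof.
move=> Q0 QX QD p pi0; rewrite (mpolyE p).
have Xi0 (m : 'X_{1..n}) : m i = 0%N -> ('X_[m] : {mpoly K[n]})^`M(i) = 0.
  by move=> mi; rewrite mderivX mi scale0r.
suff [] : (\sum_(m <- msupp p) p@_m *: 'X_[m])^`M(i) = 0 /\
  Q (\sum_(m <- msupp p) p@_m *: 'X_[m]) by [].
rewrite big_seq; elim/big_rec: _ => [|m q /(mderiv0_msupp pi0) mi [qi Qq]].
  by rewrite mderiv0.
have ri : (p@_m *: 'X_[m])^`M(i) = 0 by rewrite mderivZ Xi0 // scaler0.
by split; [rewrite mderivD ri qi addr0 | apply: QD => //; apply: QX].
Qed.

Definition transl v (p : {mpoly K[n]}) : {mpoly K[n]} := p \mPo affE 1%:M v.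

Lemma meval_transl v p x : (transl v p).@[x ord0] = p.@[(x + v) ord0].
Proof.
rewrite comp_mpoly_meval; apply: meval_eq => i.
by have /rowP/(_ i) := endact_aff 1%:M v x; rewrite mulmx1 mxE.
Qed.

Lemma mderiv_transl i v p : p^`M(i) = 0 -> (transl v p)^`M(i) = 0.
Proof.
move=> pi0; rewrite mderiv_comp big1 // => k _.
have [->|ki] := eqVneq k i; first by rewrite pi0 comp_mpoly0 mul0r.
rewrite tnth_mktuple mderivD mderivC addr0 mderiv_sum big1 ?mulr0 // => j _.
rewrite mderivZ mderivXU mxE; case: eqP => [->|_]; last by rewrite scale0r.
by rewrite (negPf ki) scaler0.
Qed.

Lemma trans_shear i p v : p^`M(i) = 0 ->
  (trans v * shear i p = shear i (transl (- v) p) * trans v)%g.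
Proof.
move=> pi0; apply: (mulg_act charK0) => x; rewrite !(act_trans charK0).
rewrite !(act_shear charK0) ?mderiv_transl // meval_transl addrK.
by rewrite addrAC.
Qed.

Lemma affM (A B : 'M[K]_n) : A \in unitmx -> B \in unitmx ->
  aff (A *m B) 0 = (aff B 0 * aff A 0)%g.
Proof.
move=> AU BU; apply: (act_eq charK0) => x.
by rewrite actM !(act_aff charK0) ?unitmx_mul ?AU // !addr0 mulmxA.
Qed.

Lemma det1_unitmx (A : 'M[K]_n) : \det A = 1 -> A \in unitmx.
Proof. by move=> A1; rewrite unitmxE A1 unitr1. Qed.

Lemma aff_transvection (i j : 'I_n) (t : K) : i != j ->
  aff (1%:M + t *: delta_mx i j) 0 = shear j (t *: 'X_i).
Proof.
move=> ij; apply: (act_eq charK0) => x.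
rewrite (act_aff charK0); last exact/det1_unitmx/det_transvection.
rewrite (act_shear charK0); last by rewrite mderivZ mderivXU (negPf ij) scaler0.
rewrite addr0 mulmxDr mulmx1 mevalZ mevalXU -scalemxAr; congr (_ + _).
rewrite -scalerA; congr (_ *: _); apply/rowP => k.
rewrite !mxE (bigD1 i) //= big1 ?addr0 => [|l li]; last first.
  by rewrite !mxE (negPf li) mulr0.
by rewrite !mxE !eqxx.
Qed.

(** Halving coordinate [i] and doubling coordinate [j] has determinant 1, and conjugation by it
    multiplies a monomial shear along [i] by [2^-(m_j + 1)], a scalar other than 1. *)
Definition dilation (i j : 'I_n) : 'M[K]_n :=
  diag_mx (\row_k (if k == j then 2%:R else if k == i then 2%:R^-1 else 1)).

Lemma two_neq0 : 2%:R != 0 :> K.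
Proof. by rewrite (natf_eq0 charK0). Qed.

Lemma det_dilation i j : i != j -> \det (dilation i j) = 1.
Proof.
move=> ij; rewrite det_diag (bigD1 j) //= (bigD1 i) //= !mxE eqxx (negPf ij) eqxx.
rewrite big1 ?mulr1 ?mulfV ?two_neq0 // => k /andP[kj ki].
by rewrite mxE (negPf kj) (negPf ki).
Qed.

Lemma dilation_shear i j (c : K) (m : 'X_{1..n}) : i != j -> m i = 0%N ->
  (aff (dilation i j) 0 * shear i (c *: 'X_[m]) =
   shear i ((2%:R ^- (m j).+1 * c) *: 'X_[m]) * aff (dilation i j) 0)%g.
Proof.
move=> ij mi; have dU := det1_unitmx (det_dilation ij).
have Xi c' : (c' *: 'X_[m] : {mpoly K[n]})^`M(i) = 0.
  by rewrite mderivZ mderivX mi scale0r scaler0.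
apply: (mulg_act charK0) => x; rewrite !(act_aff charK0) // !addr0.
rewrite !(act_shear charK0) // mulmxDl; congr (_ + _).
rewrite -scalemxAl !mevalZ !mevalX.
have -> : (delta_mx 0 i : point) *m dilation i j = 2%:R^-1 *: delta_mx 0 i.
  rewrite -rowE; apply/rowP => k; rewrite !mxE !eqxx (negPf ij) /= [k == i]eq_sym.
  by case: eqP => _; rewrite ?mulr1n ?mulr0n ?mulr1 ?mulr0.
rewrite scalerA; congr (_ *: _).
have -> : \prod_k (x *m dilation i j) ord0 k ^+ m k =
    2%:R ^+ m j * \prod_k x ord0 k ^+ m k.
  rewrite (bigD1 j) //= [in RHS](bigD1 j) //= mulrA -exprMn; congr (_ * _).
    by rewrite mul_mx_diag !mxE eqxx mulrC.
  apply: eq_bigr => k kj; rewrite mul_mx_diag !mxE (negPf kj).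
  by case: eqP => [->|_]; rewrite ?mi ?mulr1.
rewrite exprS invfM; field.
by rewrite expf_neq0 // two_neq0.
Qed.

(** From [(x + 1)^2 = x^2 + 2 x + 1]: a linear shear is, up to a translation, a commutator of a
    translation with a quadratic shear. *)
Lemma shear_square (i j : 'I_n) (t : K) : i != j ->
  (trans (- delta_mx 0 j) * shear i (t *: ('X_j * 'X_j)) =
   shear i (t *: ('X_j * 'X_j)) * shear i ((2%:R * t) *: 'X_j)
     * shear i t%:MP * trans (- delta_mx 0 j))%g.
Proof.
move=> ij; have Xj : ('X_j : {mpoly K[n]})^`M(i) = 0.
  by rewrite mderivXU eq_sym (negPf ij).
have XX : (t *: ('X_j * 'X_j) : {mpoly K[n]})^`M(i) = 0.
  by rewrite mderivZ mderivM Xj mul0r mulr0 addr0 scaler0.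
have X2 : ((2%:R * t) *: 'X_j : {mpoly K[n]})^`M(i) = 0.
  by rewrite mderivZ Xj scaler0.
rewrite trans_shear // opprK -(shearD charK0) // -(shearD charK0)
  ?mderivD ?XX ?X2 ?addr0 ?mderivC //.
congr (shear i _ * _)%g; apply: (mpoly_meval_inj charK0) => x.
rewrite meval_transl !mevalD !mevalZ !mevalM !mevalXU mevalC !mxE !eqxx /=.
by ring.
Qed.

Context (phi : SAut -> Aut).
Hypothesis phiM : {morph phi : h k / (h * k)%g}.
Hypothesis phi_mor : ind_morphism phi.

Lemma phi_toSAutM f g : kappa f = 1 -> kappa g = 1 ->
  phi (toSAut (f * g)%g) = (phi (toSAut f) * phi (toSAut g))%g.
Proof. by move=> f1 g1; rewrite (toSAutM f1 g1) phiM. Qed.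

(** Rigidity against the trivial homomorphism. Linear shears die as commutators with translations,
    hence so does [SL_n]; then a monomial shear and a scalar multiple of it, conjugate under [SL_n],
    have the same image. *)
Lemma hom_trans_trivial :
  (forall v, phi (toSAut (trans v)) = 1%g) -> forall h, phi h = 1%g.
Proof.
move=> Tv; have kt v : kappa (trans v) = 1 := kappa_trans charK0 v.
have psiM : {morph (fun=> 1%g : Aut) : h k / (h * k)%g : SAut >-> (h * k)%g : Aut}.
  by move=> h k; rewrite mulg1.
have psi_mor := @ind_morphism_const K SAut Aut 1%g.
have shear_lin i j (t : K) : i != j -> phi (toSAut (shear i (t *: 'X_j))) = 1%g.
  move=> ij; have Xj c : (c *: 'X_j : {mpoly K[n]})^`M(i) = 0.
    by rewrite mderivZ mderivXU eq_sym (negPf ij) scaler0.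
  have XX c : (c *: ('X_j * 'X_j) : {mpoly K[n]})^`M(i) = 0.
    by rewrite mderivZ mderivM mderivXU eq_sym (negPf ij) mul0r mulr0 addr0 scaler0.
  pose c := t / 2%:R; have := shear_square c ij.
  have -> : 2%:R * c = t by rewrite /c mulrC divfK ?two_neq0.
  have k1 := kappa_shear charK0 (XX c); have k2 := kappa_shear charK0 (Xj t).
  rewrite (shearC charK0) => /(congr1 (fun f => phi (toSAut f))).
  rewrite (phi_toSAutM (kt _) k1) !phi_toSAutM ?kappaM ?kt ?k1 ?k2 ?mulr1 //.
  by rewrite !Tv mul1g !mulg1 -[LHS]mulg1 => /mulgI ->.
have lin L : \det L = 1 -> phi (toSAut (aff L 0)) = 1%g.
  move=> L1; suff [] : \det L = 1 /\ phi (toSAut (aff L 0)) = 1%g by [].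
  apply: (SL_transvection_ind
    (P := fun A => \det A = 1 /\ phi (toSAut (aff A 0)) = 1%g) _ _ L1).
    by rewrite det1 Tv.
  move=> i j t A ij [A1 IH]; have tr1 := det_transvection t ij.
  split; first by rewrite det_mulmx tr1 mul1r.
  have k1 : kappa (aff A 0) = 1 by rewrite (kappa_aff charK0) ?det1_unitmx.
  have k2 : kappa (aff (1%:M + t *: delta_mx i j) 0) = 1.
    by rewrite (kappa_aff charK0) ?det1_unitmx.
  rewrite affM ?det1_unitmx // (phi_toSAutM k1 k2) IH mul1g.
  by rewrite aff_transvection // shear_lin // eq_sym.
apply: (rigidity charK0 phiM psiM phi_mor psi_mor) => [L L1|v|i].
- exact: lin.
- exact: Tv.
rewrite /agree; apply: mderiv0_ind => [|c m mi|p q pi0 qi0 Hp Hq].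
- by rewrite -mpolyC0 (shearC charK0) Tv.
- have [->|m0] := eqVneq m 0%MM.
    by rewrite mpolyX0 -mul_mpolyC mulr1 (shearC charK0) Tv.
  have [j mj] := mnm_neq0_exists m0.
  have ij : i != j by apply: contraNneq mj => <-; rewrite mi.
  have Xi c' : (c' *: 'X_[m] : {mpoly K[n]})^`M(i) = 0.
    by rewrite mderivZ mderivX mi scale0r scaler0.
  pose k := 2%:R ^- (m j).+1 : K.
  have k1 : 1 - k != 0.
    rewrite subr_eq0 eq_sym invr_eq1 -natrX -[1]/(1%:R) (inj_eq (natf_inj charK0)).
    by rewrite gtn_eqF // -[1%N](expn0 2) ltn_exp2l.
  (* Chosen so that [c' - k * c' = c]: the relation identifies the images of the shears for [c'] and
     [k * c']. *)
  pose c' := c / (1 - k); have := dilation_shear c' ij mi.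
  have d1 := det_dilation ij; have kd : kappa (aff (dilation i j) 0) = 1.
    by rewrite (kappa_aff charK0) ?det1_unitmx.
  have ks c'' := kappa_shear charK0 (Xi c'').
  move/(congr1 (fun f => phi (toSAut f))).
  rewrite (phi_toSAutM kd (ks _)) (phi_toSAutM (ks _) kd) (lin _ d1) mul1g mulg1.
  have -> : c' *: 'X_[m] = (k * c') *: 'X_[m] + c *: 'X_[m] :> {mpoly K[n]}.
    by rewrite -scalerDl; congr (_ *: _); rewrite /c'; field.
  rewrite (shearD charK0 (Xi _) (Xi _)) (phi_toSAutM (ks _) (ks _)).
  by rewrite -/k -[in RHS](mulg1 (phi _)) => /mulgI.
rewrite (shearD charK0 pi0 qi0) phi_toSAutM ?(kappa_shear charK0) //.
by rewrite Hp Hq mulg1.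
Qed.

End Relations.

(** * The image of the translations has no isotropy *)

Section Rank.
Context (K : fieldType) (charK0 : [pchar K] =i pred0) (n : nat).
Local Notation Aut := (polyAut K n).
Local Notation SAut := (polySAut K n).
Local Notation point := 'rV[K]_n.
Implicit Types (f g : Aut) (x y v : point).

Definition upoly (a : 'I_n) (q : {poly K}) : {mpoly K[n]} :=
  (map_poly (@mpolyC n K) q).['X_a].

Lemma upolyD a p q : upoly a (p + q) = upoly a p + upoly a q.
Proof. by rewrite /upoly rmorphD hornerD. Qed.

Lemma upolyZ a c q : upoly a (c *: q) = c *: upoly a q.
Proof. by rewrite /upoly map_polyZ hornerZ mul_mpolyC. Qed.

Lemma upolyC a c : upoly a c%:P = c%:MP.
Proof. by rewrite /upoly map_polyC hornerC. Qed.

Lemma meval_upoly a q x : (upoly a q).@[x ord0] = q.[x ord0 a].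
Proof.
elim/poly_ind: q => [|q c IH]; first by rewrite /upoly rmorph0 !horner0 meval0.
rewrite /upoly rmorphD rmorphM /= map_polyX map_polyC !hornerMXaddC.
by rewrite mevalD mevalM mevalXU mevalC -/(upoly a q) IH.
Qed.

Lemma mderiv_upoly a i q : i != a -> (upoly a q)^`M(i) = 0.
Proof.
move=> ia; elim/poly_ind: q => [|q c IH].
  by rewrite /upoly rmorph0 horner0 mderiv0.
rewrite /upoly rmorphD rmorphM /= map_polyX map_polyC hornerMXaddC.
rewrite mderivD mderivC mderivM -/(upoly a q) IH mderivXU eq_sym (negPf ia).
by rewrite mul0r mulr0 !addr0.
Qed.

Lemma transl_upoly a q v :
  transl (- v) (upoly a q) = upoly a (q \Po ('X - (v ord0 a)%:P)).
Proof.
apply: (mpoly_meval_inj charK0) => x; rewrite meval_transl !meval_upoly !mxE.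
by rewrite horner_comp !hornerE.
Qed.

Lemma poly_periodic_const (q : {poly K}) c :
  c != 0 -> q \Po ('X - c%:P) = q -> (size q <= 1)%N.
Proof.
move=> c0 qc; pose r := q \Po (- c *: 'X) - (q.[0])%:P.
have rE : r = 0.
  apply: (poly_natf_root_eq0 charK0) => m; rewrite /r !hornerE horner_comp !hornerE.
  elim: m => [|m IH]; first by rewrite mulr0 subrr.
  rewrite -[RHS]IH; congr (_ - _).
  by rewrite -[in RHS]qc horner_comp !hornerE -natr1; congr (q.[_]); ring.
have qE : q \Po (- c *: 'X) = (q.[0])%:P by apply/eqP; rewrite -subr_eq0 -/r rE.
have := size_comp_poly q (- c *: 'X); rewrite qE size_scale ?oppr_eq0 // size_polyX muln1.
by rewrite size_polyC; case: (_ == 0) => /=; case: (size q) => [|[]].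
Qed.

Lemma size_comp_shift_sub (q : {poly K}) c : (0 < size q)%N ->
  (size (q \Po ('X - c%:P) - q)%R < size q)%N.
Proof.
move=> q0; rewrite -[in X in (_ < X)%N](prednK q0) ltnS.
have szc : size (q \Po ('X - c%:P)) = size q by rewrite size_comp_poly2 // size_XsubC.
apply/leq_sizeP => j; rewrite leq_eqVlt => /orP[/eqP <-|jq]; rewrite coefB.
  have [q1|q1] := leqP (size q) 1.
    by rewrite (size1_polyC q1) comp_polyC subrr.
  have := lead_coef_comp q (q := 'X - c%:P).
  rewrite size_XsubC => /(_ isT); rewrite lead_coefXsubC expr1n mulr1.
  by rewrite !lead_coefE szc => ->; rewrite subrr.
have jq' : (size q <= j)%N by rewrite -(prednK q0).
by rewrite !nth_default ?subrr // szc.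
Qed.

Context (phi : SAut -> Aut).
Hypothesis phiM : {morph phi : h k / (h * k)%g}.
Hypothesis phi_mor : ind_morphism phi.

Definition phiT v : Aut := phi (toSAut (trans v)).
Definition phiS i p : Aut := phi (toSAut (shear i p)).

Lemma phiTD u v : phiT (u + v) = (phiT u * phiT v)%g.
Proof.
rewrite /phiT (transD charK0).
by rewrite (phi_toSAutM phiM (kappa_trans charK0 _) (kappa_trans charK0 _)).
Qed.

Lemma phiT0 : phiT 0 = 1%g.
Proof. by rewrite /phiT (trans0 charK0) toSAut1 (hom1 phiM). Qed.

Lemma phiSD i p q : p^`M(i) = 0 -> q^`M(i) = 0 ->
  phiS i (p + q) = (phiS i p * phiS i q)%g.
Proof.
move=> pi0 qi0; rewrite /phiS (shearD charK0 pi0 qi0).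
by rewrite (phi_toSAutM phiM (kappa_shear charK0 pi0) (kappa_shear charK0 qi0)).
Qed.

Lemma phiSC i c : phiS i c%:MP = phiT (c *: delta_mx 0 i).
Proof. by rewrite /phiS (shearC charK0). Qed.

Lemma phiT_S i p v : p^`M(i) = 0 ->
  (phiT v * phiS i p = phiS i (transl (- v) p) * phiT v)%g.
Proof.
move=> pi0; have k1 := kappa_trans charK0 v; have k2 := kappa_shear charK0 pi0.
have k3 := kappa_shear charK0 (mderiv_transl (- v) pi0).
rewrite /phiT /phiS -(phi_toSAutM phiM k1 k2) (trans_shear charK0 v pi0).
by rewrite (phi_toSAutM phiM k3 k1).
Qed.

Lemma regfam_phiT T N (c : T -> 'rV[K]_N) (v : T -> point) :
  (forall j, regular_on c predT (fun t => v t ord0 j)) -> regfam c (fun t => phiT (v t)).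
Proof.
move=> vr; apply: regfam_morph phi_mor _.
apply: regfam_toSAut (regfam_trans charK0 vr) _ => t; exact: kappa_trans.
Qed.

Lemma regfam_phiTZ v : regfam line (fun s => phiT (s *: v)).
Proof.
apply: regfam_phiT => j.
by apply: reg_ext (reg_mul (line_id K) (reg_const _ _ (v ord0 j))) => s _; rewrite mxE.
Qed.

Lemma regfam_phiS i p : p^`M(i) = 0 -> regfam line (fun s => phiS i (s *: p)).
Proof.
move=> pi0; apply: regfam_morph phi_mor _.
apply: regfam_toSAut (regfam_shear charK0 pi0) _ => s.
by apply: kappa_shear; rewrite // mderivZ pi0 scaler0.
Qed.

Lemma phiS0 i p : phiS i (0 *: p) = 1%g.
Proof. by rewrite scale0r -mpolyC0 phiSC scale0r phiT0. Qed.

Definition Dfield v (X : 'I_n -> {mpoly K[n]}) : Prop :=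
  tangent (fun s => phiT (s *: v)) X.

Lemma Dfield_sum (D : 'I_n -> 'I_n -> {mpoly K[n]}) v :
    (forall i, Dfield (delta_mx 0 i) (D i)) ->
  Dfield v (fun k => \sum_i v ord0 i *: D i k).
Proof.
move=> HD; pose w (r : seq 'I_n) : point := \sum_(i <- r) v ord0 i *: delta_mx 0 i.
suff H r : Dfield (w r) (fun k => \sum_(i <- r) v ord0 i *: D i k).
  by have := H (index_enum _); rewrite {1}/w -row_sum_delta.
elim: r => [|i r IH].
  move=> x k; rewrite big_nil; apply: isder0_ext (tangent_const 1%g x k) => // s.
  by rewrite /w big_nil scaler0 phiT0.
have Hi := tangent_scale (v ord0 i) (HD i).
have T0 u : phiT (0 *: u) = 1%g by rewrite scale0r phiT0.
have T0' : phiT ((0 * v ord0 i) *: delta_mx 0 i) = 1%g by rewrite mul0r T0.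
have Hf := regfam_scale (v ord0 i) (regfam_phiTZ (delta_mx 0 i)).
have H := tangent_mul charK0 Hf T0' (T0 (w r)) Hi IH.
move=> x k; rewrite big_cons; apply: isder0_ext (H x k) => // s.
by rewrite -phiTD /w big_cons scalerDr scalerA.
Qed.

Lemma phiT_fix v X (p : point) : Dfield v X -> (forall k, (X k).@[p ord0] = 0) ->
  forall t, act (phiT (t *: v)) p = p.
Proof.
move=> vX Xp t; apply/rowP => k.
pose u s := act (phiT (s *: v)) p ord0 k.
suff H : forall s, u s = u 0 by rewrite -/(u t) H /u scale0r phiT0 act1.
apply: (isder0_shift_const charK0) => a.
have Xp0 l : isder0 (fun s => act (phiT (s *: v)) p ord0 l) 0.
  by rewrite -(Xp l); apply: vX.
apply: isder0_ext (isder0_act_const (phiT (a *: v)) k Xp0) => [s|].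
  by rewrite /u scalerDl phiTD actM.
by rewrite big1 // => l _; rewrite mulr0.
Qed.

(* If [D_v] vanishes at [p], then [phiT v] fixes [p], and conjugation by it
   turns [q] into its translate; as [p] has a finite-dimensional tangent space,
   the polynomials [q] whose field vanishes at [p] include a nonzero one, hence
   by repeated differences a nonzero constant. *)
Lemma Dfield_vanish v X (p : point) a i Y :
    Dfield v X -> (forall k, (X k).@[p ord0] = 0) ->
    v ord0 a != 0 -> i != a -> Dfield (delta_mx 0 i) Y ->
  forall k, (Y k).@[p ord0] = 0.
Proof.
move=> vX Xp va ia iY; have fixp := phiT_fix vX Xp.
pose F q s := phiS i (s *: upoly a q).
have Fi q : (upoly a q)^`M(i) = 0 by apply: mderiv_upoly.
have Fsi s q : (s *: upoly a q)^`M(i) = 0 by rewrite mderivZ Fi scaler0.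
have Ff q : regfam line (F q) by apply: regfam_phiS.
have F0 q : F q 0 = 1%g by apply: phiS0.
have FD q q' W W' : tangent (F q) W -> tangent (F q') W' ->
    tangent (F (q + q')) (fun k => W k + W' k).
  move=> HW HW' x k.
  have H := tangent_mul charK0 (Ff q) (F0 q) (F0 q') HW HW' x k.
  apply: isder0_ext H => // s.
  by rewrite -phiSD // -scalerDr -upolyD.
have FZ c q W : tangent (F q) W -> tangent (F (c *: q)) (fun k => c *: W k).
  move=> HW x k; apply: isder0_ext (tangent_scale c HW x k) => // s.
  by rewrite /F upolyZ scalerA.
pose Z q := exists2 W, tangent (F q) W & forall k, (W k).@[p ord0] = 0.
have ZD q q' : Z q -> Z q' -> Z (q + q').
  move=> [W HW W0] [W' HW' W0']; exists (fun k => W k + W' k); first exact: FD.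
  by move=> k; rewrite mevalD W0 W0' addr0.
have ZZ c q : Z q -> Z (c *: q).
  move=> [W HW W0]; exists (fun k => c *: W k); first exact: FZ.
  by move=> k; rewrite mevalZ W0 mulr0.
have Zshift q : Z q -> Z (q \Po ('X - (v ord0 a)%:P)).
  move=> [W HW W0]; have [W' HW'] := tangent_exists (Ff (q \Po ('X - (v ord0 a)%:P))).
  exists W' => // k; apply: isder0_uniq (HW' p k) _ => //.
  have H l : isder0 (fun s => act (F q s) p ord0 l) 0 by rewrite -(W0 l); apply: HW.
  have fp : act (phiT v) p = p by rewrite -[v]scale1r fixp.
  apply: isder0_ext (isder0_act_const (phiT v) k H) => [s|].
    rewrite -actM /F phiT_S // actM fp; congr (act (phiS _ _) _ _ _).
    rewrite -transl_upoly /transl; exact: comp_mpolyZ.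
  by rewrite big1 // => l _; rewrite mulr0.
suff Z1 : Z 1%:P.
  have [W HW W0] := Z1 => k; rewrite -[RHS](W0 k).
  apply: isder0_uniq (iY p k) _ => //; apply: isder0_ext (HW p k) => // s.
  by rewrite /F upolyC mpolyC1 -mul_mpolyC mulr1 phiSC.
have descend m : forall q : {poly K},
    (size q <= m)%N -> q != 0 -> Z q -> Z (1%:P : {poly K}).
  elim: m => [|m IH] q; first by rewrite leqn0 size_poly_eq0 => ->.
  move=> qm q0 Zq; have [q1|q1] := leqP (size q) 1.
    have qE := size1_polyC q1; have c0 : q`_0 != 0.
      by apply: contraNneq q0 => c0; rewrite qE c0.
    suff -> : 1%:P = (q`_0)^-1 *: q by apply: ZZ.
    by rewrite [in RHS]qE -mul_polyC -polyCM [in RHS]coefC /= mulVf.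
  pose q' := q \Po ('X - (v ord0 a)%:P) + (-1) *: q.
  have szq' : (size q' < size q)%N.
    by rewrite /q' scaleN1r; apply: size_comp_shift_sub; apply: ltnW.
  apply: (IH q'); first by rewrite -ltnS; apply: leq_trans szq' qm.
    apply/eqP => q'0; have /poly_periodic_const : v ord0 a != 0 by [].
    move/(_ q); rewrite leqNgt q1 => H; suff: false by []; apply: H.
    by move/eqP: q'0; rewrite /q' scaleN1r subr_eq0 => /eqP.
  by apply: ZD; [apply: Zshift | apply: ZZ].
have /fin_all_exists[W HW] : forall k : 'I_n.+1, exists W, tangent (F ('X^k)) W.
  by move=> k; apply: tangent_exists.
(* The fields of the [n + 1] powers of degree at most [n] take values at [p] in a space of dimension
   [n]; a linear relation between these values is the polynomial sought. *)
pose A : 'M[K]_(n.+1, n) := \matrix_(k, l) (W k l).@[p ord0].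
have /rowV0Pn[u uA u0] : kermx A != 0.
  rewrite kermx_eq0; apply/negP => /eqP rA.
  by have := rank_leq_col A; rewrite rA ltnn.
have {}uA : u *m A = 0 by apply/sub_kermxP.
have HV (r : seq 'I_n.+1) : tangent (F (\sum_(k <- r) u ord0 k *: 'X^k))
    (fun l => \sum_(k <- r) u ord0 k *: W k l).
  elim: r => [|k r IHr] x l.
    apply: isder0_ext (tangent_const 1%g x l) => [s|]; rewrite big_nil //.
    by rewrite /F -[0 : {poly K}](scale0r 0) upolyZ scalerA mulr0 phiS0.
  rewrite [in X in isder0 _ X]big_cons.
  have H := FD _ _ _ _ (FZ (u ord0 k) _ _ (HW k)) IHr x l.
  by apply: isder0_ext H => // s; rewrite big_cons.
apply: (descend _ _ (leqnn _) _ (ex_intro2 _ _ _ (HV (index_enum _)) _)) => [|l].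
  apply: contraNneq u0 => s0; apply/eqP/rowP => k; rewrite mxE.
  have := congr1 (fun q : {poly K} => q`_k) s0; rewrite coef0 coef_sum => <-.
  rewrite (bigD1 k) //= coefZ coefXn eqxx mulr1 big1 ?addr0 // => l lk.
  by rewrite coefZ coefXn eq_sym (inj_eq val_inj) (negPf lk) mulr0.
have := congr1 (fun B : 'M_(_, _) => B ord0 l) uA; rewrite !mxE => uAl.
rewrite raddf_sum -[RHS]uAl; apply: eq_bigr => k _.
by rewrite /= mevalZ mxE.
Qed.

(** A left kernel vector [v] gives a field vanishing at [p]. If [v] has a nonzero coordinate [a],
    [Dfield_vanish] treats the indices other than [a], and the relation given by [v] then treats
    [a]. *)
Lemma Dfield_det0 (D : 'I_n -> 'I_n -> {mpoly K[n]}) (p : point) :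
    (forall i, Dfield (delta_mx 0 i) (D i)) ->
    \det (\matrix_(i, k) (D i k).@[p ord0]) = 0 ->
  forall i k, (D i k).@[p ord0] = 0.
Proof.
move=> HD /eqP/det0P[v v0 vD].
have [a va] : exists a, v ord0 a != 0.
  apply/existsP; apply: contraNT v0; rewrite negb_exists => /forallP v0.
  by apply/eqP/rowP => k; rewrite mxE; apply/eqP; have := v0 k; rewrite negbK.
have vX k : (\sum_i v ord0 i *: D i k).@[p ord0] = 0.
  have := congr1 (fun B : 'M_(_, _) => B ord0 k) vD; rewrite !mxE => uAl.
  rewrite raddf_sum -[RHS]uAl; apply: eq_bigr => i _.
  by rewrite /= mevalZ mxE.
have Di i k : i != a -> (D i k).@[p ord0] = 0.
  move=> ia; exact: (Dfield_vanish (Dfield_sum v HD) vX va ia (HD i)).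
move=> i k; have [->|/Di //] := eqVneq i a.
have := vX k; rewrite raddf_sum (bigD1 a) //= big1 => [|l la].
  by rewrite addr0 mevalZ => /eqP; rewrite mulf_eq0 (negPf va) => /eqP.
by rewrite mevalZ Di ?mulr0.
Qed.

End Rank.

(** * Simultaneous linearization of the translations *)

Section Poincare.
Context (K : fieldType) (charK0 : [pchar K] =i pred0) (n : nat).

(** The integral of [t^(c-1) p(t x)] for [t] from 0 to 1, computed on monomials. *)
Definition mdeg_divide (c : nat) (p : {mpoly K[n]}) : {mpoly K[n]} :=
  \sum_(m <- msupp p) (p@_m / (mdeg m + c)%:R) *: 'X_[m].

Lemma mcoeff_mdeg_divide c p m : (mdeg_divide c p)@_m = p@_m / (mdeg m + c)%:R.
Proof.
rewrite /mdeg_divide raddf_sum /=; under eq_bigr do rewrite mcoeffZ mcoeffX.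
have [mp|mp] := boolP (m \in msupp p).
  rewrite (bigD1_seq m) ?msupp_uniq //= eqxx mulr1 big1 ?addr0 // => k km.
  by rewrite (negPf km) mulr0.
rewrite (memN_msupp_eq0 mp) mul0r big_seq big1 // => k kp.
by case: eqP => [km|_]; rewrite ?mulr0 // -km kp in mp *.
Qed.

Lemma mderiv_mdeg_divide c p i :
  (mdeg_divide c p)^`M(i) = mdeg_divide c.+1 p^`M(i).
Proof.
apply/mpolyP => m; rewrite mcoeff_mderiv !mcoeff_mdeg_divide mcoeff_mderiv.
by rewrite mdegD mdeg1 mulrnAl -addnA add1n.
Qed.

Lemma euler_identity p :
  mdeg_divide 1 p + \sum_k 'X_k * mdeg_divide 2 p^`M(k) = p.
Proof.
have lin c a q r : mdeg_divide c (a *: q + r) = a *: mdeg_divide c q + mdeg_divide c r.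
  apply/mpolyP => m; rewrite mcoeffD mcoeffZ !mcoeff_mdeg_divide mcoeffD mcoeffZ.
  by rewrite mulrDl mulrA.
have mon c m : mdeg_divide c 'X_[m] = ((mdeg m + c)%:R)^-1 *: 'X_[m].
  apply/mpolyP => k; rewrite mcoeffZ mcoeff_mdeg_divide mcoeffX.
  by case: eqP => [->|_]; rewrite ?mulr0 ?mul0r // mulrC.
have zero c : mdeg_divide c 0 = 0.
  by apply/mpolyP => m; rewrite mcoeff_mdeg_divide mcoeff0 mul0r.
elim/mpolyind: p => [|a m p _ _ IH].
  by rewrite zero big1 ?addr0 // => k _; rewrite mderiv0 zero mulr0.
rewrite lin; under eq_bigr do rewrite mderivD mderivZ lin mulrDr -scalerAr.
rewrite big_split /= addrACA IH -scaler_sumr -scalerDr; congr (_ *: _ + _).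
have dm k : 'X_k * mdeg_divide 2 'X_[m]^`M(k) =
    ((m k)%:R / (mdeg m + 1)%:R) *: 'X_[m].
  rewrite mderivX -[_ *: _]addr0 lin zero addr0 mon -!scalerAr scalerA.
  case: (posnP (m k)) => [->|mk]; first by rewrite !mul0r !scale0r.
  have le1 : (U_(k) <= m)%MM.
    by apply/mnm_lepP => j; rewrite mnm1E; case: eqP => // <-.
  rewrite -mpolyXD addmC submK // -[in RHS](submK le1) mdegD mdeg1.
  by rewrite -addnA submK.
under eq_bigr do rewrite dm.
rewrite mon -scaler_suml -scalerDl -mulr_suml -natr_sum -mdegE.
rewrite -[X in X + _]mul1r -mulrDl addrC natr1 addn1 mulfV ?scale1r //.
by rewrite (natf_eq0 charK0).
Qed.

(** The primitive is the integral of the form along the segment from 0 to [x]; closedness reduces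
    the claim to Euler's identity. *)
Lemma poincare (w : 'I_n -> {mpoly K[n]}) :
    (forall k l, (w k)^`M(l) = (w l)^`M(k)) ->
  exists y, forall k, y^`M(k) = w k.
Proof.
move=> wc; exists (\sum_k 'X_k * mdeg_divide 1 (w k)) => l.
rewrite mderiv_sum -[RHS]euler_identity.
under eq_bigr do rewrite mderivM mderivXU mderiv_mdeg_divide wc.
rewrite big_split /=; congr (_ + _); rewrite (bigD1 l) //= eqxx mul1r.
by rewrite big1 ?addr0 // => k /negPf ->; rewrite mul0r.
Qed.

End Poincare.

(** * From a commuting frame to coordinates *)

Section Linearization.
Context (K : fieldType) (charK0 : [pchar K] =i pred0) (n : nat).
Local Notation Aut := (polyAut K n).
Local Notation SAut := (polySAut K n).
Local Notation point := 'rV[K]_n.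
Local Notation mpol := {mpoly K[n]}.
Implicit Types (f g : Aut) (x y v p : point).

(* Given a frame [D] of fields and a map [g] with [d g (e_i) = D_i o g], the
   substitution [f |-> f o g] is injective, since its kernel is stable under
   all derivations; so identities between the [D_i] can be checked after it. *)
Lemma frame_integral (D : 'I_n -> 'I_n -> mpol) (g : polyEnd K n) (c : K) :
    c != 0 -> \det (\matrix_(i, k) D i k) = c%:MP ->
    (forall i k, (tnth g k)^`M(i) = D i k \mPo g) ->
  exists h : polyEnd K n,
    cancel (endact g) (endact h) /\ cancel (endact h) (endact g).
Proof.
move=> c0 detD gD; pose M : 'M[mpol]_n := \matrix_(i, k) D i k.
(* The inverse is polynomial because the determinant is a nonzero constant; the columns of [W] are
   the dual 1-forms. *)
have [W MW WM] : exists2 W : 'M[mpol]_n, M *m W = 1%:M & W *m M = 1%:M.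
  have MW : M *m ((c^-1)%:MP *: \adj M) = 1%:M.
    by rewrite -scalemxAr mul_mx_adj detD scale_scalar_mx -mpolyCM mulVf.
  by exists ((c^-1)%:MP *: \adj M) => //; apply: mulmx1C.
have dcomp q i : (q \mPo g)^`M(i) = \sum_k (D i k \mPo g) * (q^`M(k) \mPo g).
  by rewrite mderiv_comp; apply: eq_bigr => k _; rewrite gD mulrC.
have g_inj q : q \mPo g = 0 -> q = 0.
  move=> qg; apply/eqP/negPn/negP => q0.
  pose I (q : mpol) := q \mPo g = 0.
  have Ider r i : I r -> I r^`M(i).
    move=> rg; pose N : 'cV[mpol]_n := \col_k r^`M(k).
    have MN : map_mx (comp_mpoly g) (M *m N) = 0.
      apply/colP => j; rewrite !mxE rmorph_sum.
      transitivity ((r \mPo g)^`M(j)); last by rewrite rg mderiv0.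
      by rewrite dcomp; apply: eq_bigr => k _; rewrite rmorphM /= !mxE.
    have : map_mx (comp_mpoly g) N = 0.
      by rewrite -[N]mul1mx -WM -mulmxA map_mxM MN mulmx0.
    by move/colP/(_ i); rewrite !mxE.
  have [a a0] := mderiv_stable_const charK0 Ider qg q0.
  rewrite /I comp_mpolyC => /eqP; rewrite mpolyC_eq0 => /eqP a0'.
  by rewrite a0' eqxx in a0.
(* The fields commute: after substitution of [g], the two sides are the mixed second derivatives of
   a component of [g]. *)
have bracket a i k :
    \sum_l D a l * (D i k)^`M(l) = \sum_l D i l * (D a k)^`M(l).
  apply/eqP; rewrite -subr_eq0; apply/eqP/g_inj; rewrite comp_mpolyB !rmorph_sum.
  have E b j : \sum_l comp_mpoly g (D b l * (D j k)^`M(l)) = (tnth g k)^`M(j)^`M(b).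
    by rewrite gD dcomp; apply: eq_bigr => l _; rewrite rmorphM.
  by rewrite !E mderiv_comm subrr.
(* Evaluated on the frame, the matrix [B] of derivatives of the form becomes [M *m B *m M^T],
   symmetric because the fields commute; so [B] is symmetric. *)
have closed j k l : (W k j)^`M(l) = (W l j)^`M(k).
  pose B : 'M[mpol]_n := \matrix_(l, k) (W k j)^`M(l).
  have dMW i b : \sum_k D i k * (W k j)^`M(b) = - \sum_k (D i k)^`M(b) * W k j.
    apply/eqP; rewrite -addr_eq0 -big_split /=; apply/eqP.
    have := congr1 (fun N : 'M_n => (N i j)^`M(b)) MW; rewrite !mxE.
    rewrite -[(_ == _)%:R]mpolyC_nat mderivC mderiv_sum => H; rewrite -[RHS]H.
    by apply: eq_bigr => m _; rewrite mderivM addrC !mxE.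
  have MBM a i : (M *m B *m M^T) a i = - \sum_k (\sum_b D a b * (D i k)^`M(b)) * W k j.
    rewrite -mulmxA mxE.
    transitivity (- \sum_b \sum_k D a b * (D i k)^`M(b) * W k j).
      rewrite -sumrN; apply: eq_bigr => b _; rewrite !mxE.
      under eq_bigr do rewrite !mxE mulrC.
      rewrite dMW mulrN mulr_sumr; congr (- _).
      by apply: eq_bigr => m _; rewrite mulrA.
    rewrite exchange_big; congr (- _); apply: eq_bigr => m _.
    by rewrite mulr_suml.
  have [S Ss BE] : exists2 S, S^T = S & B = W *m S *m W^T.
    exists (M *m B *m M^T).
      apply/matrixP => a i; rewrite [LHS]mxE !MBM; congr (- _).
      by apply: eq_bigr => m _; rewrite bracket.
    by rewrite !mulmxA WM mul1mx -mulmxA -trmx_mul WM trmx1 mulmx1.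
  have Bs : B = B^T by rewrite BE !trmx_mul trmxK Ss mulmxA.
  by have /matrixP/(_ l k) := Bs; rewrite !mxE.
have /fin_all_exists[y0 Hy0] : forall j, exists y : mpol, forall k, y^`M(k) = W k j.
  by move=> j; apply: (poincare charK0) => k l; apply: closed.
(* By duality, [y0 j] composed with [g] has the derivatives of ['X_j]. The integration constants are
   subtracted in [h]. *)
have yg j : exists a, y0 j \mPo g = 'X_j + a%:MP.
  have dz i : (y0 j \mPo g - 'X_j)^`M(i) = 0.
    rewrite mderivB mderivXU dcomp.
    have := congr1 (fun N : 'M_n => N i j \mPo g) MW; rewrite !mxE rmorph_sum /=.
    rewrite -[in X in _ = X -> _]mpolyC_nat comp_mpolyC => H.
    rewrite eq_sym -[(i == j)%:R]mpolyC_nat -H -sumrB big1 // => k _.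
    by rewrite Hy0 !mxE rmorphM /= subrr.
  have E := mderiv_eq0_const charK0 dz.
  by exists ((y0 j \mPo g - 'X_j)@_0%MM); rewrite -E addrC subrK.
have /fin_all_exists[a Ha] := yg.
pose h : polyEnd K n := [tuple y0 j - (a j)%:MP | j < n].
have hg j : tnth h j \mPo g = 'X_j.
  by rewrite tnth_mktuple comp_mpolyB comp_mpolyC Ha addrK.
have gh_cancel : cancel (endact g) (endact h).
  move=> x; apply/rowP => j; rewrite mxE.
  have := congr1 (meval (x ord0)) (hg j); rewrite mevalXU comp_mpoly_meval => <-.
  by apply: meval_eq => k; rewrite mxE.
exists h; split=> // x; apply/rowP => k; rewrite mxE.
(* The left inverse is also a right inverse: the two sides agree after substitution of [g], which is
   injective. *)
have gk : tnth g k \mPo h = 'X_k.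
  apply/eqP; rewrite -subr_eq0; apply/eqP/g_inj.
  rewrite comp_mpolyB comp_mpolyXt comp_mpolyA; apply/eqP; rewrite subr_eq0; apply/eqP.
  rewrite -[RHS]comp_mpoly_id; congr (_ \mPo _); apply/eq_from_tnth => j.
  by rewrite tnth_mktuple hg tnth_mktuple.
have := congr1 (meval (x ord0)) gk; rewrite mevalXU comp_mpoly_meval => <-.
by apply: meval_eq => j; rewrite mxE.
Qed.

Context (phi : SAut -> Aut).
Hypothesis phiM : {morph phi : h k / (h * k)%g}.
Hypothesis phi_mor : ind_morphism phi.
Hypothesis phi_nontrivial : ~ (forall h, phi h = 1%g).

Lemma kappa_phiT v : kappa (phiT phi v) = 1.
Proof.
rewrite -[v]scale1r.
apply: (kappa_Ga charK0 (c := fun s => phiT phi (s *: v))) => [|s t].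
  exact: regfam_phiTZ.
by rewrite scalerDl phiTD.
Qed.

(** Translations commute, so [phiT phi v] pushes each [D i] forward to itself. *)
Lemma Dfield_equivariant (D : 'I_n -> 'I_n -> mpol) v p i k :
    (forall i, Dfield phi (delta_mx 0 i) (D i)) ->
  (D i k).@[act (phiT phi v) p ord0] =
    \sum_l (D i l).@[p ord0] * (tnth (polyAut_map (phiT phi v)) k)^`M(l).@[p ord0].
Proof.
move=> HD; under eq_bigr do rewrite mulrC.
apply: (isder0_uniq charK0) (HD i _ k) _.
have H := isder0_act_const (phiT phi v) k (HD i p).
have e0 : act (phiT phi (0 *: delta_mx 0 i)) p = p by rewrite scale0r phiT0 // act1.
rewrite e0 in H; apply: isder0_ext H => // s.
by rewrite -!actM -!phiTD // addrC.
Qed.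

(** The determinant [d] is invariant because the images of translations have Jacobian 1. So every
    [D i] annihilates [d], and multiplying by the adjugate gives that [d] times each of its
    derivatives is 0. *)
Lemma Dfield_det_const (D : 'I_n -> 'I_n -> mpol) :
    (forall i, Dfield phi (delta_mx 0 i) (D i)) ->
  exists2 c, c != 0 & \det (\matrix_(i, k) D i k) = c%:MP.
Proof.
move=> HD; pose M : 'M[mpol]_n := \matrix_(i, k) D i k.
pose d : mpol := \det M; rewrite -/M -/d.
have dE p : d.@[p ord0] = \det (\matrix_(i, k) (D i k).@[p ord0]).
  rewrite /d -det_map_mx; congr (\det _); by apply/matrixP => i k; rewrite !mxE.
have d0 : d != 0.
  apply/negP => /eqP d0; apply: phi_nontrivial.
  apply: (hom_trans_trivial charK0 phiM phi_mor) => v.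
  apply: (act_eq charK0) => p; rewrite act1 -/(phiT phi v) -[v]scale1r.
  apply: (phiT_fix charK0 phiM (Dfield_sum charK0 phiM phi_mor v HD)) => k.
  rewrite raddf_sum big1 // => i _ /=; rewrite mevalZ.
  by rewrite (Dfield_det0 charK0 phiM phi_mor HD) ?mulr0 // -dE d0 meval0.
have dinv v p : d.@[act (phiT phi v) p ord0] = d.@[p ord0].
  pose J : 'M_n := map_mx (meval (p ord0)) (jacobian (polyAut_map (phiT phi v))).
  have J1 : \det J = 1.
    by rewrite /J det_map_mx -/(jdet _) jdetE kappa_phiT /= mevalC.
  rewrite !dE -[RHS]mulr1 -J1 -[\det J]det_tr -det_mulmx; congr (\det _).
  apply/matrixP => i k; rewrite !mxE (Dfield_equivariant v p i k HD).
  by apply: eq_bigr => l _; rewrite !mxE.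
have dd i : \sum_l D i l * d^`M(l) = 0.
  apply: (mpoly_meval_eq0 charK0) => p; rewrite raddf_sum.
  have H := isder0_meval d (HD i p).
  have e0 : act (phiT phi (0 *: delta_mx 0 i)) p = p by rewrite scale0r phiT0 // act1.
  rewrite e0 in H; transitivity (\sum_l d^`M(l).@[p ord0] * (D i l).@[p ord0]).
    by apply: eq_bigr => l _; rewrite /= mevalM mulrC.
  apply: (isder0_uniq charK0 H).
  exact: isder0_ext (fun s => esym (dinv (s *: delta_mx 0 i) p)) erefl (isder0_const _).
have dl l : d^`M(l) = 0.
  pose N : 'cV[mpol]_n := \col_l d^`M(l).
  have MN : M *m N = 0.
    by apply/colP => i; rewrite !mxE -[RHS](dd i); apply: eq_bigr => m _; rewrite !mxE.
  have : \adj M *m (M *m N) = 0 by rewrite MN mulmx0.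
  rewrite mulmxA mul_adj_mx -/d mul_scalar_mx => /colP/(_ l); rewrite !mxE => /eqP.
  by rewrite mulf_eq0 (negPf d0) => /eqP.
have dC := mderiv_eq0_const charK0 dl.
by exists d@_0%MM => //; apply: contraNneq d0 => d00; rewrite dC d00.
Qed.

(** The orbit map of 0 intertwines the translations with their images by construction; the point is
    that it is invertible, its differential being the frame [D] taken along it. *)
Lemma linearization : exists g, forall v, phiT phi v = (g * trans v * g^-1)%g.
Proof.
have /fin_all_exists[D HD] : forall i, exists X, Dfield phi (delta_mx 0 i) X.
  by move=> i; apply: tangent_exists; apply: regfam_phiTZ.
have [c c0 detD] := Dfield_det_const HD.
have idr (j : 'I_n) : regular_on (id : point -> point) predT (fun v : point => v ord0 j).
  exact: reg_coord.
have gf : regfam (id : point -> point) (fun v => phiT phi v) by apply: regfam_phiT.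
have /fin_all_exists[gE HgE] : forall k, exists q : mpol,
    forall v, act (phiT phi v) 0 ord0 k = q.@[v ord0].
  move=> k; have [q Hq] := regfam_act k gf (fun j => reg_const _ _ ((0 : point) ord0 j)).
  by exists q => v; apply: Hq.
pose g : polyEnd K n := [tuple gE k | k < n].
have gv v : endact g v = act (phiT phi v) 0.
  by apply/rowP => k; rewrite HgE mxE tnth_mktuple.
have gD i k : (tnth g k)^`M(i) = D i k \mPo g.
  apply: (mpoly_meval_inj charK0) => v; rewrite tnth_mktuple comp_mpoly_meval.
  pose w s : 'I_n -> K := (s *: delta_mx 0 i + v) ord0.
  have ww j : isder0 (w^~ j) (i == j)%:R.
    apply: isder0_ext (isder0D (isder0Z (i == j)%:R (isder0_id K))
      (isder0_const (v 0 j))) => [s|].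
      by rewrite /w !mxE eqxx eq_sym mulrC.
    by rewrite addr0 mulr1.
  have H := isder0_meval (gE k) ww.
  have -> : (gE k)^`M(i).@[v ord0] = \sum_l (gE k)^`M(l).@[w 0] * (i == l)%:R.
    rewrite (bigD1 i) //= eqxx mulr1 big1 ?addr0 => [|l li].
      by apply: meval_eq => l; rewrite /w scale0r add0r.
    by rewrite eq_sym (negPf li) mulr0.
  have -> : (D i k).@[fun l => (tnth g l).@[v ord0]] = (D i k).@[act (phiT phi v) 0 ord0].
    by apply: meval_eq => l; rewrite -gv mxE.
  apply: (isder0_uniq charK0 H); apply: isder0_ext (HD i (act (phiT phi v) 0) k) => // s.
  by rewrite -actM -phiTD // HgE.
have [h [gh hg]] := frame_integral c0 detD gD.
exists (mkAut g h) => v; apply: (@mulIg _ (mkAut g h)); rewrite mulgKV.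
apply: (mulg_act charK0) => x; rewrite !(act_mkAut charK0 gh hg) !gv.
by rewrite (act_trans charK0) -actM -phiTD // addrC.
Qed.

End Linearization.

(** * Homomorphisms that fix the translations *)

Section Centralizers.
Context (K : fieldType) (charK0 : [pchar K] =i pred0) (n : nat).
Local Notation Aut := (polyAut K n).
Local Notation SAut := (polySAut K n).
Local Notation point := 'rV[K]_n.
Implicit Types (f g u : Aut) (x y v w : point).

Lemma centralize_trans u :
  (forall v, u * trans v = trans v * u)%g -> u = trans (act u 0).
Proof.
move=> uT; apply: (act_eq charK0) => v; rewrite (act_trans charK0).
have := congr1 (fun f => act f 0) (uT v).
by rewrite !actM !(act_trans charK0) add0r addrC.
Qed.

Lemma aff_trans (L : 'M[K]_n) v : L \in unitmx ->
  (aff L 0 * trans v = trans (v *m L) * aff L 0)%g.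
Proof.
move=> LU; apply: (mulg_act charK0) => x.
by rewrite !(act_trans charK0) !(act_aff charK0) // !addr0 mulmxDl.
Qed.

Lemma centralize_trans_scalar w c : c != 0 -> c != 1 ->
  (aff c%:M 0 * trans w = trans w * aff c%:M 0)%g -> w = 0.
Proof.
move=> c0 c1 /(congr1 (fun f => act f 0)).
rewrite !actM !(act_trans charK0) !(act_aff charK0) ?scalar_unit // !addr0 add0r.
rewrite mul0mx add0r mul_mx_scalar => e; apply/eqP.
have : (c - 1) *: w == 0 by rewrite scalerBl scale1r e subrr.
by rewrite scaler_eq0 subr_eq0 (negPf c1).
Qed.

Lemma centralize_shear w i j : i != j ->
  (shear i 'X_j * trans w = trans w * shear i 'X_j)%g -> w ord0 j = 0.
Proof.
move=> ij; have Xi : ('X_j : {mpoly K[n]})^`M(i) = 0.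
  by rewrite mderivXU eq_sym (negPf ij).
move=> /(congr1 (fun f => act f 0 ord0 i)).
rewrite !actM !(act_trans charK0) !(act_shear charK0) // !mevalXU !mxE !eqxx /=.
by rewrite !add0r mulr1 mul0r add0r -[RHS]addr0 => /addrI.
Qed.

(** Commuting with translations makes [u] a translation, and each of its coordinates [j] is killed
    by a linear shear along some other coordinate. *)
Lemma centralize_SAut u : (1 < n)%N ->
  (forall f, kappa f = 1%R -> u * f = f * u)%g -> u = 1%g.
Proof.
move=> n2 uC; have uT v := uC (trans v) (kappa_trans charK0 v).
have uE := centralize_trans uT; rewrite uE; set w := act u 0 in uE *.
suff -> : w = 0 by rewrite (trans0 charK0).
apply/rowP => j; rewrite [RHS]mxE.
have [i ij] : exists i : 'I_n, i != j.
  have n0 : (0 < n)%N by apply: ltnW.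
  have [j0|j0] := eqVneq j (Ordinal n0); last by exists (Ordinal n0); rewrite eq_sym.
  by exists (Ordinal n2); rewrite j0.
apply: (centralize_shear ij); rewrite -uE uC //; apply: (kappa_shear charK0).
by rewrite mderivXU eq_sym (negPf ij).
Qed.

Lemma shear_inj i p q : p^`M(i) = 0 -> q^`M(i) = 0 ->
  shear i p = shear i q :> Aut -> p = q.
Proof.
move=> pi0 qi0 e; apply: (mpoly_meval_inj charK0) => x.
have := congr1 (fun f => act f x ord0 i) e.
rewrite !(act_shear charK0) // !mxE !eqxx /= !mulr1.
exact: addrI.
Qed.

(** The leading terms cancel. [S p a] says that [p] has degree at most [a] and its difference degree
    below [a]; the twisted Leibniz rule makes this multiplicative. *)
Lemma msize_transl_sub v (m : 'X_{1..n}) :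
  (msize (transl v 'X_[m] - 'X_[m])%R <= mdeg m)%N.
Proof.
pose S (p : {mpoly K[n]}) a :=
  ((msize p <= a.+1) /\ (msize (transl v p - p)%R <= a))%N.
have mul_leq (p q : {mpoly K[n]}) a b :
    (msize p <= a -> msize q <= b.+1 -> msize (p * q)%R <= a + b)%N.
  case: a => [|a] pa qb; last exact: msize_mul_leq.
  by move: pa; rewrite leqn0 msize_poly_eq0 => /eqP ->; rewrite mul0r msize0.
have add_leq (p q : {mpoly K[n]}) a :
    (msize p <= a -> msize q <= a -> msize (p + q)%R <= a)%N.
  by move=> pa qa; apply: leq_trans (msizeD_le _ _) _; rewrite geq_max pa.
have S1 : S 1 0%N by rewrite /S /transl comp_mpoly1 subrr msize0 msize1.
have SM p q a b : S p a -> S q b -> S (p * q) (a + b)%N.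
  move=> [pa dpa] [qb dqb]; split; first exact: msize_mul_leq.
  have -> : transl v (p * q) - p * q =
      (transl v p - p) * transl v q + p * (transl v q - q).
    by rewrite /transl rmorphM /=; ring.
  apply: (add_leq); first apply: (mul_leq) => //.
    by rewrite -[transl v q](subrK q) add_leq // (leq_trans dqb).
  by rewrite mulrC addnC; apply: mul_leq.
have SX (i : 'I_n) : S 'X_i 1%N.
  split; first by rewrite msizeX mdeg1.
  have -> : transl v 'X_i - 'X_i = (v ord0 i)%:MP.
    apply: (mpoly_meval_inj charK0) => x.
    by rewrite mevalB meval_transl !mevalXU mevalC mxE addrAC subrr add0r.
  by rewrite msizeC; case: (_ != 0).
suff [] : S 'X_[m] (mdeg m) by [].
rewrite mpolyXE_id mdegE; elim/big_rec2: _ => [|i p a _ Sp]; first exact: S1.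
apply: (SM) => //; elim: (m i) => [|k IH]; first by rewrite expr0.
by rewrite exprS -add1n; apply: SM.
Qed.

Context (theta : SAut -> Aut).
Hypothesis thetaM : {morph theta : h k / (h * k)%g}.
Hypothesis thetaT : forall v, theta (toSAut (trans v)) = trans v.

Lemma theta_toSAutM f g : kappa f = 1 -> kappa g = 1 ->
  theta (toSAut (f * g)%g) = (theta (toSAut f) * theta (toSAut g))%g.
Proof. by move=> f1 g1; rewrite (toSAutM f1 g1) thetaM. Qed.

(** Since [theta] fixes translations, [f] and its image conjugate them alike; their quotient
    commutes with all translations, hence is one. *)
Lemma theta_normalizes f : kappa f = 1 ->
    (forall v, exists w, f * trans v = trans w * f)%g ->
  exists w, theta (toSAut f) = (f * trans w)%g.
Proof.
move=> f1 fT; exists (act (f^-1 * theta (toSAut f))%g 0).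
rewrite -centralize_trans ?mulVKg // => v; have [w e] := fT v.
have kt (z : point) := kappa_trans charK0 z.
have := congr1 (fun h => theta (toSAut h)) e.
rewrite /= (theta_toSAutM f1 (kt v)) (theta_toSAutM (kt w) f1) !thetaT => e'.
by rewrite -mulgA e' mulgA -[(f^-1 * trans w)%g](mulgK f) -(mulgA f^-1%g) -e mulKg mulgA.
Qed.

Hypothesis thetaL : forall L : 'M[K]_n, \det L = 1 -> theta (toSAut (aff L 0)) = aff L 0.

(** The commutator with a translation is a shear of lower degree, fixed by hypothesis, so [theta]
    changes the shear by a translation at most. The linear shears along [i] commute with it and
    confine that translation to the direction [i]. *)
Lemma theta_shear_monomial_drift i j (c : K) (m : 'X_{1..n}) d :
    j != i -> m i = 0%N -> (mdeg m <= d)%N ->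
    (forall p, p^`M(i) = 0 -> (msize p <= d)%N ->
       theta (toSAut (shear i p)) = shear i p) ->
  exists o, theta (toSAut (shear i (c *: 'X_[m]))) = shear i (c *: 'X_[m] + o%:MP).
Proof.
move=> ji mi md IH; pose p : {mpoly K[n]} := c *: 'X_[m].
have pi0 : p^`M(i) = 0 by rewrite mderivZ mderivX mi scale0r scaler0.
have Ci o : (o%:MP : {mpoly K[n]})^`M(i) = 0 by rewrite mderivC.
have k1 := kappa_shear charK0 pi0; have kt (z : point) := kappa_trans charK0 z.
set E := shear i p in k1 *; pose u := (E^-1 * theta (toSAut E))%g.
have thE : theta (toSAut E) = (E * u)%g by rewrite /u mulVKg.
have uT v : (u * trans v = trans v * u)%g.
  pose r := transl (- v) p - p.
  have ri : r^`M(i) = 0 by rewrite mderivB mderiv_transl // pi0 subrr.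
  have rd : (msize r <= d)%N.
    have -> : r = c *: (transl (- v) 'X_[m] - 'X_[m]).
      by rewrite scalerBr /r /p /transl comp_mpolyZ.
    apply: leq_trans (msizeZ_le _ _) _; apply: leq_trans md.
    exact: msize_transl_sub.
  have e : (trans v * E = shear i r * E * trans v)%g.
    by rewrite /E -(shearD charK0 ri pi0) /r subrK trans_shear.
  have kr := kappa_shear charK0 ri.
  have := congr1 (fun h => theta (toSAut h)) e.
  rewrite /= !theta_toSAutM ?kappaM ?kr ?kt ?k1 ?mulr1 // thetaT (IH r ri rd) thE.
  rewrite mulgA e -!mulgA => /mulgI /mulgI e'; exact: esym.
have uE := centralize_trans uT; move: (act u 0) uE => w uE.
have wj l : l != i -> w ord0 l = 0.
  move=> li; have Xi : ('X_l : {mpoly K[n]})^`M(i) = 0 by rewrite mderivXU (negPf li).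
  have kl := kappa_shear charK0 Xi.
  have thl : theta (toSAut (shear i 'X_l)) = shear i 'X_l.
    by rewrite -['X_l]scale1r -(aff_transvection charK0 1 li) thetaL ?det_transvection.
  have e : (shear i 'X_l * E = E * shear i 'X_l)%g.
    by rewrite /E -!(shearD charK0) // addrC.
  apply: (@centralize_shear w i l); first by rewrite eq_sym.
  rewrite -uE; have := congr1 (fun h => theta (toSAut h)) e.
  rewrite /= !theta_toSAutM // thl thE mulgA e -!mulgA => /mulgI; exact.
have -> : theta (toSAut (shear i (c *: 'X_[m]))) = (E * trans w)%g.
  by rewrite -uE -thE.
exists (w ord0 i); rewrite (shearD charK0) // (shearC charK0) -/p -/E.
congr (_ * trans _)%g.
apply/rowP => l; rewrite !mxE eqxx /=; case: eqP => [->|/eqP /wj ->].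
  by rewrite mulr1.
by rewrite mulr0.
Qed.

(** Two computations of the drift. With [c = 2^(m_j+1) c'], additivity gives [o = 2^(m_j+1) o'],
    whereas the dilation, which conjugates the two shears and halves coordinate [i], gives
    [o' = o / 2]. Hence [(2^(m_j) - 1) o = 0] with [m_j > 0]. *)
Lemma theta_shear_monomial i (c : K) (m : 'X_{1..n}) d :
    m i = 0%N -> (mdeg m <= d)%N ->
    (forall p, p^`M(i) = 0 -> (msize p <= d)%N ->
       theta (toSAut (shear i p)) = shear i p) ->
  theta (toSAut (shear i (c *: 'X_[m]))) = shear i (c *: 'X_[m]).
Proof.
move=> mi md IH; have [->|m0] := eqVneq m 0%MM.
  by rewrite mpolyX0 -mul_mpolyC mulr1 (shearC charK0) thetaT.
have [j mj] := mnm_neq0_exists m0.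
have ij : i != j by apply: contraNneq mj => <-; rewrite mi.
have ji : j != i by rewrite eq_sym.
have Xi a : (a *: 'X_[m] : {mpoly K[n]})^`M(i) = 0.
  by rewrite mderivZ mderivX mi scale0r scaler0.
have XCi a o : (a *: 'X_[m] + o%:MP : {mpoly K[n]})^`M(i) = 0.
  by rewrite mderivD Xi mderivC addr0.
have ks a := kappa_shear charK0 (Xi a).
have X0 : ('X_[m] : {mpoly K[n]}).@[(0 : point) ord0] = 0.
  by rewrite meval_row0 mcoeffX (negPf m0).
have [o Ho] := theta_shear_monomial_drift c ji mi md IH.
pose N := (2 ^ (m j).+1)%N; pose c' := 2%:R ^- (m j).+1 * c.
have N0 : 2%:R ^+ (m j).+1 != 0 :> K by rewrite expf_neq0 // two_neq0.
have cE : c = N%:R * c' by rewrite /c' mulrA natrX mulfV // mul1r.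
have [o' Ho'] := theta_shear_monomial_drift c' ji mi md IH.
have mult k : theta (toSAut (shear i ((k%:R * c') *: 'X_[m]))) =
    shear i ((k%:R * c') *: 'X_[m] + (k%:R * o')%:MP).
  elim: k => [|k IHk].
    by rewrite !mul0r scale0r mpolyC0 addr0 -mpolyC0 (shearC charK0) thetaT.
  rewrite -natr1 !mulrDl !mul1r scalerDl (shearD charK0) // theta_toSAutM //.
  by rewrite IHk Ho' -(shearD charK0) // mpolyCD addrACA.
have oN : o = N%:R * o'.
  have := mult N; rewrite -cE Ho => /(shear_inj (XCi _ _) (XCi _ _)) /addrI.
  by move=> e; have := congr1 (mcoeff 0%MM) e; rewrite !mcoeffC eqxx !mulr1.
have o'2 : o' = 2%:R^-1 * o.
  have d1 := det_dilation charK0 ij; have dU := det1_unitmx d1.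
  have kd : kappa (aff (dilation K i j) 0) = 1 by rewrite (kappa_aff charK0).
  have := congr1 (fun h => theta (toSAut h)) (dilation_shear charK0 c ij mi).
  rewrite /= -/c' !theta_toSAutM // (thetaL d1) Ho Ho'.
  move=> /(congr1 (fun f => act f 0 ord0 i)).
  rewrite !actM !(act_aff charK0) // mul0mx !addr0.
  rewrite !(act_shear charK0) // !add0r -scalemxAl.
  rewrite !mevalD !mevalC !mevalZ X0 !mulr0 !add0r.
  rewrite -rowE !mxE !eqxx (negPf ij) /= mulr1n mulr1 => <-.
  by rewrite mulrC.
suff o0 : o = 0 by rewrite Ho o0 mpolyC0 addr0.
have n1 : (2 ^ m j)%:R - 1 != 0 :> K.
  rewrite subr_eq0 -[1]/(1%:R) (inj_eq (natf_inj charK0)).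
  by rewrite gtn_eqF // -[1%N](expn0 2) ltn_exp2l // lt0n.
apply: (mulfI n1); rewrite mulr0 mulrBl mul1r.
apply/eqP; rewrite subr_eq0; apply/eqP; rewrite [RHS]oN o'2 /N.
by rewrite expnS natrM; field; rewrite two_neq0.
Qed.

End Centralizers.

Section ThetaShear.
Context (K : fieldType) (charK0 : [pchar K] =i pred0) (n : nat).
Local Notation Aut := (polyAut K n).
Local Notation SAut := (polySAut K n).
Context (theta : SAut -> Aut).
Hypothesis thetaM : {morph theta : h k / (h * k)%g}.
Hypothesis thetaT : forall v, theta (toSAut (trans v)) = trans v.
Hypothesis thetaL : forall L : 'M[K]_n, \det L = 1 -> theta (toSAut (aff L 0)) = aff L 0.

Lemma theta_shear i p : p^`M(i) = 0 -> theta (toSAut (shear i p)) = shear i p.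
Proof.
suff H d : forall q, q^`M(i) = 0 -> (msize q <= d)%N ->
    theta (toSAut (shear i q)) = shear i q.
  by move=> pi0; apply: (H (msize p)).
elim: d => [|d IH] q qi0 qd.
  move: qd; rewrite leqn0 msize_poly_eq0 => /eqP ->.
  by rewrite -mpolyC0 (shearC charK0) thetaT.
have Xi c (m : 'X_{1..n}) : m i = 0%N -> (c *: 'X_[m] : {mpoly K[n]})^`M(i) = 0.
  by move=> mi; rewrite mderivZ mderivX mi scale0r scaler0.
rewrite (mpolyE q).
suff [] : (\sum_(m <- msupp q) q@_m *: 'X_[m])^`M(i) = 0 /\
    theta (toSAut (shear i (\sum_(m <- msupp q) q@_m *: 'X_[m]))) =
    shear i (\sum_(m <- msupp q) q@_m *: 'X_[m]) by [].
rewrite big_seq; elim/big_rec: _ => [|m r mq [ri Hr]].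
  by rewrite mderiv0 -mpolyC0 (shearC charK0) thetaT.
have mi := mderiv0_msupp charK0 qi0 mq; split; first by rewrite mderivD Xi ?ri ?addr0.
have k1 := kappa_shear charK0 (Xi q@_m m mi); have k2 := kappa_shear charK0 ri.
rewrite (shearD charK0 (Xi _ _ mi) ri) (theta_toSAutM thetaM k1 k2) Hr.
congr (_ * _)%g; have md : (mdeg m <= d)%N.
  by rewrite -ltnS; apply: leq_trans qd; apply: msize_mdeg_lt.
exact: (theta_shear_monomial charK0 thetaM thetaT thetaL q@_m mi md IH).
Qed.

End ThetaShear.

(** * Straightening the linear maps *)

Lemma conj_commute (G : groupType) (a b w c t z : G) :
  (a * b = b * a -> w^-1 * a * w = c * t -> w^-1 * b * w = z -> c * z = z * c ->
   z * t = t * z)%g.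
Proof.
move=> ab wa wb cz; apply: (@mulgI _ c).
rewrite !mulgA cz -(mulgA z) -wa -wb !mulgA !mulgK.
by rewrite -(mulgA w^-1%g) -ab mulgA.
Qed.

(** [w] is the fixed point of [b], unique since [z] is not 1. Once it is moved to 0, [b] is a
    homothety, and the translation part of [a] must commute with it, hence vanishes. *)
Lemma straighten_linear (K : fieldType) (charK0 : [pchar K] =i pred0) n
    (L : 'M[K]_n) (z : K) s t (a b : polyAut K n) :
    L \in unitmx -> z != 0 -> z != 1 -> a = (aff L 0 * trans s)%g ->
    b = (aff z%:M 0 * trans t)%g -> (a * b = b * a)%g ->
  let w := (z^-1 - 1)^-1 *: t in (trans (- w) * a * (trans (- w))^-1 = aff L 0)%g.
Proof.
move=> LU z0 z1 aE bE ab /=; have zU := scalar_unit n z0.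
have [w wE] : exists w, w = (z^-1 - 1)^-1 *: t by exists ((z^-1 - 1)^-1 *: t).
rewrite -wE -(transN charK0) opprK.
have conjb : ((trans w)^-1 * b * trans w = aff z%:M 0)%g.
  rewrite bE -(transN charK0); apply: (act_eq charK0) => x.
  rewrite 3!actM (act_aff charK0 _ _ zU) (act_aff charK0 _ _ zU) !(act_trans charK0).
  rewrite !addr0 !mul_mx_scalar wE; apply/rowP => i; rewrite !mxE; field.
  by rewrite z0 mulN1r subr_eq0 eq_sym z1.
pose s' := s + w - w *m invmx L.
have conja : ((trans w)^-1 * a * trans w = aff L 0 * trans s')%g.
  rewrite aE -(transN charK0); apply: (act_eq charK0) => x.
  rewrite 4!actM (act_aff charK0 _ _ LU) (act_aff charK0 _ _ LU) !(act_trans charK0).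
  by rewrite /s' !addr0 !mulmxDl mulNmx mulmxKV // !addrA [_ + w *m L + _]addrAC.
have Lz : (aff L 0 * aff z%:M 0 = aff z%:M 0 * aff L 0 :> polyAut K n)%g.
  by rewrite -(affM charK0 zU LU) -(affM charK0 LU zU) mul_mx_scalar mul_scalar_mx.
have /(centralize_trans_scalar charK0 z0 z1) s'0 := conj_commute ab conja conjb Lz.
by rewrite (transN charK0) conja s'0 (trans0 charK0) mulg1.
Qed.

Section LinearPart.
Context (K : closedFieldType) (charK0 : [pchar K] =i pred0) (n : nat).
Local Notation Aut := (polyAut K n).
Local Notation SAut := (polySAut K n).
Local Notation point := 'rV[K]_n.

(** Take a root of [1 + X + ... + X^(m-1)]; at 1 this polynomial takes the value [m], nonzero in
    characteristic 0. *)
Lemma nontrivial_root_of_unity m : (1 < m)%N -> exists2 z : K, z != 1 & z ^+ m = 1.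
Proof.
move=> m1; pose p : {poly K} := \poly_(i < m) 1.
have sp : size p = m by rewrite size_poly_eq // oner_eq0.
have /closed_rootP[z /rootP] : size p != 1%N by rewrite sp gtn_eqF.
rewrite horner_poly => pz; exists z.
  apply/eqP => z1; move: pz; rewrite z1; under eq_bigr do rewrite expr1n mulr1.
  rewrite sumr_const card_ord => /eqP; rewrite (natf_eq0 charK0).
  by rewrite gtn_eqF // ltnW.
apply/eqP; rewrite -subr_eq0 subrX1; under eq_bigr do rewrite -[_ ^+ _]mul1r.
by rewrite pz mulr0.
Qed.

Context (theta : SAut -> Aut).
Hypothesis thetaM : {morph theta : h k / (h * k)%g}.
Hypothesis thetaT : forall v, theta (toSAut (trans v)) = trans v.

(* A scalar [z] with [z ^ n = 1] is central in [SL_n]; straightening it by a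
   translation straightens [SL_n]. *)
Lemma theta_linear : exists w, forall L : 'M[K]_n, \det L = 1 ->
  (trans w * theta (toSAut (aff L 0)) * (trans w)^-1 = aff L 0)%g.
Proof.
have kl L : \det L = 1 -> kappa (aff L 0 : Aut) = 1.
  by move=> L1; rewrite (kappa_aff charK0) ?det1_unitmx.
have thL L : \det L = 1 -> exists w, theta (toSAut (aff L 0)) = (aff L 0 * trans w)%g.
  move=> L1; apply: (theta_normalizes charK0 thetaM thetaT (kl L L1)) => v.
  by exists (v *m L); rewrite (aff_trans charK0) ?det1_unitmx.
have [n2|n1] := ltnP 1 n; last first.
  exists 0 => L L1; have -> : L = 1%:M.
    case: n n1 L L1 => [|[|]] // _ L; first by move=> _; apply/matrixP => -[].
    by rewrite [L]mx11_scalar det_scalar expr1 => ->.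
  by rewrite -/(trans 0) thetaT (trans0 charK0) invg1 !mulg1.
have [z z1 zn] := nontrivial_root_of_unity n2.
have z0 : z != 0.
  by apply: contra_eq_neq zn => ->; rewrite expr0n gtn_eqF 1?ltnW // eq_sym oner_eq0.
have Z1 : \det (z%:M : 'M[K]_n) = 1 by rewrite det_scalar.
have [t Ht] := thL _ Z1; exists (- ((z^-1 - 1)^-1 *: t)) => L L1.
have [s Hs] := thL L L1; have LU := det1_unitmx L1.
apply: (straighten_linear charK0 LU z0 z1 Hs Ht).
rewrite -(theta_toSAutM thetaM (kl L L1) (kl _ Z1)).
rewrite -(theta_toSAutM thetaM (kl _ Z1) (kl L L1)).
by rewrite -!(affM charK0) ?scalar_unit // mul_mx_scalar mul_scalar_mx.
Qed.

End LinearPart.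

(** * Inner automorphisms *)

Lemma conj_solve (G : groupType) (a b g w : G) :
  (w * (g^-1 * a * g) * w^-1 = b -> a = (g * w^-1) * b * (g * w^-1)^-1)%g.
Proof. by move=> <-; rewrite !invMg !invgK !mulgA !mulgVK !mulgK mulgV mul1g. Qed.

Lemma conj_morph (G H : groupType) (f : G -> H) (g : H) :
  {morph f : x y / (x * y)%g} -> {morph (fun x => g * f x * g^-1)%g : x y / (x * y)%g}.
Proof. by move=> fM x y; rewrite fM !mulgA mulgVK. Qed.

Section Inner.
Context (K : closedFieldType) (charK0 : [pchar K] =i pred0) (n : nat).
Local Notation Aut := (polyAut K n).
Local Notation SAut := (polySAut K n).

Lemma Int_morphism g : ind_morphism (Int g : Aut -> Aut).
Proof.
apply: ind_morphism_mul; last exact: ind_morphism_const.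
by apply: ind_morphism_mul; [apply: ind_morphism_const | apply: ind_morphism_id].
Qed.

Lemma IntM g : {morph Int g : f h / (f * h)%g : Aut}.
Proof. exact: (@conj_morph Aut Aut id). Qed.

Lemma IntK g : cancel (Int g : Aut -> Aut) (Int g^-1%g).
Proof. by move=> f; rewrite /Int invgK !mulgA mulVg mul1g mulgVK. Qed.

Lemma IntVK g : cancel (Int g^-1%g : Aut -> Aut) (Int g).
Proof. by move=> f; rewrite /Int invgK !mulgA mulgV mul1g mulgK. Qed.

Lemma kappa_Int g f : kappa (Int g f : Aut) = kappa f.
Proof.
rewrite /Int !kappaM mulrAC -kappaM mulgV kappa1 mul1r //.
Qed.

Section Hom.
Context (phi : SAut -> Aut).
Hypothesis phiM : {morph phi : h k / (h * k)%g}.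
Hypothesis phi_mor : ind_morphism phi.
Hypothesis phi_nontrivial : ~ (forall h, phi h = 1%g).

Theorem SAut_hom_inner : exists g, forall h, phi h = Int g (val h).
Proof.
have [g0 Hg0] := linearization charK0 phiM phi_mor phi_nontrivial.
pose theta0 (h : SAut) : Aut := (g0^-1 * phi h * g0)%g.
have theta0M : {morph theta0 : h k / (h * k)%g}.
  by move=> h k; rewrite /theta0 phiM !mulgA mulgK.
have theta0T v : theta0 (toSAut (trans v)) = trans v.
  by rewrite /theta0 -/(phiT phi v) Hg0 !mulgA mulVg mul1g mulgVK.
have [w Hw] := theta_linear charK0 theta0M theta0T.
(* Translations commute, so this second conjugation keeps them fixed. *)
pose theta (h : SAut) : Aut := (trans w * theta0 h * (trans w)^-1)%g.
have thetaM : {morph theta : h k / (h * k)%g} by apply: conj_morph.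
have thetaT v : theta (toSAut (trans v)) = trans v.
  by rewrite /theta theta0T -(transD charK0) addrC (transD charK0) mulgK.
have thetaS := theta_shear charK0 thetaM thetaT Hw.
pose g := (g0 * (trans w)^-1)%g; exists g.
have psiM : {morph (fun h : SAut => Int g (val h)) : h k / (h * k)%g}.
  by move=> h k; rewrite valSAutM IntM.
have psi_mor : ind_morphism (fun h : SAut => Int g (val h)).
  exact: ind_morphism_comp (Int_morphism g) (@val_ind_morphism K n).
have agr f : kappa f = 1 -> theta (toSAut f) = f ->
    agree phi (fun h : SAut => Int g (val h)) f.
  by rewrite /agree => f1 tf; rewrite (toSAutK f1); apply: conj_solve tf.
apply: (rigidity charK0 phiM psiM phi_mor psi_mor) => [L L1|v|i p pi0].
- apply: agr (Hw L L1); by rewrite (kappa_aff charK0) ?det1_unitmx.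
- exact: agr (kappa_trans charK0 v) (thetaT v).
exact: agr (kappa_shear charK0 pi0) (thetaS i p pi0).
Qed.

End Hom.

(** True by conversion: SAut has the filtration and the charts induced from Aut. *)
Lemma val_ind_morphism_inv (f : SAut -> SAut) :
  ind_morphism (fun h => val (f h)) -> ind_morphism f.
Proof. by []. Qed.

(** The homothety of ratio 2 excludes translations uniformly in [n], dimension 1 included. *)
Lemma centralize_Aut (u : Aut) : (forall f, u * f = f * u)%g -> u = 1%g.
Proof.
move=> uC; have uE := centralize_trans charK0 (fun v => uC (trans v)).
rewrite uE; suff -> : act u 0 = 0 by apply: trans0.
have two1 : 2%:R != 1 :> K.
  by rewrite -[1]/(1%:R) (inj_eq (natf_inj charK0)).
by apply: (centralize_trans_scalar charK0 (two_neq0 charK0) two1); rewrite -uE uC.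
Qed.

Lemma Int_uniq (g g' : Aut) (P : Aut -> Prop) :
    (forall u, (forall f, P f -> u * f = f * u)%g -> u = 1%g) ->
  (forall f, P f -> Int g f = Int g' f) -> g = g'.
Proof.
move=> cent gg'; have : (g'^-1 * g)%g = 1%g.
  apply: cent => f /gg'; rewrite /Int => e.
  have := congr1 (fun h => g'^-1 * h * g)%g e.
  by rewrite !mulgA mulgVK mulVg mul1g => ->.
by move/mulg1_eq; rewrite invgK.
Qed.

Lemma Int_iso g : ind_group_iso (Int g : Aut -> Aut).
Proof.
split; first by split; [apply: IntM | apply: Int_morphism].
exists (Int g^-1%g); split; last exact: IntVK; last exact: IntK.
by split; [apply: IntM | apply: Int_morphism].
Qed.

Lemma Int_iso_SAut g (phi : SAut -> SAut) :
    ind_group_hom phi -> (forall h, val (phi h) = Int g (val h)) ->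
  ind_group_iso phi.
Proof.
move=> phiH phiE; split=> //.
pose psi (h : SAut) := toSAut (Int g^-1%g (val h)).
have psiE h : val (psi h) = Int g^-1%g (val h).
  by rewrite toSAutK // kappa_Int kappa_val.
exists psi; split.
- split; last first.
    apply: val_ind_morphism_inv => d.
    have [e [He Hr]] := ind_morphism_comp (Int_morphism g^-1%g) (@val_ind_morphism K n) d.
    exists e; split=> [h hd|j]; first by rewrite psiE; apply: He.
    by apply: reg_ext (Hr j) => h _; rewrite psiE.
  by move=> h k; apply: val_inj; rewrite psiE !valSAutM IntM !psiE.
- by move=> h; apply: val_inj; rewrite psiE phiE IntK.
by move=> h; apply: val_inj; rewrite phiE psiE IntVK.
Qed.

End Inner.

(** * Low dimensions, and the passage from SAut to Aut *)

Lemma polyAut0_eq (K : fieldType) (charK0 : [pchar K] =i pred0)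
  (f g : polyAut K 0) : f = g.
Proof. by apply: (act_eq charK0) => x; apply/rowP => -[]. Qed.

(** In one variable the Jacobian determinant is the derivative, a nonzero constant. *)
Lemma polyAut1_affine (K : fieldType) (charK0 : [pchar K] =i pred0)
    (f : polyAut K 1) :
  exists v L, L \in unitmx /\ f = (trans v * aff L 0)%g.
Proof.
have k0 := kappa_neq0 f.
pose p := tnth (polyAut_map f) 0; have LU := @scalar_unit K 1 _ k0.
have dp i : (p - kappa f *: 'X_0)^`M(i) = 0.
  rewrite !ord1 mderivB mderivZ mderivXU eqxx.
  have := jdetE f; rewrite /jdet det_mx11 mxE -/p => ->.
  by rewrite -mul_mpolyC mulr1 subrr.
have pE := mderiv_eq0_const charK0 dp.
exists (const_mx (p - kappa f *: 'X_0)@_0%MM), (kappa f)%:M; split=> //.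
apply: (act_eq charK0) => x; rewrite actM (act_trans charK0) (act_aff charK0) //.
apply/rowP => i; rewrite addr0 mul_mx_scalar !ord1 !mxE -/p.
have := congr1 (meval (x ord0)) pE; rewrite mevalC mevalB mevalZ mevalXU => <-.
by rewrite addrC subrK.
Qed.

Lemma conj_intertwine (G : groupType) (f g p s : G) :
  (p * (g * s * g^-1) = g * (f * s * f^-1) * g^-1 * p ->
   f^-1 * (g^-1 * p * g) * s = s * (f^-1 * (g^-1 * p * g)))%g.
Proof.
move=> e; apply: (@mulgI _ (g * f)%g); apply: (@mulIg _ g^-1%g).
have -> : (g * f * (f^-1 * (g^-1 * p * g) * s) * g^-1 = p * (g * s * g^-1))%g.
  by rewrite !mulgA mulgK mulgV mul1g.
by rewrite e !mulgA mulgK.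
Qed.

Section AutHom.
Context (K : closedFieldType) (charK0 : [pchar K] =i pred0) (n : nat).
Local Notation Aut := (polyAut K n).
Local Notation SAut := (polySAut K n).
Local Notation point := 'rV[K]_n.

Lemma trans_inj : injective (@trans K n).
Proof.
move=> v w /(congr1 (fun f => act f 0)).
by rewrite !(act_trans charK0) !add0r.
Qed.

Context (phi : Aut -> Aut).
Hypothesis phiM : {morph phi : f h / (f * h)%g}.
Hypothesis phi_mor : ind_morphism phi.
Hypothesis phi_inj : injective phi.

Lemma Aut_hom_on_SAut : (0 < n)%N ->
  exists g, forall h : SAut, phi (val h) = Int g (val h).
Proof.
move=> n0.
have M : {morph (fun h : SAut => phi (val h)) : h k / (h * k)%g}.
  by move=> h k; rewrite valSAutM phiM.
apply: (SAut_hom_inner charK0 M).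
  exact: ind_morphism_comp phi_mor (@val_ind_morphism K n).
move=> triv; pose i := Ordinal n0; pose e : point := delta_mx 0 i.
have phi1 : phi 1%g = 1%g by apply: (@mulgI _ (phi 1%g)); rewrite -phiM !mulg1.
have := triv (toSAut (trans e)); rewrite (toSAutK (kappa_trans charK0 e)) -phi1.
move=> /phi_inj; rewrite -(trans0 charK0) => /trans_inj /rowP /(_ i) /eqP.
by rewrite !mxE !eqxx oner_eq0.
Qed.

(** Normality of SAut: [f] and [g^-1 * phi f * g] induce the same conjugation on it, so their
    quotient centralizes it. *)
Lemma conj_kernel g f : (forall h : SAut, phi (val h) = Int g (val h)) ->
  forall s, kappa s = 1%R ->
    (f^-1 * (g^-1 * phi f * g) * s = s * (f^-1 * (g^-1 * phi f * g)))%g.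
Proof.
move=> phiE s s1; have phiE' t : kappa t = 1%R -> phi t = (g * t * g^-1)%g.
  by move=> t1; rewrite -(toSAutK t1) phiE.
have fs : kappa (Int f s) = 1 by rewrite kappa_Int.
have e : (phi f * phi s = phi (Int f s) * phi f)%g.
  by rewrite -!phiM /Int mulgVK.
rewrite (phiE' _ s1) (phiE' _ fs) /Int in e.
exact: conj_intertwine e.
Qed.

Lemma Aut_hom_inner : exists g, forall f, phi f = Int g f.
Proof.
have [n0|n0] := posnP n.
  have eq0 (f h : Aut) : f = h by move: f h; rewrite n0; apply: polyAut0_eq.
  by exists 1%g => f; apply: eq0.
have [g Hg] := Aut_hom_on_SAut n0; have Hc f := conj_kernel f Hg.
have solve f : (f^-1 * (g^-1 * phi f * g) = 1)%g -> phi f = Int g f.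
  move/mulg1_eq; rewrite invgK => fE.
  by rewrite /Int [in RHS]fE !mulgA mulgV mul1g mulgK.
have [n1|n1] := ltnP 1 n.
  exists g => f; apply: solve; apply: (centralize_SAut charK0 n1) => s s1.
  exact: Hc.
(* In dimension 1, translations have too large a centralizer, so that the
   homothety of ratio 2 must be straightened as well. *)
pose theta (f : Aut) : Aut := (g^-1 * phi f * g)%g.
have thetaM : {morph theta : f h / (f * h)%g}.
  by move=> f h; rewrite /theta phiM !mulgA mulgK.
have thetaE f : exists w, theta f = (f * trans w)%g.
  exists (act (f^-1 * theta f)%g 0); rewrite -centralize_trans ?mulVKg // => v.
  exact: Hc (kappa_trans charK0 v).
have thetaT v : theta (trans v) = trans v.
  rewrite /theta -(toSAutK (kappa_trans charK0 v)) Hg /Int.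
  by rewrite !mulgA mulVg mul1g mulgVK.
have two0 := two_neq0 charK0; have U2 := scalar_unit n two0.
have two1 : 2%:R != 1 :> K by rewrite -[1]/(1%:R) (inj_eq (natf_inj charK0)).
have [t Ht] := thetaE (aff 2%:R%:M 0); pose w := (2%:R^-1 - 1)^-1 *: t.
have linE L : L \in unitmx ->
    (trans (- w) * theta (aff L 0) * (trans (- w))^-1 = aff L 0)%g.
  move=> LU; have [s Hs] := thetaE (aff L 0).
  apply: (straighten_linear charK0 LU two0 two1 Hs Ht).
  rewrite -!thetaM -(affM charK0 U2 LU) -(affM charK0 LU U2).
  by rewrite mul_mx_scalar mul_scalar_mx.
exists (g * (trans (- w))^-1)%g => f; apply: conj_solve.
(* On the line it is enough to treat translations and linear maps, and conjugation by a translation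
   does not disturb the former. *)
have [v [L [LU ->]]] : exists v L, L \in unitmx /\ f = (trans v * aff L 0)%g.
  have n1' : n = 1%N by apply/eqP; rewrite eqn_leq n1.
  by move: f; rewrite n1' => f; apply: polyAut1_affine.
rewrite -/(theta _) thetaM thetaT -[in RHS](linE L LU) !mulgA.
by rewrite -!(transD charK0) addrC.
Qed.

End AutHom.

(** In dimension 1, SAut is the group of translations, which centralizes itself: there [g] is
    determined only up to a translation on its right, whence the condition [n <> 1] on uniqueness in
    the second part. *)
Theorem theorem1p5 (K : closedFieldType) (charK0 : [pchar K]%R =i pred0)
    (n : nat) :
  (forall phi : polyAut K n -> polyAut K n,
      ind_group_hom phi -> injective phi ->
    ind_group_iso phi /\
    exists! g : polyAut K n, forall h : polyAut K n, phi h = Int g h) /\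
  (forall phi : polySAut K n -> polySAut K n,
      ind_group_hom phi -> ~ (forall h : polySAut K n, phi h = 1%g) ->
    ind_group_iso phi /\
    exists g : polyAut K n,
      (forall h : polySAut K n, polySAut_val (phi h) = Int g (polySAut_val h)) /\
      (n <> 1 -> forall g' : polyAut K n,
         (forall h : polySAut K n,
            polySAut_val (phi h) = Int g' (polySAut_val h)) ->
         g = g')).
Proof.
split=> phi [phiM phi_mor].
  move=> phi_inj; have [g Hg] := Aut_hom_inner charK0 phiM phi_mor phi_inj.
  split.
    have [[IM Im] [psi [psiH psiK psiVK]]] := Int_iso g.
    split; first by split.
    exists psi; split=> // h; first by rewrite Hg psiK.
    by rewrite Hg psiVK.
  exists g; split=> // g' Hg'; apply: (Int_uniq (P := fun=> True)).
    by move=> u uC; apply: (centralize_Aut charK0) => f; apply: uC.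
  by move=> f _; rewrite -Hg Hg'.
move=> phi_nontrivial.
have M : {morph (fun h => val (phi h)) : h k / (h * k)%g}.
  by move=> h k; rewrite phiM valSAutM.
have [g Hg] : exists g, forall h, val (phi h) = Int g (val h).
  apply: (SAut_hom_inner charK0 M).
    exact: ind_morphism_comp (@val_ind_morphism K n) phi_mor.
  move=> triv; apply: phi_nontrivial => h.
  by apply: val_inj; rewrite triv valSAut1.
split; first exact: (Int_iso_SAut (conj phiM phi_mor) Hg).
exists g; split=> // n1 g' Hg'.
have [n2|n0] := ltnP 1 n; last first.
  have n0' : n = 0%N.
    by case: n n0 n1 {phi phiM phi_mor phi_nontrivial M g Hg g' Hg'} => [|[|]].
  by move: g g' {Hg Hg'}; rewrite n0' => g g'; apply: polyAut0_eq.
apply: (Int_uniq (P := fun f => kappa f = 1%R)) => [u|f f1].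
  exact: centralize_SAut.
by rewrite -(toSAutK f1) -Hg -Hg'.
Qed.
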